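(* Let $\alpha>1$. Then, for any $E\in\left(0,\frac{2}{11}\left[(1-\alpha^{-1})\wedge\frac12\right]\right)$, $K\in(0,\infty)$, $0<T_1<T_2<\infty$ and $t>0$, it holds that $$\sup_{x\in\mathbb R}\bigl|P_0(X_t\le x)-P^n_0(X^n_t\le x)\bigr|=O(n^{-E})\qquad(n\to\infty),$$ and $$\lim_{n\to\infty}n^{\frac23E}\sup_{\substack{|x|\le K\\ t\in[T_1,T_2]}}\left|p(t,0,x)-p_n\left(t,0,\frac{\lfloor nx\rfloor}{n}\right)\right|=0,$$ $\mathbb P$-almost surely.
   Context: One-dimensional Bouchaud trap model. $(\tau_x)_{x\in\mathbb Z}$ are i.i.d. random variables on a probability space with probability $\mathbb P$ and expectation $\mathbb E$, with $\mathbb P(\tau_0\ge u)=u^{-\alpha}$ for $u>1$. For a realization of $(\tau_x)$, put $\mu_n=\frac1n\sum_{x\in\mathbb Z}\tau_x\delta_{x/n}$ on $n^{-1}\mathbb Z$ and $\mu=\mathbb E[\tau_0]\,dx$ on $\mathbb R$. $X^n=(X^n_t)$, with law $P^n_a$ when started from $a\in n^{-1}\mathbb Z$, is the Markov process associated with $n^{-1}\mathbb Z$ equipped with the Euclidean metric (as resistance metric) and $\mu_n$, i.e. the continuous-time chain with generator $\Delta_nf(x/n)=\frac{n^2}{\tau_x}\sum_{y:|y-x|=1}(f(y/n)-f(x/n))$ (Dirichlet form $\sum_xn(f(\frac{x+1}n)-f(\frac xn))^2$ on $L^2(\mu_n)$). $X=(X_t)$, with law $P_a$, is the process associated with $\mathbb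 R$ with the Euclidean metric and $\mu$, i.e. the diffusion with Dirichlet form $\int|f'|^2dx$ on $L^2(\mu)$ and generator $\frac1{\mathbb E[\tau_0]}\frac{d^2}{dx^2}$ (a deterministically time-scaled Brownian motion). $p(t,x,y)$ and $p_n(t,x,y)$ are the transition densities (heat kernels) of $X$ and $X^n$ with respect to $\mu$ and $\mu_n$ respectively. *)

(* Defs.v *)
From mathcomp Require Export all_boot all_order all_algebra.
From mathcomp Require Export finmap.
From mathcomp Require Export all_classical all_reals all_analysis.

Set Implicit Arguments.
Unset Strict Implicit.
Unset Printing Implicit Defensive.

Import Order.TTheory GRing.Theory Num.Theory.
Import numFieldNormedType.Exports.

Local Open Scope classical_set_scope.
Local Open Scope ring_scope.

(** * The random environment *)

Section environment.
Context {R : realType} {d : measure_display} {T : measurableType d}.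
Variables (P : probability T R) (tau : int -> {RV P >-> R}).

Definition mutually_independent : Prop :=
  forall (J : {fset int}) (B : int -> set R),
    (forall x, measurable (B x)) ->
    P (\bigcap_(x in [set` J]) (tau x @^-1` B x)) =
    (\prod_(x <- J) P (tau x @^-1` B x))%E.

Definition identically_distributed : Prop :=
  forall (x y : int) (B : set R), measurable B ->
    distribution P (tau x) B = distribution P (tau y) B.

Definition bouchaud_environment (alpha : R) : Prop :=
  [/\ mutually_independent,
      identically_distributed &
      forall u : R, 1 < u ->
        P [set w | u <= tau 0 w] = (u `^ (- alpha))%:E].

Definition mean_trap : R := fine 'E_P[tau 0].

End environment.

(** * Time-homogeneous Markov processes on a subset of the line

  A process is given by the family [P] of its laws, [P a] being the law when
  started from [a], together with the maps [X t], which are only meaningful for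
  [0 <= t]. Its state space [S] is a subset of [R]; nothing is required of the
  laws [P a] with [a] outside [S] beyond measurability in [a]. *)

Section markov.
Context {R : realType} {d : measure_display} {Om : measurableType d}.
Variables (S : set R) (P : R.-pker (measurableTypeR R) ~> Om) (X : R -> Om -> R).

Definition natural_filtration (s : R) : set (set Om) :=
  <<s [set A | exists u, [/\ 0 <= u, u <= s &
         exists2 B : set R, measurable B & A = X u @^-1` B]] >>.

Definition markov_property : Prop :=
  forall (a s t : R) (A : set Om) (B : set R),
    S a -> 0 <= s -> 0 <= t -> natural_filtration s A -> measurable B ->
    P a (A `&` X (s + t) @^-1` B) =
    (\int[P a]_(w in A) P (X s w) (X t @^-1` B))%E.

Definition markov_process : Prop :=
  [/\ forall t, 0 <= t -> measurable_fun setT (X t),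
      forall t w, 0 <= t -> S (X t w),
      forall a, S a -> P a (X 0 @^-1` [set a]) = 1%E &
      markov_property].

(** [L] is the generator of the process on the test functions [D], in the sense
  of Feller semigroups: the difference quotients of the transition semigroup
  converge uniformly over the state space. *)
Definition has_generator (D : set (R -> R)) (L : (R -> R) -> R -> R) : Prop :=
  forall f, D f -> forall e, 0 < e ->
    \forall t \near 0^'+, forall x, S x ->
      `| (Rintegral (P x) setT (f \o X t) - f x) / t - L f x | <= e.

Definition continuous_paths : Prop :=
  forall w, {within `[0, +oo[, continuous (X ^~ w)}.

Definition cadlag_paths : Prop :=
  forall w,
    (forall t, 0 <= t -> X s w @[s --> t^'+] --> X t w) /\
    (forall t, 0 < t -> cvg (X s w @[s --> t^'-])).

(** The transition density with respect to [mu], in its jointly continuous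
  version (the one for which pointwise values make sense). *)
Definition is_heat_kernel (mu : {measure set (measurableTypeR R) -> \bar R})
    (p : R -> R -> R -> R) : Prop :=
  [/\ forall t x y, 0 < t -> S x -> S y -> 0 <= p t x y,
      {within [set z : R * R * R | [/\ 0 < z.1.1, S z.1.2 & S z.2]],
        continuous (fun z => p z.1.1 z.1.2 z.2)} &
      forall t x (A : set R), 0 < t -> S x -> measurable A ->
        P x (X t @^-1` A) = (\int[mu]_(y in A `&` S) (p t x y)%:E)%E].

Definition prob_le (a t x : R) : R := fine (P a [set w | X t w <= x]).

End markov.

(** * The limiting diffusion *)

Section diffusion.
Context {R : realType}.

Definition bounded_support (f : R -> R) : Prop :=
  exists M, forall x, M < `|x| -> f x = 0.

Definition C2c : set (R -> R) :=
  [set f : R -> R | [/\ forall x : R, derivable f x 1,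
                        forall x : R, derivable (derive1 f) x 1,
                        continuous (derive1 (derive1 f)) &
                        bounded_support f]].

Definition is_diffusion (m : R) (d : measure_display) (Om : measurableType d)
    (P : R.-pker (measurableTypeR R) ~> Om) (X : R -> Om -> R) : Prop :=
  [/\ markov_process setT P X,
      continuous_paths X &
      has_generator setT P X C2c (fun f x => m^-1 * derive1 (derive1 f) x)].

(** The absolute value, here and in [lattice_measure], only serves to make the
  scaling factor syntactically nonnegative: mean and traps are a.s. positive
  for a Bouchaud environment. *)
Definition scaled_lebesgue (m : R) : {measure set (measurableTypeR R) -> \bar R} :=
  mscale (`|m|%:nng) (@lebesgue_measure R).

End diffusion.

(** * The trap model on the lattice of mesh [1/n], in a fixed environment *)

Section chain.
Context {R : realType}.
Variables (n : nat) (tau : int -> R).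

Definition site (k : int) : R := k%:~R / n%:R.

Definition lattice : set R := range site.

(** The sum over [int] is split according to its constructors, [Posz k] being
  [k] and [Negz k] being [-(k+1)]. *)
Definition lattice_measure : {measure set (measurableTypeR R) -> \bar R} :=
  let atom (k : int) : {measure set (measurableTypeR R) -> \bar R} :=
    mscale (`|tau k / n%:R|%:nng) (dirac (site k : measurableTypeR R)) in
  measure_add (mseries (fun k : nat => atom (Posz k)) 0)
              (mseries (fun k : nat => atom (Negz k)) 0).

(** Only used at lattice points [x = site k], where [Num.floor (n%:R * x) = k]. *)
Definition trap_generator (f : R -> R) (x : R) : R :=
  n%:R ^+ 2 / tau (Num.floor (n%:R * x)) *
    ((f (x + n%:R^-1) - f x) + (f (x - n%:R^-1) - f x)).

Definition is_trap_chain (d : measure_display) (Om : measurableType d)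
    (P : R.-pker (measurableTypeR R) ~> Om) (X : R -> Om -> R) : Prop :=
  [/\ markov_process lattice P X,
      cadlag_paths X &
      has_generator lattice P X bounded_support trap_generator].

End chain.

(* Main.v *)
Require Import Defs.
From HB Require Import structures.
From mathcomp Require Import measurable_realfun.
From mathcomp Require Import ring lra zify.

(** Both processes reduce to explicit objects, and the environment enters through a
  single quantity.

  The diffusion. If [heat_cdf] is the Gaussian distribution function of variance
  [2 * r], then [heat_cdf (r0 + (t - s) / m) (x - y)] solves the backward equation of
  the diffusion, so that its expectation along the process is constant in [s]. The
  cutoff which makes it an admissible test function has a vanishing effect, and
  letting [r0] tend to [0] gives the law of the process at time [t]
  ([diffusion_cdf]); the density follows by continuity ([diffusion_density]).

  The chain. Its generator, applied to indicators of sites, yields the forward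
  equation of the densities [u k t] with respect to the speed measure
  ([chain_forward_solution]). Integrated in time, they become the occupation
  densities [U k t], which are smoother: they solve a heat equation with a bounded
  source at the starting point. Their candidate limit is the occupation density of
  Brownian motion, [heat_potential] minus the positive part of the position. Shift
  this limit by [eps ^+ 2] in time, and correct it by the second primitive of
  [tau k / m - 1] times the heat kernel: if the sums of [tau k - m] over [k] sites
  are at most [delta * (n + k)], the result solves the equation of the chain up to
  an error whose time integral is of order [delta / eps]. The maximum principle, and
  the choice of [eps] as the square root of [delta], give an error of order
  [eta ^+ 2] for the occupation densities, where [delta = eta ^+ 4]
  ([occupation_comparison]).

  From occupation densities to the two quantities of the theorem there is one
  differentiation, in space for the distribution function and in time for the
  density. Differentiating a uniform estimate requires monotonicity of the
  derivative, and costs a square root. In space, [U] plus the positive part is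
  convex, because its gradient is a distribution function
  ([occupation_cdf_estimate]). In time, reversibility and the contractivity of the
  semigroup show that the densities [p(a,a) + p(b,b) + 2 p(a,b)] and
  [p(a,a) + p(b,b) - 2 p(a,b)] decrease, and [p(a,b)] is a quarter of their
  difference ([density_estimate]). Both errors are therefore of order [eta].

  The environment. The traps have moments of every order less than [alpha]. Truncating
  at dyadic levels, bounding the maximum of the partial sums by sums over dyadic
  blocks, and applying the inequalities of Boole and Chebyshev and the lemma of Borel
  and Cantelli, the sums over [k] sites deviate almost surely from their mean by at
  most a multiple of [k `^ (1 - a)], for every [a] less than the minimum of
  [1 - alpha^-1] and [1 / 2] ([trap_sum_rate]). Hence [delta] is of order
  [n `^ (- a)] and [eta] of order [n `^ (- (a / 4))]. The hypothesis on [E] makes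
  [a = 5 * E] an admissible exponent, and [n `^ (- (5 / 4 * E))] is smaller than both
  [n `^ (- E)] and [n `^ (- (2 / 3 * E))]. *)

Set Implicit Arguments.
Unset Strict Implicit.
Unset Printing Implicit Defensive.

Import Order.TTheory GRing.Theory Num.Theory.
Import numFieldNormedType.Exports.

Local Open Scope classical_set_scope.
Local Open Scope ring_scope.

(** * Elementary calculus and the parabolic maximum principle *)

Section calculus.
Context {R : realType}.
Implicit Types (f g : R -> R).

Lemma is_derive1_eps f (s l : R) :
  (forall e : R, 0 < e -> exists2 d : R, 0 < d & forall h : R, h != 0 -> `|h| < d ->
     `|f (s + h) - f s - h * l| <= e * `|h|) ->
  is_derive s 1 f l.
Proof.
move=> H.
have C : (fun h : R => h^-1 *: ((f \o shift s) (h *: 1) - f s)) @ 0^' --> l.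
  apply/cvgrPdist_le => e e0; have [d d0 Hd] := H _ e0.
  near=> h.
  have h0 : h != 0 by near: h; exact: nbhs_dnbhs_neq.
  have hd : `|h| < d by near: h; exact: dnbhs0_lt.
  rewrite /= distrC.
  have -> : h^-1 *: (f (h *: 1 + s) - f s) - l =
     h^-1 * (f (s + h) - f s - h * l).
    by rewrite /GRing.scale/= mulr1 (addrC h s); field.
  rewrite normrM normfV ler_pdivrMl ?normr_gt0// (mulrC _ e).
  exact: Hd.
by apply: DeriveDef; [apply/cvg_ex; exists l | apply: cvg_lim].
Unshelve. all: by end_near. Qed.

Lemma is_derive1_lim f (s l : R) : is_derive s 1 f l ->
  (fun h : R => h^-1 * (f (s + h) - f s)) @ 0^' --> l.
Proof.
move=> [/cvg_ex[l' /= fl'] <-].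
rewrite /derive (cvg_lim _ fl')//.
apply: cvg_trans fl'; apply: near_eq_cvg; near=> h.
by rewrite /= /GRing.scale/= mulr1 (addrC h s).
Unshelve. all: by end_near. Qed.

Lemma is_derive1_continuous f (s l : R) : is_derive s 1 f l ->
  {for s, continuous f}.
Proof.
by move=> [/derivable1_diffP/differentiable_continuous].
Qed.

Lemma derE f (x a b : R) : a = b -> is_derive x 1 f a -> is_derive x 1 f b.
Proof. by move=> ->. Qed.

Lemma derD f g (x a b : R) : is_derive x 1 f a -> is_derive x 1 g b ->
  is_derive x 1 (fun t => f t + g t) (a + b).
Proof. by move=> ? ?; exact: is_deriveD. Qed.

Lemma derB f g (x a b : R) : is_derive x 1 f a -> is_derive x 1 g b ->
  is_derive x 1 (fun t => f t - g t) (a - b).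
Proof. by move=> ? ?; exact: is_deriveB. Qed.

Lemma derN f (x a : R) : is_derive x 1 f a ->
  is_derive x 1 (fun t => - f t) (- a).
Proof. by move=> ?; exact: is_deriveN. Qed.

Lemma derM f g (x a b : R) : is_derive x 1 f a -> is_derive x 1 g b ->
  is_derive x 1 (fun t => f t * g t) (a * g x + f x * b).
Proof.
move=> da db; have := is_deriveM da db.
by rewrite /GRing.scale/= addrC (mulrC (g x)).
Qed.

Lemma derZ f (x c a : R) : is_derive x 1 f a ->
  is_derive x 1 (fun t => c * f t) (c * a).
Proof. by move=> ?; exact: (@is_deriveZ _ _ _ f c). Qed.

Lemma derC (x c : R) : is_derive x 1 (fun _ : R => c) 0.
Proof. exact: is_derive_cst. Qed.

Lemma derI (x : R) : is_derive x 1 (fun t : R => t) 1.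
Proof. exact: is_derive_id. Qed.

Lemma derV (x : R) : x != 0 -> is_derive x 1 (fun t : R => t^-1) (- x^-2).
Proof.
move=> x0; have := @is_deriveV R idfun x 1 1 x0 (is_derive_id x 1).
by rewrite /GRing.scale/= mulr1.
Qed.

Lemma derX f (x a : R) n : is_derive x 1 f a ->
  is_derive x 1 (fun t => f t ^+ n.+1) (n.+1%:R * f x ^+ n * a).
Proof.
move=> da; have -> : (fun t => f t ^+ n.+1) = f ^+ n.+1.
  by apply/funext => t; rewrite exprfctE.
exact: is_deriveX.
Qed.

Lemma derS (x : R) : 0 < x ->
  is_derive x 1 (fun t : R => Num.sqrt t) (2 * Num.sqrt x)^-1.
Proof. exact: is_derive1_sqrt. Qed.

Lemma der_comp f g (x a b : R) : is_derive (g x) 1 f a -> is_derive x 1 g b ->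
  is_derive x 1 (fun t => f (g t)) (a * b).
Proof. exact: is_derive1_comp. Qed.

Lemma mean_value_le f (df : R -> R) (a b c : R) : a <= b ->
  {within `[a, b], continuous f} ->
  (forall x, a < x < b -> is_derive x 1 f (df x)) ->
  (forall x, a < x < b -> df x <= c) -> f b - f a <= c * (b - a).
Proof.
rewrite le_eqVlt => /predU1P[->|ab] fc fd dfc; first by rewrite !subrr mulr0.
have fd' (x : R) : x \in `]a, b[ -> is_derive x 1 f (df x).
  by rewrite in_itv/=; exact: fd.
have [x + ->] := MVT ab fd' fc.
by rewrite in_itv/= => xab; rewrite ler_pM2r ?subr_gt0//; exact: dfc.
Qed.

Lemma mean_value_ge f (df : R -> R) (a b c : R) : a <= b ->
  {within `[a, b], continuous f} ->
  (forall x, a < x < b -> is_derive x 1 f (df x)) ->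
  (forall x, a < x < b -> c <= df x) -> c * (b - a) <= f b - f a.
Proof.
rewrite le_eqVlt => /predU1P[->|ab] fc fd dfc; first by rewrite !subrr mulr0.
have fd' (x : R) : x \in `]a, b[ -> is_derive x 1 f (df x).
  by rewrite in_itv/=; exact: fd.
have [x + ->] := MVT ab fd' fc.
by rewrite in_itv/= => xab; rewrite ler_pM2r ?subr_gt0//; exact: dfc.
Qed.

Lemma mean_value_norm f (df : R -> R) (a b c : R) : a <= b ->
  {within `[a, b], continuous f} ->
  (forall x, a < x < b -> is_derive x 1 f (df x)) ->
  (forall x, a < x < b -> `|df x| <= c) -> `|f b - f a| <= c * (b - a).
Proof.
move=> ab fc fd dfc; rewrite ler_norml; apply/andP; split.
  rewrite -mulNr; apply: (mean_value_ge (df := df)) => // x /dfc.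
  by rewrite ler_norml => /andP[].
apply: (mean_value_le (df := df)) => // x /dfc.
by rewrite ler_norml => /andP[].
Qed.

Lemma mean_value_dist f (df : R -> R) (a b c : R) :
  (forall x, a <= x <= b -> is_derive x 1 f (df x)) ->
  (forall x, a <= x <= b -> `|df x| <= c) ->
  forall x y, a <= x <= b -> a <= y <= b -> `|f x - f y| <= c * `|x - y|.
Proof.
move=> fd dfc x y; wlog yx : x y / y <= x => [H xab yab|].
  have [yx|/ltW xy] := leP y x; first exact: H.
  by rewrite distrC (distrC x); exact: H.
move=> /andP[_ xb] /andP[ay _]; rewrite (@ger0_norm _ (x - y)) ?subr_ge0//.
apply: (mean_value_norm (df := df)) => // [|z /andP[yz zx]|z /andP[yz zx]].
- apply: derivable_within_continuous => z; rewrite in_itv/= => /andP[yz zx].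
  by have [] := fd z ltac:(by rewrite (le_trans ay yz) (le_trans zx xb)).
- by apply: fd; rewrite (le_trans ay (ltW yz)) (le_trans (ltW zx) xb).
- by apply: dfc; rewrite (le_trans ay (ltW yz)) (le_trans (ltW zx) xb).
Qed.

Lemma is_derive1_epsE f (s l : R) : is_derive s 1 f l ->
  forall e : R, 0 < e -> exists2 d : R, 0 < d & forall h : R, `|h| < d ->
     `|f (s + h) - f s - h * l| <= e * `|h|.
Proof.
move=> /is_derive1_lim fl e e0.
have /cvgrPdist_le/(_ e e0) := fl.
rewrite near_withinE => /nbhs_normP[d /= d0 Hd].
exists d => // h hd.
have [->|h0] := eqVneq h 0; first by rewrite addr0 subrr mul0r subrr !normr0 mulr0.
have := Hd h; rewrite /= sub0r normrN => /(_ hd h0).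
rewrite distrC.
have -> : f (s + h) - f s - h * l = h * (h^-1 * (f (s + h) - f s) - l).
  by rewrite mulrBr mulrA divff// mul1r.
by rewrite normrM (mulrC e) => H; rewrite ler_wpM2l.
Qed.

Lemma derive_at_left_max f (s l a : R) : a < s ->
  is_derive s 1 f l -> (forall x, a <= x < s -> f x <= f s) -> 0 <= l.
Proof.
move=> as_ /is_derive1_epsE fl H; rewrite leNgt; apply/negP => l0.
have [|d d0 Hd] := fl (- l / 2); first by lra.
pose h := - (Num.min (d / 2) (s - a)).
have hlt0 : h < 0 by rewrite /h oppr_lt0 lt_min; apply/andP; split; lra.
have hd : - (d / 2) <= h by rewrite lerN2 ge_min lexx.
have ha : a - s <= h by rewrite /h -opprB lerN2 ge_min lexx orbT.
have := Hd h; rewrite ltr0_norm// => /(_ ltac:(lra)).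
rewrite ler_norml => /andP[+ _].
have := H (s + h) ltac:(apply/andP; split; lra).
move=> A B; have : h * l <= - l / 2 * (- h) by lra.
by nra.
Qed.

Lemma uniform_right_derivative_lipschitz f (c : R -> R) (B : R) :
  (forall e : R, 0 < e -> exists2 d : R, 0 < d & forall s h : R, 0 <= s -> 0 < h < d ->
     `|f (s + h) - f s - h * c s| <= e * h) ->
  (forall s : R, 0 <= s -> `|c s| <= B) ->
  exists2 d : R, 0 < d & forall s h : R, 0 <= s -> 0 <= h < d ->
     `|f (s + h) - f s| <= (B + 1) * h.
Proof.
move=> H cB; have [d d0 Hd] := H 1 ltr01.
exists d => // s h s0 /andP[]; rewrite le_eqVlt => /predU1P[<-|h0] hd.
  by rewrite addr0 subrr normr0 mulr0.
have := Hd s h s0; rewrite h0 hd => /(_ isT).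
have := cB s s0.
move=> cBs H1.
have -> : f (s + h) - f s = (f (s + h) - f s - h * c s) + h * c s by ring.
apply: (le_trans (ler_normD _ _)).
rewrite normrM (gtr0_norm h0) mulrDl mul1r addrC lerD//; last by rewrite mul1r in H1.
by rewrite mulrC ler_pM2r.
Qed.

Lemma locally_lipschitz_continuous f (B d : R) : 0 < d ->
  (forall s h : R, 0 <= s -> 0 <= h < d -> `|f (s + h) - f s| <= B * h) ->
  continuous (fun t : R => f `|t|).
Proof.
move=> d0 H t; apply/cvgrPdist_le => e e0 /=.
have [B1 [B10 BB1]] : exists B1, 0 < B1 /\ B <= B1.
  by exists (`|B| + 1); rewrite ltr_wpDl//; split => //; have := ler_norm B; lra.
near=> x.
have xd : `|t - x| < Num.min d (e / B1).
  by near: x; apply: cvgr_dist_lt => //; rewrite lt_min d0 divr_gt0.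
have D : `| `|x| - `|t| | <= `|t - x| by rewrite (distrC t); exact: ler_dist_dist.
move: xd; rewrite lt_min => /andP[xd xe].
have K : forall a b, 0 <= a -> a <= b -> `|a - b| <= `|t - x| -> `|f a - f b| <= e.
  move=> a b a0 ab abx.
  have E : `|a - b| = b - a by rewrite distrC ger0_norm// subr_ge0.
  have := H a (b - a) a0; rewrite subr_ge0 ab/= -E (le_lt_trans abx xd) => /(_ isT).
  rewrite E (addrC a) subrK distrC => /le_trans; apply.
  apply: (@le_trans _ _ (B1 * (b - a))); first by rewrite ler_wpM2r// subr_ge0.
  by rewrite mulrC -ler_pdivlMr// ltW// -E (le_lt_trans abx).
have [tx|xt] := leP `|t| `|x|; first by apply: K => //; rewrite distrC.
by rewrite distrC; apply: K => //; exact: ltW.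
Unshelve. all: by end_near. Qed.

(** The generator of a process only gives forward difference quotients, but
  gives them uniformly in the base point: if the limit is continuous, comparing
  the quotients at [s] and at [s - h] shows that the backward ones converge too.
  A function of a nonnegative time is extended to the line by reflection. *)
Lemma uniform_right_derivative_is_derive f (c : R -> R) (B : R) :
  (forall e : R, 0 < e -> exists2 d : R, 0 < d & forall s h : R, 0 <= s -> 0 < h < d ->
     `|f (s + h) - f s - h * c s| <= e * h) ->
  (forall s : R, 0 <= s -> `|c s| <= B) ->
  continuous (fun t : R => c `|t|) ->
  forall s : R, 0 < s -> is_derive s 1 (fun t : R => f `|t|) (c s).
Proof.
move=> H cB cc s s0; apply: is_derive1_eps => e e0.
have e20 : 0 < e / 2 by lra.
have [d d0 Hd] := H _ e20.
have /cvgrPdist_le/(_ _ e20) := cc s.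
move=> /nbhs_normP[d' /= d'0 Hd'].
exists (Num.min s (Num.min d d')); first by rewrite !lt_min s0 d0.
move=> h h0; rewrite !lt_min => /and3P[hs hd hd'].
have sh0 : 0 < s + h by move: hs; rewrite ltr_norml => /andP[]; lra.
rewrite (gtr0_norm s0) (gtr0_norm sh0).
have [hp|hn|h00] := ltgtP h 0; last by rewrite h00 eqxx in h0.
- have := Hd (s + h) (- h) (ltW sh0).
  rewrite ltr0_norm// in hd hd' *.
  rewrite oppr_gt0 hp hd => /(_ isT); rewrite addrK => H1.
  have H2 : `|c s - c (s + h)| <= e / 2.
    have := Hd' (s + h); rewrite /= (gtr0_norm s0) (gtr0_norm sh0); apply.
    by rewrite opprD addrA subrr sub0r normrN ltr0_norm.
  have -> : f (s + h) - f s - h * c s =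
    - (f s - f (s + h) - - h * c (s + h)) + - h * (c s - c (s + h)) by ring.
  apply: (le_trans (ler_normD _ _)); rewrite normrN normrM.
  rewrite (@gtr0_norm _ (- h)) ?oppr_gt0// [e]splitr mulrDl lerD//.
  by rewrite mulrC ler_wpM2r// oppr_ge0 ltW.
- rewrite (gtr0_norm hn); rewrite gtr0_norm// in hd.
  have := Hd s h (ltW s0); rewrite hn hd => /(_ isT) /le_trans; apply.
  by rewrite ler_pM2r//; lra.
Qed.

Lemma finite_family_max (Z : int -> R -> R) (T : R) (M : nat) : 0 <= T ->
  (forall k, {within `[0, T], continuous (Z k)}) ->
  exists k0 : int, exists2 t0 : R, (`|k0| <= M)%N && (0 <= t0 <= T) &
    forall (k : int) t, (`|k| <= M)%N -> 0 <= t <= T -> Z k t <= Z k0 t0.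
Proof.
move=> T0 Zc.
pose k_ (i : 'I_(M + M).+1) : int := i%:Z - M%:Z.
have /choice[tm tmP] : forall i, exists c, 0 <= c <= T /\
    forall t, 0 <= t <= T -> Z (k_ i) t <= Z (k_ i) c.
  move=> i; have [c cT cmax] := EVT_max T0 (Zc (k_ i)).
  exists c; split; first by move: cT; rewrite in_itv.
  by move=> t tT; apply: cmax; rewrite in_itv.
have [i0 _ i0max] := @Order.TotalTheory.arg_maxP _ _ _ (@ord0 (M + M)) xpredT
  (fun i => Z (k_ i) (tm i)) isT.
exists (k_ i0), (tm i0).
  have [-> _] := tmP i0; rewrite andbT /k_.
  by have := ltn_ord i0; lia.
move=> k t kM tT.
have iP : (absz (k + M%:Z)%R < (M + M).+1)%N by lia.
have kE : k = k_ (Ordinal iP) by rewrite /k_ /=; lia.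
rewrite kE; apply: le_trans (i0max (Ordinal iP) isT).
by have [_ ->] := tmP (Ordinal iP).
Qed.

(** Decay in space confines a positive maximum to a finite box. Subtracting a
  small multiple [eta * t] of time makes the inequality strict: at the maximum
  the time derivative would be at least [eta], while the discrete Laplacian is
  nonpositive. *)
Lemma maximum_principle (tau : int -> R) (lam T : R) (Z dZ : int -> R -> R) :
  0 < T -> 0 <= lam -> (forall k, 0 < tau k) ->
  (forall k, {within `[0, T], continuous (Z k)}) ->
  (forall k (t : R), 0 < t <= T -> is_derive t 1 (Z k) (dZ k t)) ->
  (forall k, Z k 0 <= 0) ->
  (forall e : R, 0 < e -> exists M : nat, forall (k : int) (t : R), (M < `|k|)%N ->
      0 <= t <= T -> Z k t <= e) ->
  (forall k (t : R), 0 < t <= T -> tau k * dZ k t <=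
     lam * (Z (k + 1) t + Z (k - 1) t - 2 * Z k t)) ->
  forall k (t : R), 0 <= t <= T -> Z k t <= 0.
Proof.
move=> T0 lam0 tau0 Zc Zd Z0 Zdecay Zsub k t /andP[t0 tT].
rewrite leNgt; apply/negP => Zpos.
pose v := Z k t; pose eta := v / (2 * T).
have eta0 : 0 < eta by rewrite divr_gt0 ?mulr_gt0.
have v20 : 0 < v / 2 by rewrite divr_gt0.
have [M HM] := Zdecay _ v20.
pose Y k t := Z k t - eta * t.
have Yc j : {within `[0, T], continuous (Y j)}.
  move=> x; apply: cvgB; first exact: Zc.
  by apply: continuous_subspaceT => y; apply: cvgMr; exact: cvg_id.
have [k0 [t1 /andP[k0M /andP[t10 t1T]] Ymax]] :=
  @finite_family_max Y T (maxn M (absz k)) (ltW T0) Yc.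
have etaT : eta * T = v / 2 by rewrite /eta; field; rewrite gt_eqF.
have Yv : v / 2 <= Y k0 t1.
  apply: (@le_trans _ _ (Y k t)); last first.
    by apply: Ymax; [rewrite leq_maxr | rewrite t0 tT].
  rewrite /Y -/v; have : eta * t <= eta * T by rewrite ler_pM2l.
  by lra.
have Yall j : Y j t1 <= Y k0 t1.
  have [jM|jM] := leqP `|j| (maxn M `|k|); first by apply: Ymax => //; apply/andP.
  apply: le_trans Yv; rewrite /Y.
  have := HM j t1 (leq_ltn_trans (leq_maxl _ _) jM); rewrite t10 t1T => /(_ isT).
  have : 0 <= eta * t1 by rewrite mulr_ge0// ltW.
  by lra.
have t1pos : 0 < t1.
  rewrite lt_neqAle t10 andbT; apply/eqP => t1E.
  by have := Z0 k0; rewrite /Y -t1E in Yv; lra.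
have dY : is_derive t1 1 (Y k0) (dZ k0 t1 - eta).
  have : is_derive t1 1 (Z k0) (dZ k0 t1) by apply: Zd; rewrite t1pos.
  move=> dZ1; rewrite /Y.
  have dl : is_derive t1 1 (fun t => eta * t) eta.
    have -> : (fun t => eta * t) = eta \*: (id : R -> R) by [].
    by apply: is_derive_eq; rewrite /GRing.scale/= mulr1.
  by apply: is_deriveB.
have : 0 <= dZ k0 t1 - eta.
  apply: (derive_at_left_max t1pos dY) => x /andP[x0 xt].
  by apply: Ymax => //; rewrite x0/= (le_trans (ltW xt)).
have := Zsub k0 t1; rewrite t1pos t1T => /(_ isT).
have := Yall (k0 + 1); have := Yall (k0 - 1); rewrite /Y => A1 A2 A3 A4.
have : 0 < tau k0 * dZ k0 t1 by rewrite mulr_gt0//; lra.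
have : lam * (Z (k0 + 1) t1 + Z (k0 - 1) t1 - 2 * Z k0 t1) <= 0.
  by rewrite mulr_ge0_le0//; lra.
by lra.
Qed.

End calculus.

(** * The Gaussian heat kernel, its distribution function and its potential *)

Section gaussian.
Context {R : realType}.
Notation mu := (@lebesgue_measure R).

(** Variance 2 makes the rescaled densities the fundamental solution of the
  heat equation without a factor in front of the Laplacian. *)
Definition gauss_density : R -> R := normal_pdf 0 (Num.sqrt 2).
Local Notation gam := gauss_density.

Definition gauss_peak : R := normal_peak (Num.sqrt 2).

Let sqrt2_neq0 : Num.sqrt 2 != 0 :> R.
Proof. by rewrite gt_eqF// sqrtr_gt0. Qed.

Lemma gauss_peak_gt0 : 0 < gauss_peak.
Proof. exact: normal_peak_gt0. Qed.

Lemma gauss_densityE z : gam z = gauss_peak * expR (- (z ^+ 2 / 4)).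
Proof.
rewrite /gam normal_pdfE// /normal_fun subr0 sqr_sqrtr//; congr (_ * expR _).
by rewrite mulNr; congr (- (_ / _)); rewrite mulr2n; ring.
Qed.

Lemma gauss_density_gt0 z : 0 < gam z.
Proof. by rewrite gauss_densityE mulr_gt0 ?gauss_peak_gt0 ?expR_gt0. Qed.

Lemma gauss_densityN z : gam (- z) = gam z.
Proof. by rewrite !gauss_densityE sqrrN. Qed.

Lemma is_derive_gauss_density z : is_derive (z : R) 1 gam (- (z / 2) * gam z).
Proof.
have -> : gam = fun z => gauss_peak * expR (- (z ^+ 2 / 4)).
  by apply/funext => x; exact: gauss_densityE.
apply: (derE _ (derZ gauss_peak (der_comp (is_derive_expR _)
  (derN (derM (derX 1 (derI z)) (derC z 4^-1)))))).
by rewrite expr1; field.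
Qed.

Lemma gauss_density_poly_bound (n : nat) :
  exists2 C, 0 < C & forall z, (1 + `|z|) ^+ n * gam z <= C.
Proof.
exists (gauss_peak * (n`!%:R * expR 2)).
  by rewrite !mulr_gt0 ?gauss_peak_gt0 ?expR_gt0// ltr0n fact_gt0.
move=> z; rewrite gauss_densityE mulrCA ler_pM2l ?gauss_peak_gt0//.
have fn0 : 0 < n`!%:R :> R by rewrite ltr0n fact_gt0.
have H : (1 + `|z|) ^+ n <= n`!%:R * expR (1 + `|z|).
  case: n fn0 => [_|n fn0].
    by rewrite expr0 mul1r -expR0 ler_expR addr_ge0.
  have z0 : 0 <= 1 + `|z| by rewrite addr_ge0.
  have := expR_ge1Dxn n z0.
  rewrite -ler_pdivrMl// mulrC; lra.
apply: (@le_trans _ _ (n`!%:R * expR (1 + `|z|) * expR (- (z ^+ 2 / 4)))).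
  by rewrite ler_wpM2r// expR_ge0.
rewrite -mulrA -expRD ler_pM2l// ler_expR -(real_normK (num_real z)).
have := sqr_ge0 (`|z| - 2); lra.
Qed.

(** ** The Gaussian distribution function *)

Definition gauss_cdf (z : R) : R := (\int[mu]_(x in `]-oo, z]) gam x)%R.
Local Notation Phi := gauss_cdf.

Let N : probability (measurableTypeR R) R := normal_prob 0 (Num.sqrt 2).

Lemma gauss_cdf_prob z : (Phi z)%:E = N [set` `]-oo, z]%R].
Proof.
rewrite /gauss_cdf /Rintegral fineK//.
have -> : (\int[mu]_(x in `]-oo, z]) (gam x)%:E)%E = N [set` `]-oo, z]%R] by [].
exact: fin_num_measure.
Qed.

Lemma gauss_cdf_ge0 z : 0 <= Phi z.
Proof. by rewrite -lee_fin gauss_cdf_prob. Qed.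

Lemma gauss_cdf_le1 z : Phi z <= 1.
Proof. by rewrite -lee_fin gauss_cdf_prob; exact: probability_le1. Qed.

Lemma is_derive_gauss_cdf z : is_derive (z : R) 1 Phi (gam z).
Proof.
have int : mu.-integrable [set` Interval -oo%O (BRight (z + 1))] (EFin \o gam).
  apply: (integrableS measurableT) => //.
  exact: integrable_normal_pdf.
have zz1 : z < z + 1 by rewrite ltrDl.
have gamc : {for z, continuous gam} by exact: continuous_normal_pdf.
have [d e] := continuous_FTC1 zz1 int (ltNyr _) gamc.
by apply: DeriveDef; [exact: d|rewrite -derive1E; exact: e].
Qed.

Let idR : measurableTypeR R -> R := idfun.

#[local] HB.instance Definition _ :=
  @isMeasurableFun.Build _ _ _ _ idR (@measurable_id _ _ setT).

Lemma cvg_gauss_cdfy : Phi x @[x --> +oo] --> (1 : R).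
Proof.
have := @cvg_cdfy1 _ _ _ N (idR : {RV N >-> R}).
have -> : cdf (idR : {RV N >-> R}) = EFin \o Phi.
  by apply/funext => x /=; rewrite gauss_cdf_prob.
by move/fine_cvg.
Qed.

Lemma cvg_gauss_cdfNy : Phi x @[x --> -oo] --> (0 : R).
Proof.
have := @cvg_cdfNy0 _ _ _ N (idR : {RV N >-> R}).
have -> : cdf (idR : {RV N >-> R}) = EFin \o Phi.
  by apply/funext => x /=; rewrite gauss_cdf_prob.
by move/fine_cvg.
Qed.

Lemma gauss_cdf_near1 e : 0 < e -> exists M, forall x, M <= x -> 1 - e <= Phi x.
Proof.
move=> e0; have /cvgrPdist_le/(_ _ e0)[M [_ HM]] := cvg_gauss_cdfy.
exists (M + 1) => x Mx; have := HM x.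
by rewrite ler_norml => /(_ ltac:(lra)) /andP[]; lra.
Qed.

Lemma gauss_cdfN z : Phi (- z) = 1 - Phi z.
Proof.
pose h x := Phi x + Phi (- x).
have hd x : is_derive (x : R) 1 h 0.
  have d1 := is_derive_gauss_cdf x.
  have d2 := is_derive1_comp (is_derive_gauss_cdf (- x)) (is_deriveNid x 1).
  by apply: (derE _ (derD d1 d2)); rewrite gauss_densityN mulrN1 subrr.
have hc : h = cst (h z).
  apply/funext => x; apply/eqP; rewrite -subr_eq0 -normr_le0 /=.
  rewrite -(mul0r `|x - z|).
  apply: (@mean_value_dist _ h (cst 0) (Num.min x z) (Num.max x z)) => //.
  - by move=> y _; rewrite normr0.
  - by rewrite ge_min le_max lexx.
  - by rewrite ge_min le_max lexx !orbT.
have h1 : h x @[x --> +oo] --> (1 : R).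
  rewrite -[X in _ --> X]addr0; apply: cvgD; first exact: cvg_gauss_cdfy.
  by apply/(cvgNy_compNP Phi (nbhs (0 : R))); exact: cvg_gauss_cdfNy.
have : h x @[x --> +oo] --> h z by rewrite hc; exact: cvg_cst.
move=> /(cvg_unique _ h1) => /(_ (@Rhausdorff R)) H.
by rewrite H /h; ring.
Qed.

(** Mills' bound: [2 * gam z / z + Phi z] decreases to its limit [1]. *)
Lemma gauss_cdf_tail z : 0 < z -> z * (1 - Phi z) <= 2 * gam z.
Proof.
move=> z0; pose h x := 2 * gam x / x + Phi x.
have hz : h z >= 1.
  have hcont (x : R) : 0 < x -> is_derive x 1 h (- (2 * gam x / x ^+ 2)).
    move=> x0; have d1 := is_derive_gauss_cdf x; have d2 := is_derive_gauss_density x.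
    apply: (derE _ (derD (derM (derZ 2 d2) (derV _)) d1)).
      by field; rewrite gt_eqF.
    by rewrite gt_eqF.
  have hdecr x : z <= x -> h x <= h z.
    move=> zx; rewrite -subr_le0 -(mul0r (x - z)).
    apply: (@mean_value_le _ _ (fun x => - (2 * gam x / x ^+ 2))) => //.
    - apply: derivable_within_continuous => y; rewrite in_itv/= => /andP[zy _].
      by have [] := hcont y (lt_le_trans z0 zy).
    - by move=> y /andP[zy _]; apply: hcont; exact: lt_trans zy.
    - move=> y _; rewrite oppr_le0 divr_ge0 ?sqr_ge0// mulr_ge0// ltW//.
      exact: gauss_density_gt0.
  apply/ler_addgt0Pr => e e0; have [M HM] := gauss_cdf_near1 e0.
  pose x := Num.max M z.
  have := HM x; rewrite le_max lexx => /(_ isT).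
  have := hdecr x; rewrite le_max lexx orbT => /(_ isT).
  have : 0 <= 2 * gam x / x.
    rewrite divr_ge0//; last by rewrite le_max (ltW z0) orbT.
    by rewrite mulr_ge0// ltW// gauss_density_gt0.
  have -> : h x = 2 * gam x / x + Phi x by [].
  lra.
move: hz; rewrite /h -lerBlDr ler_pdivlMr//; lra.
Qed.

(** ** The heat kernel and its potential *)

Definition heat (r y : R) := (Num.sqrt r)^-1 * gam (y * (Num.sqrt r)^-1).

Definition heat_cdf (r y : R) := Phi (y * (Num.sqrt r)^-1).

(** The second primitive in space of the heat kernel, which is also a primitive
  in time. Its limit for small [r] being the positive part of [y], the difference of
  the two is the integral of the heat kernel over the times up to [r]. *)
Definition heat_potential (r y : R) :=
  y * heat_cdf r y + 2 * r * heat r y.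

Definition heat1 (r y : R) := - (y / (2 * r)) * heat r y.
Definition heat2 (r y : R) := (y ^+ 2 / (4 * r ^+ 2) - (2 * r)^-1) * heat r y.

Section heat_derivatives.
Variables (r y : R).
Hypothesis r0 : 0 < r.

Let s0 : 0 < Num.sqrt r. Proof. by rewrite sqrtr_gt0. Qed.
Let s2 : Num.sqrt r ^+ 2 = r. Proof. by rewrite sqr_sqrtr// ltW. Qed.
Let dinv : is_derive r 1 (fun r : R => (Num.sqrt r)^-1)
  (- (2 * r * Num.sqrt r)^-1).
Proof.
have n0 : Num.sqrt r != 0 by rewrite gt_eqF.
apply: (derE _ (der_comp (derV n0) (derS r0))).
by rewrite s2; field; rewrite n0 gt_eqF.
Qed.

Lemma heat_gt0 : 0 < heat r y.
Proof. by rewrite mulr_gt0 ?invr_gt0// gauss_density_gt0. Qed.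

Lemma is_derive_heat_y : is_derive y 1 (heat r) (heat1 r y).
Proof.
apply: (derE _ (derZ _ (der_comp (is_derive_gauss_density _)
  (derM (derI y) (derC y _))))).
rewrite /heat1 /heat; set s := Num.sqrt r.
have s0' : 0 < s by exact: s0.
have s2' : s ^+ 2 = r by exact: s2.
by rewrite -s2'; field; rewrite gt_eqF.
Qed.

Lemma is_derive_heat1_y : is_derive y 1 (heat1 r) (heat2 r y).
Proof.
apply: (derE _ (derM (derN (derM (derI y) (derC y _))) is_derive_heat_y)).
by rewrite /heat1 /heat2; field; rewrite gt_eqF.
Qed.

Lemma is_derive_heat_r : is_derive r 1 (heat ^~ y) (heat2 r y).
Proof.
apply: (derE _ (derM dinv (der_comp (is_derive_gauss_density _)
  (derZ y dinv)))).
rewrite /heat2 /heat; set s := Num.sqrt r.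
have s0' : 0 < s by exact: s0.
have s2' : s ^+ 2 = r by exact: s2.
by rewrite -s2'; field; rewrite gt_eqF.
Qed.

Lemma is_derive_heat_cdf_y : is_derive y 1 (heat_cdf r) (heat r y).
Proof.
apply: (derE _ (der_comp (is_derive_gauss_cdf _) (derM (derI y) (derC y _)))).
by rewrite /heat; ring.
Qed.

Lemma is_derive_heat_cdf_r : is_derive r 1 (heat_cdf ^~ y) (heat1 r y).
Proof.
apply: (derE _ (der_comp (is_derive_gauss_cdf _) (derZ y dinv))).
by rewrite /heat1 /heat; field; rewrite !gt_eqF.
Qed.

Lemma is_derive_heat1_r : is_derive r 1 (heat1 ^~ y)
  (y / (2 * r ^+ 2) * heat r y - y / (2 * r) * heat2 r y).
Proof.
have r20 : 2 * r != 0 by rewrite mulf_neq0// gt_eqF.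
apply: (derE _ (derM (derN (derZ y (der_comp (derV r20) (derZ 2 (derI r)))))
  is_derive_heat_r)).
by field; rewrite gt_eqF.
Qed.

Lemma is_derive_potential_y :
  is_derive y 1 (heat_potential r) (heat_cdf r y).
Proof.
apply: (derE _ (derD (derM (derI y) is_derive_heat_cdf_y)
  (derZ (2 * r) is_derive_heat_y))).
by rewrite /heat1; field; rewrite gt_eqF.
Qed.

Lemma is_derive_potential_r :
  is_derive r 1 (heat_potential ^~ y) (heat r y).
Proof.
apply: (derE _ (derD (derZ y is_derive_heat_cdf_r)
  (derM (derZ 2 (derI r)) is_derive_heat_r))).
by rewrite /heat1 /heat2; field; rewrite gt_eqF.
Qed.

End heat_derivatives.

(** The parabolic scaling [heat r y = heat 1 (y / sqrt r) / sqrt r] reduces these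
  bounds to the fact that the Gaussian density absorbs polynomials. *)
Lemma heat_bounds (R0 : R) : 1 <= R0 -> exists2 C, 0 < C &
  forall r y, 0 < r <= R0 ->
  [/\ (1 + `|y|) ^+ 3 * heat r y <= C / Num.sqrt r,
      (1 + `|y|) ^+ 2 * `|heat1 r y| <= C / (r * Num.sqrt r) &
      (1 + `|y|) ^+ 2 * `|heat2 r y| <= C / (r * Num.sqrt r)].
Proof.
move=> R01; have [C0 C00 HC0] := gauss_density_poly_bound 4.
pose S := Num.sqrt R0.
have S1 : 1 <= S.
  by rewrite -[leLHS]sqrtr1 ler_sqrt//; lra.
have S0 : 0 < S by lra.
exists (S ^+ 3 * C0); first by rewrite mulr_gt0 ?exprn_gt0.
move=> r y /andP[r0 rR]; pose s := Num.sqrt r.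
have s0 : 0 < s by rewrite sqrtr_gt0.
have s2 : s ^+ 2 = r by rewrite sqr_sqrtr// ltW.
have sS : s <= S by rewrite ler_sqrt//; lra.
pose z := y * s^-1.
have yE : y = s * z by rewrite /z; field; rewrite gt_eqF.
have g0 : 0 < gam z := gauss_density_gt0 z.
have a1 : 1 <= 1 + `|z| by rewrite lerDl.
have ya : 1 + `|y| <= S * (1 + `|z|).
  rewrite yE normrM (gtr0_norm s0) mulrDr mulr1 lerD// ler_wpM2r//.
have y0 : 0 <= 1 + `|y| by rewrite addr_ge0.
have Y2 : (1 + `|y|) ^+ 2 <= S ^+ 2 * (1 + `|z|) ^+ 2.
  by rewrite -exprMn lerXn2r ?nnegrE// (le_trans y0).
have Y3 : (1 + `|y|) ^+ 3 <= S ^+ 3 * (1 + `|z|) ^+ 3.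
  by rewrite -exprMn lerXn2r ?nnegrE// (le_trans y0).
have G3 : (1 + `|z|) ^+ 3 * gam z <= C0.
  apply: le_trans (HC0 z); rewrite ler_pM2r// ler_weXn2l//.
split.
- rewrite /heat -/s -/z mulrCA mulrC ler_pM2r ?invr_gt0//.
  apply: (@le_trans _ _ (S ^+ 3 * ((1 + `|z|) ^+ 3 * gam z))).
    by rewrite mulrA ler_pM2r.
  by rewrite ler_pM2l// exprn_gt0.
- have -> : heat1 r y = - (z / 2 * gam z) / r.
    by rewrite /heat1 /heat -/s -/z yE -s2; field; rewrite gt_eqF.
  have X : (1 + `|y|) ^+ 2 * `|z / 2 * gam z| <= S ^+ 2 * C0.
    apply: (@le_trans _ _ (S ^+ 2 * (1 + `|z|) ^+ 2 * ((1 + `|z|) * gam z))).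
      rewrite ler_pM ?exprn_ge0// normrM (gtr0_norm g0) ler_pM2r//.
      by rewrite normrM (@gtr0_norm _ (2^-1)); lra.
    by rewrite -mulrA ler_pM2l ?exprn_gt0// mulrA -exprSr.
  rewrite normrM normrN normfV (gtr0_norm r0) -/s invfM !mulrA.
  rewrite [leRHS]mulrAC ler_pM2r ?invr_gt0// ler_pdivlMr//.
  rewrite [S ^+ 3]exprSr [leRHS]mulrAC.
  by rewrite ler_pM// ?mulr_ge0 ?exprn_ge0// ltW.
- have -> : heat2 r y = (z ^+ 2 / 4 - 2^-1) * gam z / (r * s).
    by rewrite /heat2 /heat -/s -/z yE -s2; field; rewrite gt_eqF.
  have rs0 : 0 < r * s by rewrite mulr_gt0.
  rewrite normrM normfV (gtr0_norm rs0) mulrA ler_pM2r ?invr_gt0//.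
  rewrite normrM (gtr0_norm g0).
  have Z : `|z ^+ 2 / 4 - 2^-1| <= (1 + `|z|) ^+ 2.
    have -> : z ^+ 2 = `|z| ^+ 2 by rewrite real_normK// num_real.
    have z0 := normr_ge0 z.
    by rewrite ler_norml; apply/andP; split; nra.
  apply: (@le_trans _ _ (S ^+ 2 * (1 + `|z|) ^+ 2 * ((1 + `|z|) ^+ 2 * gam z))).
    by rewrite ler_pM ?exprn_ge0 ?mulr_ge0 ?(ltW g0)// ler_pM2r.
  have -> (a g : R) : S ^+ 2 * a ^+ 2 * (a ^+ 2 * g) = S ^+ 2 * (a ^+ 4 * g).
    by ring.
  rewrite ler_pM ?exprn_ge0 ?mulr_ge0 ?exprn_ge0 ?(ltW g0) ?(ltW S0)//.
  by rewrite ler_weXn2l.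
Qed.

Lemma heat_bounded (r1 r2 : R) : 0 < r1 -> exists2 B, 0 < B &
  forall r y, r1 <= r <= r2 -> [/\ heat r y <= B, `|heat1 r y| <= B,
    `|heat2 r y| <= B & `|y / (2 * r ^+ 2) * heat r y - y / (2 * r) * heat2 r y| <= B].
Proof.
move=> r10; have [|C C0 HC] := @heat_bounds (Num.max 1 r2).
  by rewrite le_max lexx.
have s10 : 0 < Num.sqrt r1 by rewrite sqrtr_gt0.
pose a := C / Num.sqrt r1; pose b := C / (r1 * Num.sqrt r1).
have a0 : 0 < a by exact: divr_gt0.
have b0 : 0 < b by rewrite divr_gt0// mulr_gt0.
have c0 : 0 < a / (2 * r1 ^+ 2) by rewrite divr_gt0// mulr_gt0// exprn_gt0.
have d0 : 0 < b / (2 * r1) by rewrite divr_gt0// mulr_gt0.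
exists (a + b + a / (2 * r1 ^+ 2) + b / (2 * r1)).
  by rewrite !addr_gt0.
move=> r y /andP[rr1 rr2]; have r0 : 0 < r := lt_le_trans r10 rr1.
have [h1 h2 h3] := HC r y ltac:(by rewrite r0 le_max rr2 orbT).
have s0 : 0 < Num.sqrt r by rewrite sqrtr_gt0.
have s1 : Num.sqrt r1 <= Num.sqrt r by exact: ler_wsqrtr.
have {}h1 : (1 + `|y|) ^+ 3 * heat r y <= a.
  by apply: (le_trans h1); rewrite ler_pM2l// lef_pV2.
have cb : C / (r * Num.sqrt r) <= b.
  by rewrite ler_pM2l// lef_pV2 ?posrE ?mulr_gt0// ler_pM// ltW.
have {}h2 := le_trans h2 cb; have {}h3 := le_trans h3 cb.
have g0 := heat_gt0 y r0; have y0 := normr_ge0 y.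
have y1 : 1 <= 1 + `|y| by rewrite lerDl.
have w n (z : R) : 0 <= z -> z <= (1 + `|y|) ^+ n * z.
  by move=> z0; rewrite ler_peMl// exprn_ege1.
have wy n (z : R) : 0 <= z -> `|y| * z <= (1 + `|y|) ^+ n.+1 * z.
  move=> z0; rewrite ler_wpM2r// exprS (@le_trans _ _ ((1 + `|y|) * 1))//.
    by rewrite mulr1 lerDr.
  by rewrite ler_wpM2l ?exprn_ege1// (le_trans ler01).
have H1 := le_trans (w 3 _ (ltW g0)) h1.
have H2 := le_trans (w 2 _ (normr_ge0 _)) h2.
have H3 := le_trans (w 2 _ (normr_ge0 _)) h3.
have Y1 := le_trans (wy 2 _ (ltW g0)) h1.
have Y2 := le_trans (wy 1 _ (normr_ge0 _)) h3.
have H4 : `|y / (2 * r ^+ 2) * heat r y| <= a / (2 * r1 ^+ 2).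
  have p0 : 0 < 2 * r1 ^+ 2 by rewrite mulr_gt0// exprn_gt0.
  have p1 : 0 < 2 * r ^+ 2 by rewrite mulr_gt0// exprn_gt0.
  rewrite mulrAC normrM (@gtr0_norm _ (_^-1)) ?invr_gt0// normrM (gtr0_norm g0).
  apply: ler_pM => //; [exact: mulr_ge0 (ltW g0)|by rewrite invr_ge0 ltW|].
  by rewrite lef_pV2 ?posrE// ler_pM2l// lerXn2r ?nnegrE// ltW.
have H5 : `|y / (2 * r) * heat2 r y| <= b / (2 * r1).
  have p0 : 0 < 2 * r1 by rewrite mulr_gt0.
  have p1 : 0 < 2 * r by rewrite mulr_gt0.
  rewrite mulrAC normrM (@gtr0_norm _ (_^-1)) ?invr_gt0// normrM.
  apply: ler_pM => //; first by rewrite invr_ge0 ltW.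
  by rewrite lef_pV2 ?posrE// ler_pM2l.
move: (a / (2 * r1 ^+ 2)) (b / (2 * r1)) c0 d0 H4 H5 => c d c0 d0 H4 H5.
split; [lra|lra|lra|apply: (le_trans (ler_normB _ _)); lra].
Qed.

Lemma potential_ge0 (r y : R) : 0 < r -> 0 <= heat_potential r y - Num.max y 0.
Proof.
move=> r0; pose s := Num.sqrt r.
have s0 : 0 < s by rewrite sqrtr_gt0.
have s2 : s ^+ 2 = r by rewrite sqr_sqrtr// ltW.
rewrite /heat_potential /heat /heat_cdf -/s.
have key (z : R) : 0 < z -> 0 <= 2 * s * gam z - s * z * (1 - Phi z).
  move=> z0; have := gauss_cdf_tail z0 => H.
  have -> : 2 * s * gam z - s * z * (1 - Phi z) = s * (2 * gam z - z * (1 - Phi z)) by ring.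
  by rewrite pmulr_rge0//; lra.
have -> : 2 * r * (s^-1 * gam (y / s)) = 2 * s * gam (y / s).
  by rewrite -s2; field; rewrite gt_eqF.
have yE : y = s * (y / s) by field; rewrite gt_eqF.
have [y0|y0|->] := ltgtP y 0.
- have z0 : 0 < - (y / s) by rewrite oppr_gt0 pmulr_llt0// invr_gt0.
  have := key _ z0; rewrite gauss_densityN gauss_cdfN.
  have -> : s * - (y / s) = - y by field; rewrite gt_eqF.
  by lra.
- have z0 : 0 < y / s by rewrite divr_gt0.
  have := key _ z0; have -> : s * (y / s) = y by field; rewrite gt_eqF.
  by lra.
by rewrite !mul0r add0r subr0 !mulr_ge0// ltW// gauss_density_gt0.
Qed.

Lemma potential_le (r y : R) : 0 < r ->
  heat_potential r y - Num.max y 0 <= 2 * r * heat r y.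
Proof.
move=> r0; rewrite /heat_potential addrAC gerDr subr_le0.
have [y0|y0] := leP y 0; rewrite /heat_cdf.
  by rewrite mulr_le0_ge0// gauss_cdf_ge0.
by rewrite ler_piMr ?gauss_cdf_le1// ltW.
Qed.

Lemma heat_cdf_ge0 (r y : R) : 0 <= heat_cdf r y.
Proof. exact: gauss_cdf_ge0. Qed.

Lemma heat_cdf_le1 (r y : R) : heat_cdf r y <= 1.
Proof. exact: gauss_cdf_le1. Qed.

Lemma heat_continuous (r y : R) : 0 < r -> {for y, continuous (heat r)}.
Proof. by move=> r0; apply: is_derive1_continuous; exact: is_derive_heat_y. Qed.

Lemma heat_cdf_continuous (r y : R) : 0 < r -> {for y, continuous (heat_cdf r)}.
Proof. by move=> r0; apply: is_derive1_continuous; exact: is_derive_heat_cdf_y. Qed.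

(** The heat kernel is at most a multiple of the derivative of the square root of
  time, so that a time shift by [eps ^+ 2] costs at most a multiple of [eps]. *)
Lemma potential_time_shift (R0 : R) : 1 <= R0 -> exists2 C, 0 < C &
  forall r eps y, 0 < r -> 0 < eps -> r + eps ^+ 2 <= R0 ->
  0 <= heat_potential (r + eps ^+ 2) y - heat_potential r y <= C * eps.
Proof.
move=> /heat_bounds[C C0 HC]; exists (2 * C); first by rewrite mulr_gt0.
move=> r eps y r0 e0 rR.
have e20 : 0 < eps ^+ 2 by rewrite exprn_gt0.
have rr : r <= r + eps ^+ 2 by rewrite lerDl ltW.
have hcont : {within `[r, r + eps ^+ 2], continuous (heat_potential ^~ y)}.
  apply: derivable_within_continuous => x; rewrite in_itv/= => /andP[rx _].
  by have [] := is_derive_potential_r y (lt_le_trans r0 rx).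
have hd (x : R) : r < x < r + eps ^+ 2 ->
    is_derive x 1 (heat_potential ^~ y) (heat x y).
  by move=> /andP[rx _]; apply: is_derive_potential_r; exact: lt_trans rx.
apply/andP; split.
  rewrite -(mul0r (r + eps ^+ 2 - r)).
  apply: (mean_value_ge rr hcont hd) => x /andP[rx _].
  by rewrite ltW// heat_gt0// (lt_trans r0).
have sd (x : R) : 0 < x -> is_derive x 1 (fun x : R => 2 * C * Num.sqrt x) (C / Num.sqrt x).
  move=> x0; apply: (derE _ (derZ (2 * C) (derS x0))).
  by field; rewrite gt_eqF// sqrtr_gt0.
pose f x := heat_potential x y - 2 * C * Num.sqrt x.
have : f (r + eps ^+ 2) - f r <= 0 * (r + eps ^+ 2 - r).
  apply: (@mean_value_le _ f (fun x => heat x y - C / Num.sqrt x)) => //.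
  - apply: derivable_within_continuous => x; rewrite in_itv/= => /andP[rx _].
    have x0 := lt_le_trans r0 rx.
    by have [] := derB (is_derive_potential_r y x0) (sd _ x0).
  - move=> x /andP[rx xe]; have x0 := lt_trans r0 rx.
    exact: derB (is_derive_potential_r y x0) (sd _ x0).
  - move=> x /andP[rx xe]; have x0 := lt_trans r0 rx.
    rewrite subr_le0; have [|+ _ _] := HC x y.
      by rewrite x0/= (le_trans (ltW xe)).
    apply: le_trans; rewrite ler_peMl ?(ltW (heat_gt0 _ _))//.
    by rewrite exprn_ege1// lerDl.
rewrite mul0r /f.
suff : Num.sqrt (r + eps ^+ 2) <= Num.sqrt r + eps.
  by move=> H1 H2; nra.
rewrite -(@ler_pXn2r _ 2)// ?nnegrE ?addr_ge0 ?sqrtr_ge0 ?(ltW e0)//.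
rewrite sqr_sqrtr ?addr_ge0 ?(ltW r0) ?(ltW e20)// sqrrD sqr_sqrtr ?(ltW r0)//.
by rewrite lerD2r lerDl mulrn_wge0// mulr_ge0 ?sqrtr_ge0 ?(ltW e0).
Qed.

Lemma second_difference (f f1 f2 : R -> R) (y h L : R) : 0 <= h ->
  (forall x, `|x - y| <= h -> is_derive x 1 f (f1 x)) ->
  (forall x, `|x - y| <= h -> is_derive x 1 f1 (f2 x)) ->
  (forall x, `|x - y| <= h -> `|f2 x| <= L) ->
  `|f (y + h) + f (y - h) - 2 * f y| <= 2 * L * h ^+ 2.
Proof.
move=> h0 df df1 f2L.
have shp s : 0 <= s <= h -> `|(y + s) - y| <= h.
  by move=> /andP[s0 sh]; rewrite addrAC subrr add0r ger0_norm.
have shm s : 0 <= s <= h -> `|(y - s) - y| <= h.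
  by move=> /andP[s0 sh]; rewrite addrAC subrr add0r normrN ger0_norm.
pose g s := f (y + s) + f (y - s) - 2 * f y.
pose g1 s := f1 (y + s) - f1 (y - s).
have dp (F : R -> R) (c s : R) : is_derive (y + s) 1 F c ->
    is_derive s 1 (fun s : R => F (y + s)) c.
  move=> dF; apply: (derE _ (der_comp dF (derD (derC s y) (derI s)))); ring.
have dm (F : R -> R) (c s : R) : is_derive (y - s) 1 F c ->
    is_derive s 1 (fun s : R => F (y - s)) (- c).
  move=> dF; apply: (derE _ (@der_comp _ F (fun s => y - s) _ _ _ dF (derB (derC s y) (derI s)))); ring.
have dg s : 0 <= s <= h -> is_derive s 1 g (g1 s).
  move=> sh; apply: (derE _ (derB (derD (dp _ _ _ (df _ (shp _ sh)))
    (dm _ _ _ (df _ (shm _ sh)))) (derC s _))).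
  by rewrite subr0.
have dg1 s : 0 <= s <= h -> is_derive s 1 g1 (f2 (y + s) + f2 (y - s)).
  move=> sh; apply: (derE _ (derB (dp _ _ _ (df1 _ (shp _ sh)))
    (dm _ _ _ (df1 _ (shm _ sh))))).
  by rewrite opprK.
have g1b s : 0 <= s <= h -> `|g1 s| <= 2 * L * h.
  move=> /andP[s0 sh].
  have : `|g1 s - g1 0| <= 2 * L * (s - 0).
    apply: (@mean_value_norm _ g1 (fun s => f2 (y + s) + f2 (y - s)) 0 s (2 * L) s0).
    - apply: derivable_within_continuous => x; rewrite in_itv/= => /andP[x0 xs].
      by have [] := dg1 x ltac:(rewrite x0 (le_trans xs)).
    - by move=> x /andP[x0 xs]; apply: dg1; rewrite (ltW x0) (le_trans (ltW xs)).
    - move=> x /andP[x0 xs]; have xh : 0 <= x <= h.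
        by rewrite (ltW x0) (le_trans (ltW xs)).
      rewrite mulr_natl mulr2n; apply: (le_trans (ler_normD _ _)); apply: lerD; apply: f2L.
        exact: shp.
      exact: shm.
  rewrite /g1 addr0 subr0 !subrr !subr0 => /le_trans; apply.
  have L0 : 0 <= L by apply: le_trans (f2L y _); rewrite ?subrr ?normr0.
  by rewrite ler_wpM2l// mulr_ge0.
have : `|g h - g 0| <= 2 * L * h * (h - 0).
  apply: (@mean_value_norm _ g g1 0 h (2 * L * h) h0).
  - apply: derivable_within_continuous => x; rewrite in_itv/= => xh.
    by have [] := dg x xh.
  - by move=> x /andP[x0 xs]; apply: dg; rewrite !ltW.
  - by move=> x /andP[x0 xs]; apply: g1b; rewrite !ltW.
have -> : g 0 = 0 by rewrite /g addr0 subr0; ring.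
by rewrite !subr0 -mulrA -expr2.
Qed.

End gaussian.

(** * Occupation times of the chain against the potential of Brownian motion *)

Section int_primitive.
Context {R : realType}.
Implicit Types s : int -> R.

Definition int_primitive s (k : int) : R :=
  match k with
  | Posz j => \sum_(i < j) s (Posz i)
  | Negz j => - \sum_(i < j.+1) s (Negz i)
  end.

Lemma int_primitiveD1 s k : int_primitive s (k + 1) - int_primitive s k = s k.
Proof.
case: k => [j|[|j]].
- have -> : Posz j + 1 = Posz j.+1 by rewrite -addn1 PoszD.
  by rewrite /= big_ord_recr/= addrAC subrr add0r.
- by rewrite /= big_ord0 big_ord1 opprK add0r.
- have -> : Negz j.+1 + 1 = Negz j by rewrite !NegzE; lia.
  by rewrite /= [in X in - - X]big_ord_recr/=; ring.
Qed.

Lemma int_primitive_bound s k B :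
  (forall i : int, (`|i| <= `|k|)%N -> `|s i| <= B) ->
  `|int_primitive s k| <= `|k|%N%:R * B.
Proof.
case: k => j sB; rewrite /= ?normrN; apply: (le_trans (ler_norm_sum _ _ _)).
  apply: (@le_trans _ _ (\sum_(i < j) B)).
    by apply: ler_sum => i _; apply: sB => /=; exact: ltnW.
  by rewrite sumr_const card_ord mulr_natl.
apply: (@le_trans _ _ (\sum_(i < j.+1) B)).
  by apply: ler_sum => i _; apply: sB; have := ltn_ord i; lia.
by rewrite sumr_const card_ord mulr_natl.
Qed.

End int_primitive.

Section comparison.
Context {R : realType}.

Lemma site_pos_part (n : nat) (j : int) :
  Num.max (@site R n j) 0 = (Num.max j 0)%:~R / n%:R.
Proof.
have n0 : 0 <= n%:R^-1 :> R by rewrite invr_ge0.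
rewrite /site; have [j0|j0] := leP j 0.
  by rewrite mul0r max_r// mulr_le0_ge0// lerz0.
by rewrite max_l// mulr_ge0// ler0z ltW.
Qed.

Lemma site_pos_part_laplacian (n : nat) (k : int) :
  Num.max (@site R n (k + 1)) 0 + Num.max (site n (k - 1)) 0
    - 2 * Num.max (site n k) 0 = n%:R^-1 * (k == 0)%:R.
Proof.
rewrite !site_pos_part mulrA -mulrDl -mulrBl mulrC; congr (_ * _).
have -> : 2 = (2 : int)%:~R :> R by [].
rewrite -intrM -intrD -intrB; case: eqVneq => [->//|k0].
by apply/eqP; rewrite intr_eq0; lia.
Qed.

Lemma siteD (n : nat) (j k : int) : @site R n (j + k) = site n j + site n k.
Proof. by rewrite /site intrD mulrDl. Qed.

Lemma siteD1 (n : nat) (k : int) : @site R n (k + 1) = site n k + n%:R^-1.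
Proof. by rewrite /site intrD mulrDl mul1r. Qed.

Lemma siteB1 (n : nat) (k : int) : @site R n (k - 1) = site n k - n%:R^-1.
Proof. by rewrite /site intrB mulrBl mul1r. Qed.

Lemma norm_site (n : nat) (k : int) : `|@site R n k| = `|k|%N%:R / n%:R.
Proof.
by rewrite /site normrM normfV normr_nat natr_absz intr_norm.
Qed.

Lemma weight_window (f : R -> R) (y h W : R) : 0 <= h <= 1 ->
  (forall x, (1 + `|x|) ^+ 2 * `|f x| <= W) ->
  forall x, `|x - y| <= h -> (1 + `|y|) ^+ 2 * `|f x| <= 4 * W.
Proof.
move=> /andP[h0 h1] fW x xy.
apply: (@le_trans _ _ ((4 * (1 + `|x|) ^+ 2) * `|f x|)); last first.
  by rewrite -mulrA ler_wpM2l.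
rewrite ler_wpM2r//; have x0 := normr_ge0 x; have y0 := normr_ge0 y.
have : `|y| <= `|x| + 1.
  have -> : y = x + (y - x) by ring.
  by apply: (le_trans (ler_normD _ _)); rewrite lerD2l distrC (le_trans xy).
by move=> yx; nra.
Qed.

Lemma heat_lipschitz_window (r y h W : R) : 0 < r -> 0 < h ->
  (forall x, `|x - y| <= h -> (1 + `|y|) ^+ 2 * `|heat1 r x| <= W) ->
  forall x, `|x - y| <= h ->
    (1 + `|y|) ^+ 2 * `|heat r x - heat r y| <= W * h.
Proof.
move=> r0 h0 W1 x xh; have a20 : 0 < (1 + `|y|) ^+ 2 by rewrite exprn_gt0// ltr_wpDr.
have yy : `|y - y| <= h by rewrite subrr normr0 ltW.
have W0 : 0 <= W by apply: le_trans (W1 y yy); rewrite mulr_ge0// exprn_ge0.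
rewrite mulrC -ler_pdivlMr//.
apply: (@le_trans _ _ (W / (1 + `|y|) ^+ 2 * `|x - y|)); last first.
  by rewrite mulrAC ler_pM2r ?invr_gt0// ler_wpM2l.
apply: (@mean_value_dist _ (heat r) (heat1 r) (y - h) (y + h));
  rewrite -?ler_distl// => z; rewrite -ler_distl => zh.
  exact: is_derive_heat_y.
by rewrite ler_pdivlMr// mulrC; exact: W1.
Qed.

(** The residual of the corrected potential: the corrector cancels the
  fluctuations of the environment, and what remains involves the corrector
  and its differences, all of which are small. *)
Lemma corrected_potential_residual (n : nat) (m r W delta : R)
  (tau sigma theta v : int -> R) (k : int) :
  (forall j, v j = heat_potential r (site n j) - Num.max (site n j) 0
    + theta j * heat r (site n j)) ->
  (0 < n)%N -> 0 < m -> 0 < r -> n%:R^-1 <= delta -> 1 <= tau k ->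
  sigma k - sigma (k - 1) = tau k / m - 1 ->
  (forall k, `|sigma k| <= delta * n%:R * (1 + `|@site R n k|)) ->
  (forall k, n%:R ^+ 2 * (theta (k + 1) - theta k) = sigma k) ->
  `|theta k| <= delta * (1 + `|@site R n k|) ^+ 2 ->
  (forall x, (1 + `|x|) ^+ 2 * `|heat1 r x| <= W) ->
  (forall x, (1 + `|x|) ^+ 2 * `|heat2 r x| <= W) ->
  `|tau k * ((heat r (site n k) + theta k * heat2 r (site n k)) * m^-1)
    - n%:R ^+ 2 * (v (k + 1) + v (k - 1) - 2 * v k)
    - n%:R * (k == 0)%:R| <= tau k * ((28 + m^-1) * delta * W).
Proof.
move=> vE n0 m0 r0 ndelta tau1 sigmaD sigmaB thetaD thetaB H1 H2.
have n0' : 0 < n%:R :> R by rewrite ltr0n.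
pose y k : R := site n k.
pose h : R := n%:R^-1.
have h0 : 0 < h by rewrite invr_gt0.
have h1 : h <= 1 by rewrite invf_le1// ler1n.
have delta0 : 0 < delta by exact: lt_le_trans ndelta.
have h01 : 0 <= h <= (1 : R) by rewrite (ltW h0) h1.
have W1 := weight_window (y := y k) h01 H1.
have W2 := weight_window (y := y k) h01 H2.
have hn : h * n%:R = 1 by rewrite /h mulVf// gt_eqF.
pose a := 1 + `|y k|.
have a1 : 1 <= a by rewrite /a lerDl.
have a2 : 1 <= a ^+ 2 by rewrite exprn_ege1.
have yp : y (k + 1) = y k + h by exact: siteD1.
have ym : y (k - 1) = y k - h by exact: siteB1.
have W0 : 0 <= W by apply: le_trans (H1 0); rewrite mulr_ge0// exprn_ge0// addr_ge0.
have hL := heat_lipschitz_window r0 h0 W1.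
rewrite -/(y k).
have hhp : `|y k + h - y k| <= h by rewrite addrAC subrr add0r gtr0_norm.
have hhm : `|y k - h - y k| <= h by rewrite addrAC subrr add0r normrN gtr0_norm.
(* Subtracting a parabola leaves a function whose second derivative vanishes at
   [y k] and is thus of order [h] nearby. *)
have dn0 : 0 < delta * n%:R by rewrite mulr_gt0.
have E1 : `|heat r (y k) - n%:R ^+ 2 *
    (heat_potential r (y k + h) + heat_potential r (y k - h)
      - 2 * heat_potential r (y k))| <= 8 * W * delta.
  pose f (x : R) := heat_potential r x - heat r (y k) / 2 * x ^+ 2.
  have := @second_difference _ f
    (fun x => heat_cdf r x - heat r (y k) * x)
    (fun x => heat r x - heat r (y k)) (y k) h (4 * W * h) (ltW h0).
  move=> /(_ _)/wrap[x _|].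
    apply: (derE _ (derB (is_derive_potential_y x r0) (derZ _ (derX 1 (derI x))))).
    by field.
  move=> /(_ _)/wrap[x _|].
    have := derB (is_derive_heat_cdf_y r x) (derZ (heat r (y k)) (derI x)).
    by rewrite mulr1.
  move=> /(_ _)/wrap[x xh|].
    apply: le_trans (hL x xh); rewrite ler_peMl//.
  move=> H; rewrite distrC.
  have -> : n%:R ^+ 2 *
    (heat_potential r (y k + h) + heat_potential r (y k - h)
      - 2 * heat_potential r (y k)) - heat r (y k) =
    n%:R ^+ 2 * (f (y k + h) + f (y k - h) - 2 * f (y k)).
    have hE : h = n%:R^-1 by [].
    by rewrite /f hE; field; rewrite gt_eqF.
  rewrite normrM (@gtr0_norm _ (_ ^+ 2)) ?exprn_gt0//.
  apply: (@le_trans _ _ (n%:R ^+ 2 * (2 * (4 * W * h) * h ^+ 2))).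
    by rewrite ler_pM2l ?exprn_gt0.
  have -> : n%:R ^+ 2 * (2 * (4 * W * h) * h ^+ 2) = 8 * W * h * (h * n%:R) ^+ 2 by ring.
  by rewrite hn expr1n mulr1 ler_wpM2l// mulr_ge0.
have E2 : `|tau k * (theta k * heat2 r (y k) / m)| <= tau k * delta * W / m.
  rewrite normrM (normrM _ m^-1) (normrM (theta k)) normfV (gtr0_norm m0).
  rewrite (@ger0_norm _ (tau k)); last first.
    exact: le_trans tau1.
  rewrite -!mulrA ler_wpM2l//; first exact: le_trans tau1.
  rewrite !mulrA ler_pM2r ?invr_gt0//.
  apply: (@le_trans _ _ (delta * a ^+ 2 * `|heat2 r (y k)|)).
    by rewrite ler_wpM2r// thetaB.
  by rewrite -mulrA ler_pM2l//; exact: H2.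
have E3 : `|sigma k * (heat r (y k + h) - heat r (y k))| <= 4 * W * delta.
  rewrite normrM; apply: (@le_trans _ _
    (delta * n%:R * (a ^+ 2 * `|heat r (y k + h) - heat r (y k)|))).
    rewrite mulrA ler_wpM2r//; apply: (le_trans (sigmaB k)).
    by rewrite -/(y k) -/a ler_pM2l// expr2 ler_peMl// (le_trans ler01).
  apply: (@le_trans _ _ (delta * n%:R * (4 * W * h))).
    by rewrite ler_wpM2l ?mulr_ge0 ?(ltW delta0)// hL.
  have -> : delta * n%:R * (4 * W * h) = 4 * W * delta * (h * n%:R) by ring.
  by rewrite hn mulr1.
have E4 : `|sigma (k - 1) * (heat r (y k - h) - heat r (y k))| <= 8 * W * delta.
  rewrite normrM; apply: (@le_trans _ _
    (2 * delta * n%:R * (a ^+ 2 * `|heat r (y k - h) - heat r (y k)|))).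
    rewrite mulrA ler_wpM2r//; apply: (le_trans (sigmaB _)).
    rewrite -/(y _) ym -!mulrA (mulrCA 2) ler_pM2l// (mulrCA 2) ler_pM2l//.
    have : `|y k - h| <= `|y k| + h by rewrite (le_trans (ler_normB _ _))// (gtr0_norm h0).
    by rewrite -/a; move: a1; rewrite /a; nra.
  apply: (@le_trans _ _ (2 * delta * n%:R * (4 * W * h))).
    by rewrite ler_wpM2l ?mulr_ge0 ?(ltW delta0)// hL.
  have -> : 2 * delta * n%:R * (4 * W * h) = 8 * W * delta * (h * n%:R) by ring.
  by rewrite hn mulr1.
have E5 : `|theta k * (n%:R ^+ 2 * (heat r (y k + h) + heat r (y k - h)
     - 2 * heat r (y k)))| <= 8 * W * delta.
  have L0 : 0 < a ^+ 2 by lra.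
  have := @second_difference _ (heat r) (heat1 r) (heat2 r) (y k) h
     (4 * W / a ^+ 2) (ltW h0).
  move=> /(_ (fun x _ => is_derive_heat_y x r0) (fun x _ => is_derive_heat1_y x r0)).
  move=> /(_ _)/wrap[x xh|H].
    by rewrite ler_pdivlMr// mulrC W2.
  rewrite normrM normrM (@gtr0_norm _ (_ ^+ 2)) ?exprn_gt0//.
  apply: (@le_trans _ _ (delta * a ^+ 2 * (n%:R ^+ 2 * (2 * (4 * W / a ^+ 2) * h ^+ 2)))).
    rewrite ler_pM ?mulr_ge0 ?exprn_ge0//.
    by rewrite ler_pM2l ?exprn_gt0.
  have -> : delta * a ^+ 2 * (n%:R ^+ 2 * (2 * (4 * W / a ^+ 2) * h ^+ 2)) =
    8 * W * delta * (h * n%:R) ^+ 2 by field; rewrite gt_eqF//; lra.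
  by rewrite hn expr1n mulr1.
have -> : tau k * ((heat r (y k) + theta k * heat2 r (y k)) * m^-1)
    - n%:R ^+ 2 * (v (k + 1) + v (k - 1) - 2 * v k)
    - n%:R * (k == 0)%:R =
  (heat r (y k) - n%:R ^+ 2 *
    (heat_potential r (y k + h) + heat_potential r (y k - h)
      - 2 * heat_potential r (y k)))
  + tau k * (theta k * heat2 r (y k) / m)
  - sigma k * (heat r (y k + h) - heat r (y k))
  + sigma (k - 1) * (heat r (y k - h) - heat r (y k))
  - theta k * (n%:R ^+ 2 * (heat r (y k + h) + heat r (y k - h)
     - 2 * heat r (y k))).
  have := site_pos_part_laplacian n k; rewrite -/(y _) -/(y _) -/(y _) -/h.
  have hE : (k == 0)%:R = n%:R * (h * (k == 0)%:R) :> R.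
    by rewrite mulrA (mulrC n%:R) hn mul1r.
  move=> L; rewrite hE -L !vE -!/(y _) yp ym.
  have := sigmaD; have := thetaD k; have := thetaD (k - 1); rewrite subrK.
  set Tp := theta (k + 1); set Tm := theta (k - 1); set T_ := theta k.
  move=> Sm S S'.
  have S1 : tau k / m = sigma k - sigma (k - 1) + 1 by rewrite S' subrK.
  have -> : tau k * ((heat r (y k) + T_ * heat2 r (y k)) / m) =
    (tau k / m) * heat r (y k) + tau k * (T_ * heat2 r (y k) / m) by ring.
  by rewrite S1 -S -Sm; ring.
apply: (@le_trans _ _ (8 * W * delta + tau k * delta * W / m + 4 * W * delta
   + 8 * W * delta + 8 * W * delta)).
  do 2![apply: (le_trans (ler_normB _ _)); apply: lerD => //;
        apply: (le_trans (ler_normD _ _)); apply: lerD => //].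
have Wd : 0 <= W * delta by rewrite mulr_ge0// ltW.
have : 0 <= (tau k - 1) * (W * delta) by rewrite mulr_ge0 ?subr_ge0.
have -> : tau k * ((28 + m^-1) * delta * W) =
  28 * (W * delta) + 28 * ((tau k - 1) * (W * delta)) + tau k * delta * W / m by ring.
have -> : 8 * W * delta + tau k * delta * W / m + 4 * W * delta
     + 8 * W * delta + 8 * W * delta =
  28 * (W * delta) + tau k * delta * W / m by ring.
lra.
Qed.

(** Homogenization of the occupation densities. The limiting potential, shifted
  in time to remove the initial singularity and corrected by a second primitive
  of the fluctuations of the environment, solves the heat equation of the trap
  model up to a small error; the maximum principle turns this into a bound on
  the difference. *)
Theorem occupation_comparison (m T : R) : 0 < m -> 0 < T ->
  exists2 C : R, 0 < C &
  forall (n : nat) (tau sigma : int -> R) (delta eps : R) (U dU : int -> R -> R),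
  (0 < n)%N -> n%:R^-1 <= delta -> 0 < eps <= 1 ->
  (forall k, 1 <= tau k) ->
  (forall k, sigma k - sigma (k - 1) = tau k / m - 1) ->
  (forall k, `|sigma k| <= delta * n%:R * (1 + `|@site R n k|)) ->
  (forall k, {within `[0, T], continuous (U k)}) ->
  (forall k (t : R), 0 < t <= T -> is_derive t 1 (U k) (dU k t)) ->
  (forall k, U k 0 = 0) ->
  (forall e : R, 0 < e -> exists M : nat, forall (k : int) (t : R),
     (M < `|k|)%N -> 0 <= t <= T -> `|U k t| <= e) ->
  (forall k (t : R), 0 < t <= T -> tau k * dU k t =
     n%:R ^+ 2 * (U (k + 1) t + U (k - 1) t - 2 * U k t) + n%:R * (k == 0)%:R) ->
  forall k (t : R), 0 < t <= T ->
    `|U k t - (heat_potential (t / m) (site n k) - Num.max (site n k) 0)|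
      <= C * (eps + delta / eps).
Proof.
move=> m0 T0; pose R0 := T / m + 1.
have Tm0 : 0 < T / m by rewrite divr_gt0.
have R01 : 1 <= R0 by rewrite /R0; lra.
have [C C0 HC] := heat_bounds R01.
have [C2 C20 HC2] := potential_time_shift R01.
pose K := 28 + m^-1.
have K0 : 0 < K by rewrite addr_gt0// invr_gt0.
exists (2 * C + C2 + 2 * m * (C * K) + 2 * C).
  by rewrite !addr_gt0// !mulr_gt0.
move=> n tau sigma delta eps U dU n0 ndelta /andP[e0 e1] tau1 sigmaD sigmaB
  Uc Ud U0 Udecay Ueq.
have n0' : 0 < n%:R :> R by rewrite ltr0n.
have h0 : 0 < n%:R^-1 :> R by rewrite invr_gt0.
have h1 : n%:R^-1 <= 1 :> R by rewrite invf_le1// ler1n.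
have delta0 : 0 < delta by exact: lt_le_trans ndelta.
pose y k : R := site n k.
pose theta k := int_primitive sigma k / n%:R ^+ 2.
have thetaD k : n%:R ^+ 2 * (theta (k + 1) - theta k) = sigma k.
  rewrite /theta -mulrBl int_primitiveD1; field.
  by rewrite gt_eqF.
have thetaB k : `|theta k| <= delta * (1 + `|y k|) ^+ 2.
  have := @int_primitive_bound R sigma k (delta * n%:R * (1 + `|y k|)).
  move=> /(_ _)/wrap[i ik|H].
    apply: (le_trans (sigmaB i)); rewrite ler_wpM2l ?mulr_ge0 ?(ltW delta0)//.
    by rewrite lerD2l /y !norm_site ler_pM2r// ler_nat.
  rewrite /theta normrM normfV (@gtr0_norm _ (_ ^+ 2)) ?exprn_gt0//.
  rewrite ler_pdivrMr ?exprn_gt0//; apply: (le_trans H).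
  have -> : `|k|%N%:R = `|y k| * n%:R :> R.
    by rewrite /y norm_site; field; rewrite gt_eqF.
  have yk0 := normr_ge0 (y k).
  have -> : `|y k| * n%:R * (delta * n%:R * (1 + `|y k|)) =
    delta * (n%:R ^+ 2) * (`|y k| * (1 + `|y k|)) by ring.
  have -> : delta * (1 + `|y k|) ^+ 2 * n%:R ^+ 2 =
    delta * n%:R ^+ 2 * (1 + `|y k|) ^+ 2 by ring.
  rewrite ler_wpM2l ?mulr_ge0 ?exprn_ge0 ?(ltW delta0) ?(ltW n0')//.
  by nra.
pose r t := t / m + eps ^+ 2.
have e20 : 0 < eps ^+ 2 by rewrite exprn_gt0.
have e21 : eps ^+ 2 <= 1 by rewrite exprn_ile1// ltW.
have rP t : 0 <= t <= T -> 0 < r t <= R0.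
  move=> /andP[t0 tT]; have : 0 <= t / m <= T / m.
    by rewrite divr_ge0 ?(ltW m0)// ler_pM2r ?invr_gt0.
  by rewrite /r /R0 => /andP[? ?]; apply/andP; split; lra.
have dr t : is_derive (t : R) 1 r m^-1.
  apply: (derE _ (derD (derM (derI t) (derC t m^-1)) (derC t _))); ring.
pose V k (t : R) := heat_potential (r t) (y k) - Num.max (y k) 0
  + theta k * heat (r t) (y k).
pose dV k (t : R) := (heat (r t) (y k) + theta k * heat2 (r t) (y k)) * m^-1.
have Vd k (t : R) : 0 <= t <= T -> is_derive t 1 (V k) (dV k t).
  move=> tT; have /andP[r0 _] := rP _ tT.
  apply: (derE _ (derD (derB (@der_comp _ (heat_potential ^~ (y k)) r t _ _
      (is_derive_potential_r (y k) r0) (dr t)) (derC t _))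
      (derZ (theta k) (@der_comp _ (heat ^~ (y k)) r t _ _
      (is_derive_heat_r (y k) r0) (dr t))))).
  by rewrite /dV; ring.
(* The barrier starts above the corrected potential at time [0], and its time
   derivative absorbs the residual, of order [delta * r t ^ (- 3 / 2)]: the time
   integral of the latter is only of order [delta / eps]. *)
pose B0 := 2 * C * eps + C * delta / eps.
pose w t := (r t * Num.sqrt (r t))^-1.
pose B (t : R) := B0 + 2 * m * (C * K * delta) * (eps^-1 - (Num.sqrt (r t))^-1).
have Bd (t : R) : 0 <= t <= T -> is_derive t 1 B (C * K * delta * w t).
  move=> tT; have /andP[r0 _] := rP _ tT.
  have s0 : 0 < Num.sqrt (r t) by rewrite sqrtr_gt0.
  have s2 : Num.sqrt (r t) ^+ 2 = r t by rewrite sqr_sqrtr// ltW.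
  have sn0 : Num.sqrt (r t) != 0 by rewrite gt_eqF.
  apply: (derE _ (derD (derC t B0) (derZ _ (derB (derC t _)
    (@der_comp _ (fun x => x^-1) (fun t => Num.sqrt (r t)) t _ _ (derV sn0)
      (@der_comp _ Num.sqrt r t _ _ (derS r0) (dr t))))))).
  rewrite /w; set s := Num.sqrt (r t) in s0 s2 sn0 *.
  by rewrite -s2; field; rewrite sn0 gt_eqF.
have w0 t : 0 <= t <= T -> 0 < w t.
  move=> tT; have /andP[r0 _] := rP _ tT.
  by rewrite invr_gt0 mulr_gt0// sqrtr_gt0.
have dd0 : 0 < eps^-1 by rewrite invr_gt0.
have es (t : R) : 0 <= t -> (Num.sqrt (r t))^-1 <= eps^-1.
  move=> t0; have sq : eps = Num.sqrt (eps ^+ 2) by rewrite sqrtr_sqr gtr0_norm.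
  rewrite lef_pV2 ?posrE// ?sqrtr_gt0 ?(lt_le_trans e20)// ?lerDr ?divr_ge0 ?(ltW m0)//.
  by rewrite {1}sq ler_sqrt ?lerDr ?divr_ge0 ?addr_ge0 ?divr_ge0 ?(ltW m0) ?(ltW e20).
have B00 : 0 <= B0 by rewrite addr_ge0// ?mulr_ge0// ?divr_ge0// ltW// mulr_gt0.
have CKd : 0 < C * K * delta by rewrite !mulr_gt0.
have Bge (t : R) : 0 <= t -> B0 <= B t.
  by move=> t0; rewrite lerDl mulr_ge0 ?subr_ge0 ?es// ltW// !mulr_gt0.
have Ble (t : R) : B t <= B0 + 2 * m * (C * K * delta) / eps.
  rewrite lerD2l ler_wpM2l//; first by rewrite ltW// !mulr_gt0.
  by rewrite gerBl invr_ge0 sqrtr_ge0.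
have Vc k : {within `[0, T], continuous (V k)}.
  apply: derivable_within_continuous => x; rewrite in_itv/= => xT.
  by have [] := Vd k x xT.
have Bc : {within `[0, T], continuous B}.
  apply: derivable_within_continuous => x; rewrite in_itv/= => xT.
  by have [] := Bd x xT.
have residual k (t : R) : 0 < t <= T ->
    `|tau k * dV k t - n%:R ^+ 2 * (V (k + 1) t + V (k - 1) t - 2 * V k t)
      - n%:R * (k == 0)%:R| <= tau k * (C * K * delta * w t).
  move=> /andP[t0 tT].
  have /rP r0R : 0 <= t <= T by rewrite (ltW t0).
  have /andP[r0 rR] := r0R.
  have H1 x : (1 + `|x|) ^+ 2 * `|heat1 (r t) x| <= C * w t.
    by have [_ + _] := HC (r t) x r0R.
  have H2 x : (1 + `|x|) ^+ 2 * `|heat2 (r t) x| <= C * w t.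
    by have [_ _ +] := HC (r t) x r0R.
  have := corrected_potential_residual (fun j => erefl (V j t)) n0 m0 r0 ndelta (tau1 k) (sigmaD k) sigmaB
    thetaD (thetaB k) H1 H2.
  have -> : C * K * delta * w t = (28 + m^-1) * delta * (C * w t).
    by rewrite /K; ring.
  by [].
have theta_heat k (t : R) : 0 <= t <= T ->
    `|theta k * heat (r t) (y k)| <= C * delta * (Num.sqrt (r t))^-1.
  move=> tT; have [+ _ _] := HC (r t) (y k) (rP _ tT).
  have /andP[r0 _] := rP _ tT; have h0' := heat_gt0 (y k) r0.
  move=> Hh; rewrite normrM (gtr0_norm h0').
  apply: (@le_trans _ _ (delta * ((1 + `|y k|) ^+ 3 * heat (r t) (y k)))).
    rewrite [leRHS]mulrA ler_pM2r//; apply: (le_trans (thetaB k)).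
    by rewrite ler_pM2l// ler_weXn2l// lerDl.
  by rewrite (mulrC C) -[leRHS]mulrA ler_pM2l.
have potential_V k (t : R) : 0 <= t <= T ->
    `|heat_potential (r t) (y k) - Num.max (y k) 0| <= 2 * r t * heat (r t) (y k).
  move=> tT; have /andP[r0 _] := rP _ tT.
  by rewrite ger0_norm ?potential_ge0// potential_le.
have r0E : r 0 = eps ^+ 2 by rewrite /r mul0r add0r.
have V0 k : `|V k 0| <= B0.
  have T00 : 0 <= (0 : R) <= T by rewrite lexx ltW.
  apply: (le_trans (ler_normD _ _)); rewrite lerD//.
    apply: (le_trans (potential_V k _ T00)).
    have [+ _ _] := HC (r 0) (y k) (rP _ T00).
    rewrite r0E sqrtr_sqr (gtr0_norm e0) ler_pdivlMr// => Hh.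
    have h0' := heat_gt0 (y k) e20.
    have : heat (eps ^+ 2) (y k) * eps <= C.
      apply: le_trans Hh; rewrite ler_pM2r// ler_peMl ?(ltW h0')//.
      by rewrite exprn_ege1// lerDl.
    by move=> H; rewrite expr2 -!mulrA ler_pM2l// mulrCA mulrC ler_pM2r// mulrC.
  by have := theta_heat k _ T00; rewrite r0E sqrtr_sqr (gtr0_norm e0).
have Vdecay e : 0 < e -> exists M : nat, forall (k : int) (t : R),
    (M < `|k|)%N -> 0 <= t <= T -> `|V k t| <= e.
  move=> e0'; pose A := (2 * R0 + delta) * C / eps * n%:R / e.
  exists (Num.truncn `|A|) => k t kM tT.
  have /andP[r0 rR] := rP _ tT.
  have h0' := heat_gt0 (y k) r0.
  have [+ _ _] := HC (r t) (y k) (rP _ tT).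
  set a := 1 + `|y k|; set g := heat _ _ in h0' *.
  have a1 : 1 <= a by rewrite /a lerDl.
  move=> H3; have {}H3 : a ^+ 3 * g <= C / eps.
    by apply: (le_trans H3); rewrite ler_pM2l// es//; case/andP: tT.
  have : `|V k t| <= (2 * R0 + delta) * (a ^+ 2 * g).
    apply: (le_trans (ler_normD _ _)); rewrite mulrDl lerD//.
      apply: (le_trans (potential_V k t tT)); rewrite -/g.
      apply: (@le_trans _ _ (2 * R0 * g)); first by rewrite ler_pM2r// ler_pM2l.
      rewrite ler_wpM2l ?mulr_ge0//; first by lra.
      by rewrite ler_peMl ?(ltW h0')// exprn_ege1.
    by rewrite normrM (gtr0_norm h0') [leRHS]mulrA ler_pM2r// thetaB.
  move=> /le_trans; apply.
  have a0 : 0 < a by exact: lt_le_trans a1.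
  have R0d : 0 < 2 * R0 + delta by lra.
  apply: (@le_trans _ _ ((2 * R0 + delta) * (C / eps / a))).
    rewrite ler_pM2l// ler_pdivlMr//.
    by have -> : a ^+ 2 * g * a = a ^+ 3 * g by ring.
  rewrite !mulrA ler_pdivrMr// -ler_pdivrMl//.
  have : `|A| < `|k|%N%:R.
    have := truncnS_gt `|A|; move/lt_le_trans; apply.
    by rewrite ler_nat.
  move=> Ak; have : A / n%:R <= `|y k|.
    rewrite /y norm_site ler_pM2r ?invr_gt0//.
    by rewrite (le_trans (ler_norm _))// ltW.
  have -> : A / n%:R = e^-1 * ((2 * R0 + delta) * C / eps).
    by rewrite /A; field; rewrite !gt_eqF.
  by rewrite /a; lra.
pose Z (s : R) k (t : R) := s * (U k t - V k t) - B t.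
pose dZ (s : R) k (t : R) := s * (dU k t - dV k t) - C * K * delta * w t.
have Zmax (s : R) : `|s| = 1 -> forall k (t : R), 0 <= t <= T -> Z s k t <= 0.
  move=> s1; apply: (@maximum_principle _ tau (n%:R ^+ 2) T (Z s) (dZ s)) => //.
  - by move=> k; exact: lt_le_trans (tau1 k).
  - move=> k x; apply: cvgB; last exact: Bc.
    by apply: cvgM; [exact: cvg_cst|apply: cvgB; [exact: Uc|exact: Vc]].
  - move=> k t /andP[t0 tT].
    have t0T : 0 <= t <= T by rewrite (ltW t0).
    apply: derB; last exact: Bd.
    by apply: derZ; apply: derB; [apply: Ud; rewrite t0|exact: Vd].
  - move=> k; rewrite /Z U0 sub0r mulrN subr_le0.
    apply: (le_trans (ler_norm _)); rewrite normrN normrM s1 mul1r.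
    by apply: le_trans (Bge 0 (lexx 0)); exact: V0.
  - move=> e e0'; have e40 : 0 < e / 2 by rewrite divr_gt0.
    have [M1 HM1] := Udecay _ e40; have [M2 HM2] := Vdecay _ e40.
    exists (maxn M1 M2) => k t kM tT.
    have Bt : 0 <= B t by apply: le_trans (Bge t _) => //; case/andP: tT.
    rewrite lerBlDr; apply: (le_trans (ler_norm _)); rewrite normrM s1 mul1r.
    apply: (le_trans (ler_normB _ _)); apply: (@le_trans _ _ e); last by rewrite lerDl.
    rewrite [e]splitr lerD//; [apply: HM1|apply: HM2] => //.
      by apply: leq_ltn_trans kM; exact: leq_maxl.
    by apply: leq_ltn_trans kM; exact: leq_maxr.
  - move=> k t tT; have := residual k t tT; have := Ueq k t tT.
    rewrite /dZ /Z => UE Rk.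
    have -> : tau k * (s * (dU k t - dV k t) - C * K * delta * w t) =
      s * (tau k * dU k t - tau k * dV k t) - tau k * (C * K * delta * w t) by ring.
    rewrite lerBlDr -lerBlDl UE; apply: le_trans Rk.
    set E := (X in _ <= `|X|).
    have -> : s * (n%:R ^+ 2 * (U (k + 1) t + U (k - 1) t - 2 * U k t) +
        n%:R * (k == 0)%:R - tau k * dV k t) -
      n%:R ^+ 2 * (s * (U (k + 1) t - V (k + 1) t) - B t +
        (s * (U (k - 1) t - V (k - 1) t) - B t) -
        2 * (s * (U k t - V k t) - B t)) = - (s * E) by rewrite /E; ring.
    by apply: (le_trans (ler_norm _)); rewrite normrN normrM s1 mul1r.
move=> k t /andP[t0 tT]; have t0T : 0 <= t <= T by rewrite (ltW t0).
have D : `|U k t - V k t| <= B t.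
  rewrite ler_norml; apply/andP; split.
    have := Zmax (-1) _ k t t0T; rewrite normrN1 => /(_ erefl); rewrite /Z; lra.
  have := Zmax 1 _ k t t0T; rewrite normr1 => /(_ erefl); rewrite /Z; lra.
have tm0 : 0 < t / m by rewrite divr_gt0.
have shift := HC2 (t / m) eps (y k) tm0 e0.
have /andP[r0 rR] := rP _ t0T.
move: shift; rewrite -/(r t) => /(_ rR)/andP[sh0 shC].
have th : `|theta k * heat (r t) (y k)| <= C * delta / eps.
  apply: (le_trans (theta_heat k _ t0T)).
  by rewrite ler_wpM2l ?es ?(ltW t0)// ltW// mulr_gt0.
have -> : U k t - (heat_potential (t / m) (site n k) - Num.max (site n k) 0) =
  (U k t - V k t) + (heat_potential (r t) (y k) - heat_potential (t / m) (y k))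
   + theta k * heat (r t) (y k) by rewrite /V -/(y k); ring.
apply: (@le_trans _ _ (B t + C2 * eps + C * delta / eps)).
  apply: (le_trans (ler_normD _ _)); apply: lerD => //.
  apply: (le_trans (ler_normD _ _)); apply: lerD => //.
  by rewrite ger0_norm.
have := Ble t; rewrite /B0.
have de0 : 0 < delta / eps by rewrite divr_gt0.
set q := delta / eps in de0 *.
rewrite -!mulrA -/q => Bt.
have A1 : 0 <= m * (C * (K * eps)) by rewrite !mulr_ge0// ltW.
have A2 : 0 <= C2 * q by rewrite mulr_ge0// ltW.
have A3 : 0 <= C * eps by rewrite mulr_ge0// ltW.
have A4 : 0 <= C * q by rewrite mulr_ge0// ltW.
have -> : (2 * C + C2 + 2 * (m * (C * K)) + 2 * C) * (eps + q) =
  2 * (C * eps) + 2 * (C * q) + C2 * eps + C2 * q + 2 * (m * (C * (K * eps)))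
  + 2 * (m * (C * (K * q))) + 2 * (C * eps) + 2 * (C * q) by ring.
lra.
Qed.

End comparison.

(** * Forward equations on the integer line *)

Section calculus_bis.
Context {R : realType}.
Notation mu := (@lebesgue_measure R).

Lemma derSum N (F : 'I_N -> R -> R) (d : 'I_N -> R) (x : R) :
  (forall i, is_derive x 1 (F i) (d i)) ->
  is_derive x 1 (fun t => \sum_(i < N) F i t) (\sum_(i < N) d i).
Proof.
move=> dF; have -> : (fun t => \sum_(i < N) F i t) = \sum_(i < N) F i.
  by apply/funext => t; rewrite fct_sumE.
exact: is_derive_sum.
Qed.

Lemma within_continuous_sum (A : set R) N (F : 'I_N -> R -> R) :
  (forall i, {within A, continuous (F i)}) ->
  {within A, continuous (fun t => \sum_(i < N) F i t)}.
Proof.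
elim: N F => [|N IH] F dF.
  have -> : (fun t : R => \sum_(i < 0) F i t) = cst 0.
    by apply/funext => t; rewrite big_ord0.
  by move=> x; exact: cvg_cst.
have -> : (fun t : R => \sum_(i < N.+1) F i t) =
    fun t => \sum_(i < N) F (widen_ord (leqnSn N) i) t + F ord_max t.
  by apply/funext => t; rewrite big_ord_recr.
by move=> x; apply: cvgD; [apply: IH|exact: dF].
Qed.

Lemma derive_le_incr (f g df dg : R -> R) (a b : R) : a <= b ->
  {within `[a, b], continuous f} -> {within `[a, b], continuous g} ->
  (forall x, a < x < b -> is_derive x 1 f (df x)) ->
  (forall x, a < x < b -> is_derive x 1 g (dg x)) ->
  (forall x, a < x < b -> df x <= dg x) -> f b - f a <= g b - g a.
Proof.
move=> ab fc gc fd gd dfg.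
have := @mean_value_le R (fun x => f x - g x) (fun x => df x - dg x) a b 0 ab.
rewrite mul0r => /(_ _)/wrap[|].
  by move=> x; apply: cvgB; [exact: fc|exact: gc].
move=> /(_ _)/wrap[x xab|]; first by apply: derB; [exact: fd|exact: gd].
move=> /(_ _)/wrap[x xab|]; first by rewrite subr_le0; exact: dfg.
lra.
Qed.

Lemma derive0_constant (f : R -> R) (a b : R) : a <= b ->
  {within `[a, b], continuous f} ->
  (forall x, a < x < b -> is_derive x 1 f 0) -> f b = f a.
Proof.
move=> ab fc fd; apply/eqP; rewrite -subr_eq0 -normr_le0 -(mul0r (b - a)).
apply: (@mean_value_norm R f (cst 0) a b 0 ab fc fd) => x _.
by rewrite normr0.
Qed.

Definition primitive (f : R -> R) (t : R) := (\int[mu]_(x in `[0, t]) f x)%R.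

Lemma primitive0 f : primitive f 0 = 0.
Proof. by rewrite /primitive set_itv1 Rintegral_set1. Qed.

Lemma primitive_integrable (f : R -> R) (t : R) : continuous f ->
  mu.-integrable `[0, t] (EFin \o f).
Proof.
move=> fc; apply: continuous_compact_integrable; first exact: segment_compact.
exact: continuous_subspaceT.
Qed.

Lemma is_derive_primitive (f : R -> R) (t : R) : continuous f -> 0 < t ->
  is_derive t 1 (primitive f) (f t).
Proof.
move=> fc t0; have t1 : t < t + 1 by rewrite ltrDl.
have [d e] := continuous_FTC1_closed t1 (primitive_integrable (t + 1) fc) t0 (fc t).
by apply: DeriveDef; [exact: d|rewrite -derive1E; exact: e].
Qed.

Lemma primitive_continuous (f : R -> R) (T : R) : continuous f -> 0 <= T ->
  {within `[0, T], continuous (primitive f)}.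
Proof.
move=> fc T0; apply: parameterized_integral_continuous => //.
exact: primitive_integrable.
Qed.

Lemma bounded_sums_decay (g : nat -> R) (B : R) : (forall i, 0 <= g i) ->
  (forall N, \sum_(i < N) g i <= B) ->
  forall e, 0 < e -> exists M, forall i, (M <= i)%N -> g i <= e.
Proof.
move=> g0 gB e e0.
have c : cvgn (series g).
  apply: nondecreasing_is_cvgn; first exact: nondecreasing_series.
  by exists B => _ [N _ <-]; rewrite /series/= big_mkord.
have /cvgrPdist_le/(_ _ e0)[M _ HM] := cvg_series_cvg_0 c.
exists M => i Mi; have := HM i Mi; rewrite sub0r normrN; apply: le_trans.
exact: ler_norm.
Qed.

End calculus_bis.

Section forward_equation.
Context {R : realType}.

Definition isum (a : int) (N : nat) (F : int -> R) := \sum_(i < N) F (a + i%:Z).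

Lemma ltn_absz_left (M : nat) : (M < absz (- M%:Z - 1)%R)%N.
Proof. lia. Qed.

Lemma isum_telescope a N (G : int -> R) :
  isum a N (fun k => G (k + 1) - G k) = G (a + N%:Z) - G a.
Proof.
elim: N => [|N IH]; first by rewrite /isum big_ord0 addr0 subrr.
rewrite /isum big_ord_recr/= -/(isum a N (fun k => G (k + 1) - G k)) IH.
have -> : a + N%:Z + 1 = a + N.+1%:Z by lia.
by ring.
Qed.

Lemma isum_delta a N (c : int) (F : int -> R) :
  isum a N (fun k => F k * (k == c)%:R) = F c * (a <= c < a + N%:Z)%R%:R.
Proof.
elim: N => [|N IH].
  rewrite /isum big_ord0; have -> : (a <= c < a + 0%:Z) = false by lia.
  by rewrite mulr0.
rewrite /isum big_ord_recr/= -/(isum a N (fun k => F k * (k == c)%:R)) IH.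
case: eqVneq => [<-|ac]; last first.
  rewrite mulr0 addr0; congr (F c * _%:R); congr nat_of_bool; lia.
have -> : (a <= a + N%:Z < a + N%:Z) = false by lia.
have -> : (a <= a + N%:Z < a + N.+1%:Z) = true by lia.
by rewrite mulr0 add0r.
Qed.

(** The densities [u k t] of the law at time [t], with respect to the speed measure,
  of the chain started at [a]. *)
Record forward_solution (n : nat) (tau : int -> R) (a : int)
    (u : int -> R -> R) : Prop := ForwardSolution {
  fs_ge0 : forall k t, 0 <= t -> 0 <= u k t;
  fs_continuous : forall k, continuous (u k);
  fs_derive : forall k (t : R), 0 < t -> is_derive t 1 (u k)
    (n%:R ^+ 2 / tau k * (u (k + 1) t + u (k - 1) t - 2 * u k t));
  fs_init : forall k, u k 0 = n%:R / tau a * (k == a)%:R;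
  fs_mass : forall t c N, 0 <= t ->
    isum c N (fun k => tau k / n%:R * u k t) <= 1 }.

Section one_solution.
Variables (n : nat) (tau : int -> R) (a : int) (u : int -> R -> R).
Hypothesis n0 : (0 < n)%N.
Hypothesis tau1 : forall k, 1 <= tau k.
Hypothesis fu : forward_solution n tau a u.

Let n0' : 0 < n%:R :> R. Proof. by rewrite ltr0n. Qed.
Let tau0 k : 0 < tau k. Proof. exact: lt_le_trans (tau1 k). Qed.

Lemma fs_le k t : 0 <= t -> u k t <= n%:R.
Proof.
move=> t0; have := fs_mass fu k 1 t0.
rewrite /isum big_ord1 addr0 -mulrAC ler_pdivrMr// mul1r; apply: le_trans.
by rewrite ler_peMl// (fs_ge0 fu).
Qed.

Definition occupation k t := primitive (u k) t.
Local Notation U := occupation.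

Lemma occupation0 k : U k 0 = 0. Proof. exact: primitive0. Qed.

Lemma is_derive_occupation k (t : R) : 0 < t -> is_derive t 1 (U k) (u k t).
Proof. by move=> t0; apply: is_derive_primitive => //; exact: (fs_continuous fu). Qed.

Lemma occupation_continuous k T : 0 <= T -> {within `[0, T], continuous (U k)}.
Proof. by move=> T0; apply: primitive_continuous => //; exact: (fs_continuous fu). Qed.

Lemma occupation_incr k s t : 0 <= s <= t -> U k s <= U k t.
Proof.
move=> /andP[s0 st]; rewrite -subr_ge0 -(mul0r (t - s)).
apply: (@mean_value_ge R (U k) (u k) s t 0 st).
- have sub : `[s, t]%classic `<=` `[0, t]%classic.
    by move=> x /=; rewrite !in_itv/= => /andP[sx ->]; rewrite (le_trans s0).
  by apply: (continuous_subspaceW sub); apply: occupation_continuous; lra.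
- by move=> x /andP[sx _]; apply: is_derive_occupation; exact: le_lt_trans sx.
- by move=> x /andP[sx _]; apply: (fs_ge0 fu); rewrite (le_trans s0)// ltW.
Qed.

Lemma occupation_ge0 k t : 0 <= t -> 0 <= U k t.
Proof. by move=> t0; rewrite -(occupation0 k); apply: occupation_incr; rewrite lexx. Qed.

Lemma occupation_mass c N t : 0 <= t -> isum c N (fun k => U k t) <= n%:R * t.
Proof.
move=> t0; rewrite -[t in leRHS]subr0.
have -> : isum c N (U ^~ t) = isum c N (U ^~ t) - isum c N (U ^~ 0).
  by rewrite [X in _ - X]big1 ?subr0// => i _; exact: occupation0.
apply: (@mean_value_le R (fun t => isum c N (U ^~ t)) (fun t => isum c N (u ^~ t)) 0 t).
- by [].
- by apply: within_continuous_sum => i; exact: occupation_continuous.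
- by move=> x /andP[x0 _]; apply: derSum => i; exact: is_derive_occupation.
- move=> x /andP[x0 _]; rewrite -[leRHS]mulr1.
  apply: (@le_trans _ _ (n%:R * isum c N (fun k => tau k / n%:R * u k x))).
    rewrite mulr_sumr; apply: ler_sum => i _.
    rewrite mulrA mulrCA divff ?mulr1 ?gt_eqF// ler_peMl//.
    exact: (fs_ge0 fu _ (ltW x0)).
  by rewrite ler_pM2l// (fs_mass fu)// ltW.
Qed.

Lemma occupation_decay T e : 0 <= T -> 0 < e -> exists M : nat,
  forall (k : int) (t : R), (M < `|k|)%N -> 0 <= t <= T -> `|U k t| <= e.
Proof.
move=> T0 e0.
have [M1 HM1] := @bounded_sums_decay R (fun i : nat => U i%:Z T) (n%:R * T)
  (fun i => occupation_ge0 _ T0)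
  (fun N => ltac:(have := occupation_mass 0 N T0; rewrite /isum;
     under eq_bigr do rewrite add0r; exact)) _ e0.
have [M2 HM2] := @bounded_sums_decay R (fun i : nat => U (Negz i) T) (n%:R * T)
  (fun i => occupation_ge0 _ T0)
  (fun N => ltac:(have := occupation_mass (- N%:Z) N T0; rewrite /isum;
     rewrite (reindex_inj rev_ord_inj)/=;
     under eq_bigr => i _ do
      (have -> : - N%:Z + (N - i.+1)%N%:Z = Negz i by have := ltn_ord i; lia);
     exact)) _ e0.
exists (maxn M1 M2) => k t kM /andP[t0 tT].
rewrite ger0_norm ?occupation_ge0//.
apply: (@le_trans _ _ (U k T)); first by apply: occupation_incr; rewrite t0.
by case: k kM => j jM; [apply: HM1|apply: HM2]; lia.
Qed.

(** Integrating the forward equation in time exchanges the singular initial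
  condition for a bounded source term. *)
Lemma occupation_equation k t : 0 <= t -> tau k * u k t =
  n%:R ^+ 2 * (U (k + 1) t + U (k - 1) t - 2 * U k t) + n%:R * (k == a)%:R.
Proof.
move=> t0.
pose f t := tau k * u k t - n%:R ^+ 2 * (U (k + 1) t + U (k - 1) t - 2 * U k t).
suff : f t = f 0.
  rewrite /f !occupation0 (fs_init fu) => H.
  apply/eqP; rewrite addrC -subr_eq; apply/eqP; rewrite H.
  case: eqVneq => [->|_]; last by rewrite !mulr0; ring.
  by field; rewrite gt_eqF.
apply: derive0_constant => //.
  move=> x; apply: cvgB.
    by apply: cvgMr; apply: continuous_subspaceT; exact: (fs_continuous fu).
  apply: cvgMr; apply: cvgB; last by apply: cvgMr; exact: occupation_continuous.
  by apply: cvgD; exact: occupation_continuous.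
move=> x /andP[x0 _].
have dU j := is_derive_occupation j x0.
apply: (derE _ (derB (derZ (tau k) (fs_derive fu k x0)) (derZ (n%:R ^+ 2)
  (derB (derD (dU (k + 1)) (dU (k - 1))) (derZ 2 (dU k)))))).
by field; rewrite gt_eqF.
Qed.

End one_solution.

Section conservation.
Variables (n : nat) (tau : int -> R).
Hypothesis n0 : (0 < n)%N.
Hypothesis tau1 : forall k, 1 <= tau k.

Let n0' : 0 < n%:R :> R. Proof. by rewrite ltr0n. Qed.
Let tau0 k : 0 < tau k. Proof. exact: lt_le_trans (tau1 k). Qed.

Variables (a b : int) (u v : int -> R -> R).
Hypothesis fu : forward_solution n tau a u.
Hypothesis fv : forward_solution n tau b v.
Local Notation U := (occupation u).
Local Notation V := (occupation v).

Let box_lt (c : int) M : (`|c| <= M)%N ->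
  (- M%:Z <= c < - M%:Z + (M + M).+1%:Z)%R = true.
Proof. lia. Qed.

(** The Laplacian is symmetric, so that the derivative of the scalar product over a
  box telescopes to flux terms at its ends. These are bounded by the solution
  itself, whose time integral is small far away. *)
Lemma box_product_variation M t s1 s2 : 0 <= s1 <= s2 -> s2 <= t -> 
  `|isum (- M%:Z) (M + M).+1 (fun k => tau k / n%:R * (u k s2 * v k (t - s2)))
   - isum (- M%:Z) (M + M).+1 (fun k => tau k / n%:R * (u k s1 * v k (t - s1)))|
  <= n%:R ^+ 2 * (U M.+1%:Z t + U M%:Z t + U (- M%:Z) t + U (- M%:Z - 1) t).
Proof.
move=> /andP[s10 s12] s2t; have t0 : 0 <= t by lra.
pose I s := isum (- M%:Z) (M + M).+1 (fun k => tau k / n%:R * (u k s * v k (t - s))).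
pose G k (s : R) := u k s * v (k - 1) (t - s) - u (k - 1) s * v k (t - s).
pose B s := n%:R ^+ 2 * (U M.+1%:Z s + U M%:Z s + U (- M%:Z) s + U (- M%:Z - 1) s).
pose dB s := n%:R ^+ 2 * (u M.+1%:Z s + u M%:Z s + u (- M%:Z) s + u (- M%:Z - 1) s).
pose dI s := n%:R * (G M.+1%:Z s - G (- M%:Z) s).
have dv k (s : R) : s < t -> is_derive s 1 (fun s => v k (t - s))
    (- (n%:R ^+ 2 / tau k * (v (k + 1) (t - s) + v (k - 1) (t - s) - 2 * v k (t - s)))).
  move=> st; have ts0 : 0 < t - s by rewrite subr_gt0.
  have := @der_comp R (v k) (fun s => t - s) s _ _ (fs_derive fv k ts0)
    (derB (derC s t) (derI s)).
  by rewrite sub0r mulrN1.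
have dIE (s : R) : 0 < s < t -> is_derive s 1 I (dI s).
  move=> /andP[s0 st].
  apply: (derE _ (@derSum _ _ _ _ _ (fun i => derZ (tau (- M%:Z + i%:Z) / n%:R)
    (derM (fs_derive fu (- M%:Z + i%:Z) s0) (dv (- M%:Z + i%:Z) s st))))).
  rewrite /dI.
  have <- : isum (- M%:Z) (M + M).+1 (fun k => G (k + 1) s - G k s) =
      G M.+1%:Z s - G (- M%:Z) s.
    by rewrite (isum_telescope _ _ (G ^~ s)); congr (G _ s - _); lia.
  rewrite mulr_sumr; apply: eq_bigr => i _; rewrite /G addrK.
  by field; rewrite !gt_eqF.
have dBE (s : R) : 0 < s -> is_derive s 1 B (dB s).
  by move=> s0; apply: derZ; do !apply: derD; apply: (is_derive_occupation fu).
have Gb k s : 0 <= s <= t -> `|G k s| <= n%:R * (u k s + u (k - 1) s).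
  move=> /andP[s0 st]; have ts0 : 0 <= t - s by rewrite subr_ge0.
  apply: (le_trans (ler_normB _ _)); rewrite mulrDr.
  rewrite !ger0_norm ?mulr_ge0 ?(fs_ge0 fu)// ?(fs_ge0 fv)//.
  rewrite (mulrC (u k s)) (mulrC (u (k - 1) s)).
  by rewrite lerD// ler_wpM2r ?(fs_ge0 fu)// (fs_le n0 tau1 fv).
have dIB s : 0 <= s <= t -> `|dI s| <= dB s.
  move=> st; rewrite /dI normrM (gtr0_norm n0').
  apply: (@le_trans _ _ (n%:R * (`|G M.+1%:Z s| + `|G (- M%:Z) s|))).
    by rewrite ler_pM2l// ler_normB.
  have := Gb M.+1%:Z s st; have := Gb (- M%:Z) s st.
  have -> : M.+1%:Z - 1 = M%:Z by lia.
  move=> G1 G2; rewrite /dB expr2 -!mulrA ler_pM2l//.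
  by apply: (le_trans (lerD G2 G1)); rewrite !mulrDr; lra.
have sub : `[s1, s2]%classic `<=` `[0, t]%classic.
  move=> x /=; rewrite !in_itv/= => /andP[sx xs].
  by rewrite (le_trans s10 sx) (le_trans xs s2t).
have Ic : {within `[s1, s2], continuous I}.
  apply: within_continuous_sum => i; apply: continuous_subspaceT => x.
  apply: cvgMr; apply: cvgM; first exact: (fs_continuous fu).
  apply: (@cvg_comp _ _ _ (fun s => t - s) (v _)); last exact: (fs_continuous fv).
  by apply: cvgB; [exact: cvg_cst|exact: cvg_id].
have Bc : {within `[s1, s2], continuous B}.
  have Uc k : {within `[0, t], continuous (U k)}.
    by apply: (occupation_continuous fu).
  apply: (continuous_subspaceW sub) => x; apply: cvgMr.
  exact: cvgD (cvgD (cvgD (Uc _ x) (Uc _ x)) (Uc _ x)) (Uc _ x).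
have xP x : s1 < x < s2 -> 0 < x < t.
  by move=> /andP[sx xs]; rewrite (le_lt_trans s10 sx) (lt_le_trans xs s2t).
have main : `|I s2 - I s1| <= B s2 - B s1.
  rewrite ler_norml; apply/andP; split.
    rewrite lerNl opprB; have := @derive_le_incr R (fun s => - I s) B (fun s => - dI s) dB
      s1 s2 s12; rewrite opprK addrC; apply.
    - by move=> x; apply: cvgN; exact: Ic.
    - exact: Bc.
    - by move=> x /xP xt; apply: derN; exact: dIE.
    - by move=> x /xP/andP[x0 _]; exact: dBE.
    - move=> x /xP/andP[x0 xt]; have := dIB x (introT andP (conj (ltW x0) (ltW xt))).
      by rewrite ler_norml => /andP[+ _]; rewrite lerNl.
  apply: (@derive_le_incr R I B dI dB s1 s2 s12 Ic Bc).
  - by move=> x /xP xt; exact: dIE.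
  - by move=> x /xP/andP[x0 _]; exact: dBE.
  - move=> x /xP/andP[x0 xt]; have := dIB x (introT andP (conj (ltW x0) (ltW xt))).
    by rewrite ler_norml => /andP[].
apply: (le_trans main).
have B1 : 0 <= B s1 by rewrite mulr_ge0 ?exprn_ge0 ?addr_ge0// (occupation_ge0 fu).
apply: (@le_trans _ _ (B s2)); first by rewrite gerBl.
rewrite ler_wpM2l ?exprn_ge0//.
by do !apply: lerD; apply: (occupation_incr fu); rewrite (le_trans s10 s12).
Qed.

Let boundary_decay t e : 0 <= t -> 0 < e -> exists M0 : nat,
  forall M, (M0 <= M)%N ->
  n%:R ^+ 2 * (U M.+1%:Z t + U M%:Z t + U (- M%:Z) t + U (- M%:Z - 1) t) <= e.
Proof.
move=> t0 e0; pose e' := e / (4 * n%:R ^+ 2).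
have e'0 : 0 < e' by rewrite divr_gt0// mulr_gt0// exprn_gt0.
have [M0 HM] := occupation_decay n0 tau1 fu t0 e'0.
exists M0.+1 => M MM.
have H k : (M0 < `|k|)%N -> U k t <= e'.
  by move=> kM; apply: (le_trans (ler_norm _)); apply: HM; rewrite ?t0 ?lexx.
have H1 := H M.+1%:Z ltac:(lia).
have H2 := H M%:Z ltac:(lia).
have H3 := H (- M%:Z) ltac:(lia).
have H4 := H (- M%:Z - 1) ltac:(lia).
apply: (@le_trans _ _ (n%:R ^+ 2 * (e' + e' + e' + e'))).
  by rewrite ler_wpM2l ?exprn_ge0// !lerD.
rewrite le_eqVlt; apply/orP; left; apply/eqP; rewrite /e'.
by field; rewrite gt_eqF.
Qed.

Let init_product (c : int) (w z : int -> R -> R) M s :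
  (`|c| <= M)%N -> (forall k, z k 0 = n%:R / tau c * (k == c)%:R) ->
  isum (- M%:Z) (M + M).+1 (fun k => tau k / n%:R * (w k s * z k 0)) = w c s.
Proof.
move=> cM z0.
have -> : isum (- M%:Z) (M + M).+1 (fun k => tau k / n%:R * (w k s * z k 0)) =
    isum (- M%:Z) (M + M).+1 (fun k => w k s * (k == c)%:R).
  apply: eq_bigr => i _; rewrite z0; case: eqVneq => [->|_].
    by field; rewrite !gt_eqF.
  by rewrite !mulr0.
by rewrite isum_delta box_lt// mulr1.
Qed.

(** Reversibility: the scalar product of [u s] and [v (2 * t - s)] depends on [s]
  only through boundary terms, and at [s = 2 * t] it is a value of [u]. *)
Lemma forward_product t e : 0 <= t -> 0 < e -> exists M0 : nat,
  forall M, (M0 <= M)%N ->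
  `|u b (2 * t) - isum (- M%:Z) (M + M).+1 (fun k => tau k / n%:R * (u k t * v k t))|
  <= e.
Proof.
move=> t0 e0; have t20 : 0 <= 2 * t by rewrite mulr_ge0.
have [M0 HM0] := boundary_decay t20 e0.
exists (maxn M0 (maxn `|a| `|b|)) => M MM.
have tt : 0 <= t <= 2 * t by rewrite t0/=; lra.
have := box_product_variation M tt (lexx (2 * t)).
rewrite subrr (_ : 2 * t - t = t); last by ring.
rewrite (init_product (c := b) _ _ _ (fs_init fv)); last by lia.
by move=> /le_trans; apply; apply: HM0; lia.
Qed.

End conservation.

Section energy.
Variables (n : nat) (tau : int -> R).
Hypothesis n0 : (0 < n)%N.
Hypothesis tau1 : forall k, 1 <= tau k.

Let n0' : 0 < n%:R :> R. Proof. by rewrite ltr0n. Qed.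
Let tau0 k : 0 < tau k. Proof. exact: lt_le_trans (tau1 k). Qed.

Variables (a b : int) (u v : int -> R -> R).
Hypothesis fu : forward_solution n tau a u.
Hypothesis fv : forward_solution n tau b v.
Variable sg : R.
Hypothesis sg1 : `|sg| = 1.
Local Notation U := (occupation u).
Local Notation V := (occupation v).

Let f k (s : R) := u k s + sg * v k s.
Let energy M (s : R) :=
  isum (- M%:Z) (M + M).+1 (fun k => tau k / n%:R * f k s ^+ 2).

Let sg2 : sg ^+ 2 = 1.
Proof. by rewrite -(real_normK (num_real _)) sg1 expr1n. Qed.

Let f_sqr_le k s : 0 <= s -> f k s ^+ 2 <= 2 * n%:R * (u k s + v k s).
Proof.
move=> s0; have u0 := fs_ge0 fu k s0; have v0 := fs_ge0 fv k s0.
have un := fs_le n0 tau1 fu k s0; have vn := fs_le n0 tau1 fv k s0.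
rewrite -(real_normK (num_real (f k s))).
have : `|f k s| <= u k s + v k s.
  by rewrite (le_trans (ler_normD _ _))// normrM sg1 mul1r !ger0_norm.
move=> fuv; apply: (@le_trans _ _ ((u k s + v k s) ^+ 2)).
  by rewrite lerXn2r ?nnegrE ?addr_ge0.
by rewrite expr2 ler_wpM2r ?addr_ge0//; lra.
Qed.

(** The Dirichlet form makes the energy decrease; over a finite box only the
  boundary terms can make it increase. *)
Let energy_variation M s1 s2 : 0 <= s1 <= s2 ->
  energy M s2 - energy M s1 <= 2 * n%:R ^+ 2 *
   (U M.+1%:Z s2 + V M.+1%:Z s2 + U (- M%:Z - 1) s2 + V (- M%:Z - 1) s2).
Proof.
move=> /andP[s10 s12].
pose B s := 2 * n%:R ^+ 2 *
   (U M.+1%:Z s + V M.+1%:Z s + U (- M%:Z - 1) s + V (- M%:Z - 1) s).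
pose dB s := 2 * n%:R ^+ 2 *
   (u M.+1%:Z s + v M.+1%:Z s + u (- M%:Z - 1) s + v (- M%:Z - 1) s).
pose df k s := n%:R ^+ 2 / tau k * (f (k + 1) s + f (k - 1) s - 2 * f k s).
pose dE s := isum (- M%:Z) (M + M).+1
  (fun k => tau k / n%:R * (2%:R * f k s ^+ 1 * df k s)).
have dfE k (s : R) : 0 < s -> is_derive s 1 (f k) (df k s).
  move=> s0; apply: (derE _ (derD (fs_derive fu k s0) (derZ sg (fs_derive fv k s0)))).
  by rewrite /df /f; ring.
have dEE (s : R) : 0 < s -> is_derive s 1 (energy M) (dE s).
  by move=> s0; apply: derSum => i; apply: derZ; apply: derX; exact: dfE.
have dBE (s : R) : 0 < s -> is_derive s 1 B (dB s).
  move=> s0; apply: derZ; do !apply: derD;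
  by [apply: (is_derive_occupation fu)|apply: (is_derive_occupation fv)].
have dEB s : 0 <= s -> dE s <= dB s.
  move=> s0; pose H k := f k s ^+ 2 - f (k - 1) s ^+ 2.
  apply: (@le_trans _ _ (n%:R * (H M.+1%:Z - H (- M%:Z)))).
    have -> : H M.+1%:Z - H (- M%:Z) =
        isum (- M%:Z) (M + M).+1 (fun k => H (k + 1) - H k).
      by rewrite isum_telescope; congr (H _ - _); lia.
    rewrite mulr_sumr; apply: ler_sum => i _; set k := - M%:Z + i%:Z.
    rewrite /H addrK /df.
    have -> : tau k / n%:R * (2 * f k s ^+ 1 * (n%:R ^+ 2 / tau k *
       (f (k + 1) s + f (k - 1) s - 2 * f k s))) =
      n%:R * (2 * f k s * (f (k + 1) s + f (k - 1) s - 2 * f k s)).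
      by field; rewrite !gt_eqF.
    rewrite ler_pM2l//.
    have := sqr_ge0 (f (k + 1) s - f k s); have := sqr_ge0 (f (k - 1) s - f k s).
    by nra.
  rewrite /H (_ : M.+1%:Z - 1 = M%:Z); last by lia.
  have := f_sqr_le M.+1%:Z s0; have := f_sqr_le (- M%:Z - 1) s0.
  have := sqr_ge0 (f M%:Z s); have := sqr_ge0 (f (- M%:Z) s).
  move=> h1 h2 h3 h4.
  rewrite /dB (expr2 n%:R) mulrCA -!mulrA ler_pM2l//.
  by move: h3 h4; rewrite !mulrDr !mulrA; lra.
have cont (w : int -> R -> R) c (fw : forward_solution n tau c w) k :
  {within `[s1, s2], continuous (occupation w k)}.
  have sub : `[s1, s2]%classic `<=` `[0, s2]%classic.
    by move=> x /=; rewrite !in_itv/= => /andP[sx ->]; rewrite (le_trans s10 sx).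
  by apply: (continuous_subspaceW sub); apply: (occupation_continuous fw); lra.
have Bc : {within `[s1, s2], continuous B}.
  move=> x; apply: cvgMr.
  by apply: cvgD; [apply: cvgD; [apply: cvgD|]|];
     [exact: (cont _ _ fu)|exact: (cont _ _ fv)|exact: (cont _ _ fu)|exact: (cont _ _ fv)].
have Ec : {within `[s1, s2], continuous (energy M)}.
  apply: within_continuous_sum => i; apply: continuous_subspaceT => x.
  have fc : f (- M%:Z + i%:Z) s @[s --> x] --> f (- M%:Z + i%:Z) x.
    apply: cvgD; first exact: (fs_continuous fu).
    by apply: cvgMr; exact: (fs_continuous fv).
  by apply: cvgMr; rewrite expr2; exact: cvgM.
have xP (x : R) : s1 < x < s2 -> 0 < x by move=> /andP[? _]; exact: le_lt_trans s10 _.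
have := @derive_le_incr R (energy M) B dE dB s1 s2 s12 Ec Bc
  (fun x xs => dEE x (xP x xs)) (fun x xs => dBE x (xP x xs))
  (fun x xs => dEB x (ltW (xP x xs))).
move=> /le_trans; apply; rewrite gerBl /B.
rewrite !mulr_ge0 ?exprn_ge0 ?addr_ge0//;
  by [apply: (occupation_ge0 fu)|apply: (occupation_ge0 fv)].
Qed.

(** By reversibility the two sides are the values of the energy of [u + sg * v], and
  the semigroup is a contraction in the space of square summable functions. *)
Lemma density_combination_decr s1 s2 : 0 <= s1 <= s2 ->
  u a (2 * s2) + v b (2 * s2) + 2 * sg * u b (2 * s2) <=
  u a (2 * s1) + v b (2 * s1) + 2 * sg * u b (2 * s1).
Proof.
move=> s12; have /andP[s10 s12'] := s12; have s20 : 0 <= s2 by exact: le_trans s12'.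
have approx s e : 0 <= s -> 0 < e -> exists M0 : nat, forall M, (M0 <= M)%N ->
  `|u a (2 * s) + v b (2 * s) + 2 * sg * u b (2 * s) - energy M s| <= 4 * e.
  move=> s0 e0.
  have [M1 H1] := forward_product n0 tau1 fu fu s0 e0.
  have [M2 H2] := forward_product n0 tau1 fv fv s0 e0.
  have [M3 H3] := forward_product n0 tau1 fu fv s0 e0.
  exists (maxn M1 (maxn M2 M3)) => M MM.
  have {}H1 := H1 M ltac:(lia); have {}H2 := H2 M ltac:(lia).
  have {}H3 := H3 M ltac:(lia).
  set P1 := isum _ _ _ in H1; set P2 := isum _ _ _ in H2; set P3 := isum _ _ _ in H3.
  have -> : energy M s = P1 + P2 + 2 * sg * P3.
    rewrite /P1 /P2 /P3 /isum mulr_sumr -!big_split/=; apply: eq_bigr => i _.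
    rewrite /f; set k := _ + _; rewrite sqrrD exprMn sg2; ring.
  have -> : u a (2 * s) + v b (2 * s) + 2 * sg * u b (2 * s) -
      (P1 + P2 + 2 * sg * P3) = (u a (2 * s) - P1) + (v b (2 * s) - P2)
        + 2 * sg * (u b (2 * s) - P3) by ring.
  have -> : 4 * e = e + e + 2 * e by ring.
  apply: (le_trans (ler_normD _ _)); apply: lerD.
    by apply: (le_trans (ler_normD _ _)); exact: lerD.
  by rewrite !normrM sg1 mulr1 (@gtr0_norm _ 2)// ler_pM2l.
apply/ler_addgt0Pr => e e0.
pose e' := e / 12; have e'0 : 0 < e' by rewrite divr_gt0.
pose d := e' / (2 * n%:R ^+ 2).
have d0 : 0 < d by rewrite divr_gt0// mulr_gt0// exprn_gt0.
have [M1 H1] := approx s1 e' s10 e'0; have [M2 H2] := approx s2 e' s20 e'0.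
have [M3 H3] := occupation_decay n0 tau1 fu s20 d0.
have [M4 H4] := occupation_decay n0 tau1 fv s20 d0.
pose M := maxn (maxn M1 M2) (maxn M3 M4).
have {}H1 : _ := H1 M (leq_trans (leq_maxl _ _) (leq_maxl _ _)).
have {}H2 : _ := H2 M (leq_trans (leq_maxr _ _) (leq_maxl _ _)).
have UV k : (M < `|k|)%N -> U k s2 <= d /\ V k s2 <= d.
  move=> kM; split; apply: (le_trans (ler_norm _)).
    apply: H3; last by rewrite s20 lexx.
    exact: leq_ltn_trans (leq_trans (leq_maxl _ _) (leq_maxr _ _)) kM.
  apply: H4; last by rewrite s20 lexx.
  exact: leq_ltn_trans (leq_trans (leq_maxr _ _) (leq_maxr _ _)) kM.
have := energy_variation M s12.
have [A1 A2] := UV M.+1%:Z (ltnSn M).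
have [A3 A4] := UV (- M%:Z - 1) (ltn_absz_left M).
have : 2 * n%:R ^+ 2 *
   (U M.+1%:Z s2 + V M.+1%:Z s2 + U (- M%:Z - 1) s2 + V (- M%:Z - 1) s2) <= 4 * e'.
  have -> : 4 * e' = 2 * n%:R ^+ 2 * (d + d + d + d).
    by rewrite /d; field; rewrite gt_eqF.
  by rewrite ler_wpM2l ?mulr_ge0 ?exprn_ge0// !lerD.
move=> B1 B2; have := le_trans B2 B1.
move: H1 H2; rewrite !ler_norml => /andP[? ?] /andP[? ?] ?.
have : e = 12 * e' by rewrite /e'; field.
lra.
Qed.

End energy.

End forward_equation.

(** * From occupation times to distribution functions and densities *)

Section estimates.
Context {R : realType}.
Local Notation pot0 r y := (heat_potential r y - Num.max y 0).

(** At scale [n] the environment looks homogeneous with mean [m]: the primitive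
  [sigma] of its normalised fluctuations is at most [eta ^ 4] times the
  macroscopic scale. The fourth power is chosen because the occupation times will
  turn out to be accurate to order [eta ^ 2], and one differentiation, which is all
  that separates them from the quantities of interest, costs a square root. *)
Record homogenized (n : nat) (m : R) (tau : int -> R) (eta : R) : Prop := Homogenized {
  hom_gt0 : (0 < n)%N;
  hom_eta : 0 < eta <= 1;
  hom_mesh : n%:R^-1 <= eta ^+ 4;
  hom_trap : forall k, 1 <= tau k;
  hom_fluct : exists2 sigma : int -> R,
    forall k, sigma k - sigma (k - 1) = tau k / m - 1 &
    forall k, `|sigma k| <= eta ^+ 4 * n%:R * (1 + `|@site R n k|) }.

Let absz_shift (M : nat) (a j : int) : (M + `|a| < `|j|)%N -> (M < `|(a + j)%R|)%N.
Proof. lia. Qed.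

(** For a chain started at another site the environment is translated, which costs
  a factor [1 + A] in the bound on its fluctuations. *)
Lemma occupation_estimate (m T A : R) : 0 < m -> 0 < T -> 0 <= A ->
  exists2 C : R, 0 < C & forall (n : nat) (tau : int -> R) (eta : R) (a : int) u,
  homogenized n m tau eta -> `|@site R n a| <= A -> forward_solution n tau a u ->
  forall k (t : R), 0 < t <= T ->
    `|occupation u k t - pot0 (t / m) (site n (k - a))| <= C * eta ^+ 2.
Proof.
move=> m0 T0 A0; have [C C0 HC] := occupation_comparison m0 T0.
exists (C * (2 + A)); first by rewrite mulr_gt0// ltr_wpDr.
move=> n tau eta a u [n0 /andP[e0 e1] mesh tau1 [sigma sigmaD sigmaB]] aA fu k t tT.
have n0' : 0 < n%:R :> R by rewrite ltr0n.
have T0' := ltW T0.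
have e4 : 0 < eta ^+ 4 by exact: exprn_gt0.
have A1 : 0 < 1 + A by rewrite ltr_wpDr.
have := HC n (fun j => tau (a + j)) (fun j => sigma (a + j)) ((1 + A) * eta ^+ 4)
  (eta ^+ 2) (fun j => occupation u (a + j)) (fun j => u (a + j)) n0.
move=> /(_ _)/wrap[|H].
  by apply: (le_trans mesh); rewrite ler_peMl ?(ltW e4)// lerDl.
move: H.
move=> /(_ _)/wrap[|H]; first by rewrite exprn_gt0// exprn_ile1// ltW.
have {H} := fun a1 a2 a3 a4 a5 a6 a7 => H (fun j => tau1 _) a1 a2 a3 a4 a5 a6 a7 (k - a) t tT.
rewrite [a + (k - a)]addrC subrK => H.
have -> : C * (2 + A) * eta ^+ 2 = C * (eta ^+ 2 + (1 + A) * eta ^+ 4 / eta ^+ 2).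
  by field; rewrite gt_eqF.
apply: H.
- by move=> j; rewrite addrA.
- move=> j; apply: (le_trans (sigmaB _)).
  rewrite [(1 + A) * eta ^+ 4]mulrC -[eta ^+ 4 * (1 + A) * n%:R]mulrA.
  rewrite [(1 + A) * n%:R]mulrC !mulrA -[leRHS]mulrA ler_pM2l ?mulr_gt0// siteD.
  have := ler_normD (@site R n a) (site n j); have := normr_ge0 (@site R n j).
  nra.
- by move=> j; exact: occupation_continuous fu _ _ T0'.
- by move=> j s /andP[s0 _]; exact: is_derive_occupation fu _ _ s0.
- by move=> j; exact: occupation0.
- move=> e ep; have [M HM] := occupation_decay n0 tau1 fu T0' ep.
  exists (M + `|a|)%N => j s jM sT; apply: HM => //; exact: absz_shift.
- move=> j s /andP[s0 _].
  rewrite (occupation_equation tau1 fu _ (ltW s0)) !addrA.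
  by rewrite -[X in _ == X]addr0 (inj_eq (addrI a)).
Qed.

(** The discrete gradient of the occupation density plus the positive part of the
  site: by the integrated forward equation, its increment at each site is the
  probability of that site. *)
Definition occupation_cdf (n : nat) u (k : int) (t : R) : R :=
  n%:R * (occupation u (k + 1) t - occupation u k t) + (0 <= k)%R%:R.

Lemma occupation_cdfE n u k (t : R) : (0 < n)%N ->
  occupation_cdf n u k t =
  n%:R * ((occupation u (k + 1) t + Num.max (site n (k + 1)) 0)
          - (occupation u k t + Num.max (site n k) 0)).
Proof.
move=> n0; have n0' : 0 < n%:R :> R by rewrite ltr0n.
rewrite /occupation_cdf !site_pos_part.
have -> : Num.max (k + 1) 0 = Num.max k 0 + (0 <= k)%R%:R :> int by lia.
rewrite intrD; have -> : ((0 <= k)%R%:R : int)%:~R = (0 <= k)%R%:R :> R.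
  by case: (0 <= k)%R.
by field; rewrite gt_eqF.
Qed.

Lemma occupation_cdf_step n tau u k (t : R) : (0 < n)%N -> (forall k, 1 <= tau k) ->
  forward_solution n tau 0 u -> 0 <= t ->
  occupation_cdf n u k t - occupation_cdf n u (k - 1) t = tau k / n%:R * u k t.
Proof.
move=> n0 tau1 fu t0; have n0' : 0 < n%:R :> R by rewrite ltr0n.
have E := occupation_equation tau1 fu k t0.
rewrite mulrAC E /occupation_cdf subrK.
have -> : (k == 0)%:R = (0 <= k)%R%:R - (0 <= k - 1)%R%:R :> R.
  have [->|] := eqVneq k 0; first by rewrite subr0.
  by case: (leP 0 k) => k0 kn; case: (leP 0 (k - 1)) => k1 /=; rewrite ?subrr//; lia.
by field; rewrite gt_eqF.
Qed.

Lemma occupation_cdf_incr n tau u (t : R) : (0 < n)%N -> (forall k, 1 <= tau k) ->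
  forward_solution n tau 0 u -> 0 <= t -> forall k (j : nat),
  occupation_cdf n u k t <= occupation_cdf n u (k + j%:Z) t.
Proof.
move=> n0 tau1 fu t0 k; elim => [|j IH]; first by rewrite addr0.
apply: (le_trans IH).
rewrite -subr_ge0; have -> : k + j%:Z = k + j.+1%:Z - 1 by lia.
rewrite (occupation_cdf_step _ n0 tau1 fu t0) mulr_ge0 ?(fs_ge0 fu)//.
by rewrite divr_ge0 ?ler0n// (le_trans ler01).
Qed.

(** A convex function that is uniformly close to a smooth convex one has a close
  slope: compare the slope at a point with the mean slope over a window of width
  [eta] on either side of it. *)
Lemma occupation_cdf_estimate (m t : R) : 0 < m -> 0 < t ->
  exists2 C : R, 0 < C & forall (n : nat) (tau : int -> R) (eta : R) u,
  homogenized n m tau eta -> forward_solution n tau 0 u ->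
  forall k, `|occupation_cdf n u k t - heat_cdf (t / m) (site n k)| <= C * eta.
Proof.
move=> m0 t0; have r0 : 0 < t / m by rewrite divr_gt0.
have [C C0 HC] := occupation_estimate m0 t0 (lexx 0).
have [B B0 HB] : exists2 B : R, 0 < B & forall y, heat (t / m) y <= B.
  have [B B0 HB] := heat_bounded (t / m) r0; exists B => // y.
  by have [] := HB (t / m) y ltac:(by rewrite lexx).
exists (2 * B + 2 * C); first by rewrite addr_gt0// mulr_gt0.
move=> n tau eta u hom fu k; have [n0 /andP[e0 e1] mesh tau1 _] := hom.
have n0' : 0 < n%:R :> R by rewrite ltr0n.
pose A (j : int) := occupation u j t + Num.max (@site R n j) 0.
have Aest j : `|A j - heat_potential (t / m) (site n j)| <= C * eta ^+ 2.
  have := HC n tau eta 0 u hom _ fu j t.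
  rewrite subr0 /site mul0r normr0 => /(_ (lexx 0)).
  rewrite t0 lexx => /(_ isT); rewrite /A /site; congr (`|_| <= _); ring.
have [N [N0 Neta Neta2]] : exists N : nat, [/\ (0 < N)%N,
    eta <= N%:R / n%:R & N%:R / n%:R <= 2 * eta].
  have en : 1 <= eta * n%:R.
    rewrite -ler_pdivrMr//= div1r; apply: (le_trans mesh).
    by rewrite -[leRHS]expr1 ler_wiXn2l// ltW.
  exists (Num.truncn (eta * n%:R)).+1; split => //.
    by rewrite ler_pdivlMr// ltW// truncnS_gt.
  rewrite ler_pdivrMr// -[_.+1]addn1 natrD.
  have := truncn_itv (mulr_ge0 (ltW e0) (ltW n0')) => /andP[H _]; lra.
have N0' : 0 < N%:R :> R by rewrite ltr0n.
pose h : R := N%:R / n%:R; have h0 : 0 < h by rewrite divr_gt0.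
have inc := occupation_cdf_incr n0 tau1 fu (ltW t0).
have tele (c : int) : \sum_(i < N) occupation_cdf n u (c + i%:Z) t =
    n%:R * (A (c + N%:Z) - A c).
  rewrite -(@isum_telescope R c N A) /isum big_distrr/=; apply: eq_bigr => i _.
  by rewrite occupation_cdfE.
have siteN c : site n (c + N%:Z) = site n c + h :> R.
  by rewrite siteD.
have lip (x y : R) : x <= y ->
    heat_cdf (t / m) x <= heat_cdf (t / m) y <= heat_cdf (t / m) x + B * (y - x).
  move=> xy; have cd z := is_derive_heat_cdf_y (t / m) z.
  have cc : {within `[x, y], continuous (heat_cdf (t / m))}.
    by apply: continuous_subspaceT => z; exact: heat_cdf_continuous.
  have H1 := @mean_value_le R _ _ x y B xy cc (fun z _ => cd z) (fun z _ => HB z).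
  have H2 := @mean_value_ge R _ _ x y 0 xy cc (fun z _ => cd z)
    (fun z _ => ltW (heat_gt0 z r0)).
  by apply/andP; split; lra.
have potB (x y : R) : x <= y ->
    heat_cdf (t / m) x * (y - x) <= heat_potential (t / m) y - heat_potential (t / m) x
      <= heat_cdf (t / m) y * (y - x).
  move=> xy; have cd z := is_derive_potential_y z r0.
  have cc : {within `[x, y], continuous (heat_potential (t / m))}.
    by apply: continuous_subspaceT => z; exact: is_derive1_continuous (cd z).
  have H1 := @mean_value_le R _ _ x y (heat_cdf (t / m) y) xy cc (fun z _ => cd z).
  have H2 := @mean_value_ge R _ _ x y (heat_cdf (t / m) x) xy cc (fun z _ => cd z).
  apply/andP; split.
    by apply: H2 => z /andP[xz zy]; have /andP[] := lip _ _ (ltW xz).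
  by apply: H1 => z /andP[xz zy]; have /andP[] := lip _ _ (ltW zy).
have sumE : n%:R = N%:R / h by rewrite /h; field; rewrite !gt_eqF.
have mean (c : int) : `|(\sum_(i < N) occupation_cdf n u (c + i%:Z) t) / N%:R -
   (heat_potential (t / m) (site n c + h) - heat_potential (t / m) (site n c)) / h|
   <= 2 * C * eta.
  rewrite tele sumE -siteN.
  have -> : N%:R / h * (A (c + N%:Z) - A c) / N%:R = (A (c + N%:Z) - A c) / h.
    by field; rewrite !gt_eqF.
  rewrite -mulrBl normrM (@gtr0_norm _ h^-1) ?invr_gt0// ler_pdivrMr//.
  apply: (@le_trans _ _ (2 * C * eta ^+ 2)); last first.
    by rewrite expr2 mulrA ler_pM2l// mulr_gt0// mulr_gt0.
  have := Aest c; have := Aest (c + N%:Z); rewrite !ler_norml.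
  by move=> /andP[? ?] /andP[? ?]; apply/andP; split; lra.
rewrite ler_norml; apply/andP; split.
- have up : (\sum_(i < N) occupation_cdf n u (k - N%:Z + i%:Z) t) / N%:R
      <= occupation_cdf n u k t.
    rewrite ler_pdivrMr//.
    apply: (@le_trans _ _ (\sum_(i < N) occupation_cdf n u k t)); last first.
      by rewrite sumr_const card_ord mulr_natr.
    apply: ler_sum => i _; apply: (le_trans (inc _ (N - i)%N)).
    by rewrite -addrA -PoszD subnKC ?subrK// ltnW.
  have := mean (k - N%:Z); rewrite ler_norml => /andP[lo _].
  have yh : site n (k - N%:Z) + h = site n k :> R by rewrite -siteN subrK.
  have xy : site n (k - N%:Z) <= site n k :> R by rewrite -yh lerDl ltW.
  have /andP[P1 _] := potB _ _ xy; have /andP[_ L1] := lip _ _ xy.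
  have hE : site n k - site n (k - N%:Z) = h by rewrite -yh; ring.
  rewrite hE in P1 L1; rewrite yh in lo.
  have {}P1 : heat_cdf (t / m) (site n (k - N%:Z)) <= (heat_potential (t / m) (site n k)
     - heat_potential (t / m) (site n (k - N%:Z))) / h by rewrite ler_pdivlMr.
  have : B * h <= B * (2 * eta) by rewrite ler_pM2l.
  lra.
- have up : occupation_cdf n u k t <=
      (\sum_(i < N) occupation_cdf n u (k + i%:Z) t) / N%:R.
    rewrite ler_pdivlMr//.
    apply: (@le_trans _ _ (\sum_(i < N) occupation_cdf n u k t)).
      by rewrite sumr_const card_ord mulr_natr.
    by apply: ler_sum => i _; exact: inc.
  have := mean k; rewrite ler_norml => /andP[_ hi].
  have xy : site n k <= site n k + h :> R by rewrite lerDl ltW.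
  have /andP[_ P1] := potB _ _ xy; have /andP[_ L1] := lip _ _ xy.
  have hE : site n k + h - site n k = h by ring.
  rewrite hE in P1 L1.
  have {}P1 : (heat_potential (t / m) (site n k + h)
     - heat_potential (t / m) (site n k)) / h <= heat_cdf (t / m) (site n k + h).
    by rewrite ler_pdivrMr.
  have : B * h <= B * (2 * eta) by rewrite ler_pM2l.
  lra.
Qed.

(** The derivative of a concave function lies between its difference quotients to the
  left and to the right, and these are stable under uniform perturbations. *)
Lemma concave_derivative_estimate (G H g dg : R -> R) (t h e L : R) :
  0 < h ->
  {within `[t - h, t + h], continuous G} ->
  (forall s, t - h < s < t + h -> is_derive s 1 G (H s)) ->
  (forall s r, t - h < s <= r -> r < t + h -> H r <= H s) ->
  (forall s, t - h <= s <= t + h -> `|G s - g s| <= e) ->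
  (forall s, t - h <= s <= t + h -> is_derive s 1 g (dg s)) ->
  (forall s, t - h <= s <= t + h -> `|dg s - dg t| <= L) ->
  `|H t - dg t| <= L + 2 * e / h.
Proof.
move=> h0 Gc Gd Hdecr Gg gd dgL.
have th : t - h <= t <= t + h by apply/andP; split; lra.
have gdiff s : t - h <= s <= t + h -> {for s, continuous g}.
  by move=> sh; exact: is_derive1_continuous (gd s sh).
have gc : {within `[t - h, t + h], continuous g}.
  by apply: continuous_in_subspaceT => s; rewrite inE/= in_itv/=; exact: gdiff.
have sub1 : `[t, t + h] `<=` `[t - h, t + h].
  by move=> s /=; rewrite !in_itv/= => /andP[? ?]; apply/andP; split; lra.
have sub2 : `[t - h, t] `<=` `[t - h, t + h].
  by move=> s /=; rewrite !in_itv/= => /andP[? ?]; apply/andP; split; lra.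
have t1 : t <= t + h by lra.
have t2 : t - h <= t by lra.
have E1 : G (t + h) - G t <= H t * (t + h - t).
  apply: (mean_value_le t1 (continuous_subspaceW sub1 Gc)) => x /andP[x1 x2].
    by apply: Gd; apply/andP; split; lra.
  by apply: Hdecr => //; apply/andP; split; lra.
have E2 : H t * (t - (t - h)) <= G t - G (t - h).
  apply: (mean_value_ge t2 (continuous_subspaceW sub2 Gc)) => x /andP[x1 x2].
    by apply: Gd; apply/andP; split; lra.
  by apply: Hdecr; [apply/andP; split; lra|lra].
have E3 : (dg t - L) * (t + h - t) <= g (t + h) - g t.
  apply: (mean_value_ge t1 (continuous_subspaceW sub1 gc)) => x /andP[x1 x2].
    by apply: gd; apply/andP; split; lra.
  have /dgL : t - h <= x <= t + h by apply/andP; split; lra.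
  by rewrite ler_norml => /andP[? ?]; lra.
have E4 : g t - g (t - h) <= (dg t + L) * (t - (t - h)).
  apply: (mean_value_le t2 (continuous_subspaceW sub2 gc)) => x /andP[x1 x2].
    by apply: gd; apply/andP; split; lra.
  have /dgL : t - h <= x <= t + h by apply/andP; split; lra.
  by rewrite ler_norml => /andP[? ?]; lra.
have := Gg _ th.
have /Gg : t - h <= t + h <= t + h by apply/andP; split; lra.
have /Gg : t - h <= t - h <= t + h by apply/andP; split; lra.
rewrite !ler_norml => /andP[a1 a2] /andP[b1 b2] /andP[c1 c2].
have ehE : 2 * e / h * h = 2 * e by field; rewrite gt_eqF.
apply/andP; split.
- rewrite -(ler_pM2r h0); nra.
- rewrite -(ler_pM2r h0); nra.
Qed.

(** The transition density is not monotone in time, but by reversibility the two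
  combinations [p(a,a) + p(b,b) + 2 p(a,b)] and [p(a,a) + p(b,b) - 2 p(a,b)] are, so
  that their primitives, which are combinations of occupation times, are concave. *)
Lemma density_estimate (m T1 T2 A : R) : 0 < m -> 0 < T1 <= T2 -> 0 <= A ->
  exists2 C : R, 0 < C & forall (n : nat) (tau : int -> R) (eta : R) (a b : int) u v,
  homogenized n m tau eta -> `|@site R n a| <= A -> `|@site R n b| <= A ->
  forward_solution n tau a u -> forward_solution n tau b v ->
  forall (t : R), T1 <= t <= T2 ->
    `|u b t - heat (t / m) (site n (b - a)) / m| <= C * eta.
Proof.
move=> m0 /andP[T10 T12] A0.
pose T := T2 + T1; have T0 : 0 < T by rewrite /T; lra.
have [C C0 HC] := occupation_estimate m0 T0 A0.
have [B B0 HB] : exists2 B : R, 0 < B & forall r y, T1 / 2 / m <= r <= T / m ->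
    `|heat2 r y| <= B.
  have [|B B0 HB] := @heat_bounded R (T1 / 2 / m) (T / m); first by rewrite !divr_gt0.
  by exists B => // r y /HB H; have [] := H y.
pose L := 4 * B / m ^+ 2.
have L0 : 0 < L by rewrite divr_gt0 ?mulr_gt0// exprn_gt0.
exists (L * T1 + 16 * C / T1).
  by apply: addr_gt0; [exact: mulr_gt0 L0 T10|rewrite divr_gt0// mulr_gt0].
move=> n tau eta a b u v hom aA bA fu fv t /andP[t1 t2].
have [n0 /andP[e0 e1] mesh tau1 _] := hom.
pose y : R := site n (b - a); pose h := eta * (T1 / 2).
have h0 : 0 < h by rewrite mulr_gt0// divr_gt0.
have hT : h <= T1 / 2 by rewrite ler_piMl// ltW// divr_gt0.
have winT s : t - h <= s <= t + h -> T1 / 2 <= s <= T.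
  by move=> /andP[? ?]; rewrite /T; apply/andP; split; lra.
have win s : t - h <= s <= t + h -> 0 < s <= T.
  by move=> /winT/andP[s1 ->]; rewrite andbT (lt_le_trans _ s1)// divr_gt0.
have site0 c : site n (c - c) = 0 :> R by rewrite subrr /site mul0r.
have main sg : `|sg| = 1 ->
    `|u a t + v b t + 2 * sg * u b t
      - (2 * heat (t / m) 0 + 2 * sg * heat (t / m) y) / m|
      <= L * T1 * eta + 16 * C / T1 * eta.
  move=> sg1.
  pose G s := occupation u a s + occupation v b s + 2 * sg * occupation u b s.
  pose H s := u a s + v b s + 2 * sg * u b s.
  pose g s := 2 * pot0 (s / m) 0 + 2 * sg * pot0 (s / m) y.
  pose dg s := (2 * heat (s / m) 0 + 2 * sg * heat (s / m) y) / m.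
  have sm (s : R) : is_derive s 1 (fun s : R => s / m) m^-1.
    by apply: (derE _ (derM (derI s) (derC s m^-1))); rewrite mul1r mulr0 addr0.
  have dH s : t - h <= s <= t + h -> is_derive s 1 g (dg s).
    move=> /win/andP[s0 _]; have r0 : 0 < s / m by rewrite divr_gt0.
    have d1 z := derB (@der_comp R (heat_potential ^~ z) (fun s : R => s / m) s _ _
      (is_derive_potential_r z r0) (sm s)) (derC s (Num.max z 0)).
    apply: (derE _ (derD (derZ 2 (d1 0)) (derZ (2 * sg) (d1 y)))).
    by rewrite /dg; ring.
  have dgLip s : t - h <= s <= t + h -> `|dg s - dg t| <= L * h.
    have [B1 B2] : 0 <= B /\ 0 <= h by split; exact: ltW.
    pose ddg s := (2 * heat2 (s / m) 0 + 2 * sg * heat2 (s / m) y) / m ^+ 2.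
    have der2 r : t - h <= r <= t + h -> is_derive r 1 dg (ddg r).
      move=> /win/andP[s0 _]; have r0 : 0 < r / m by rewrite divr_gt0.
      have d1 z := @der_comp R (heat ^~ z) (fun s : R => s / m) r _ _
        (is_derive_heat_r z r0) (sm r).
      apply: (derE _ (derM (derD (derZ 2 (d1 0)) (derZ (2 * sg) (d1 y))) (derC r m^-1))).
      by rewrite /ddg; field; rewrite gt_eqF.
    have ddgL r : t - h <= r <= t + h -> `|ddg r| <= L.
      move=> /winT/andP[r1 r2].
      have rr : T1 / 2 / m <= r / m <= T / m by rewrite !ler_pM2r ?invr_gt0// r1.
      rewrite /ddg /L normrM (@gtr0_norm _ (_^-1)) ?invr_gt0 ?exprn_gt0//.
      rewrite ler_pM2r ?invr_gt0 ?exprn_gt0//; apply: (le_trans (ler_normD _ _)).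
      rewrite !(@normrM R 2) !(@normrM R (2 * sg)) (@normrM R 2 sg) sg1 (@ger0_norm R 2)//.
      have := HB _ 0 rr; have := HB _ y rr; lra.
    move=> sh; apply: (le_trans (mean_value_dist der2 ddgL sh _)).
      by apply/andP; split; lra.
    by rewrite ler_pM2l// ler_distl.
  have -> : L * T1 * eta + 16 * C / T1 * eta = L * h * 2 + 2 * (4 * C * eta ^+ 2) / h.
    by rewrite /h; field; rewrite !gt_eqF// divr_gt0.
  apply: (@le_trans _ _ (L * h + 2 * (4 * C * eta ^+ 2) / h)).
    apply: (@concave_derivative_estimate G H g dg t h) => //.
    - apply: derivable_within_continuous => s; rewrite in_itv/= => /win/andP[s0 _].
      have [] // := derD (derD (is_derive_occupation fu a s0)
        (is_derive_occupation fv b s0))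
        (derZ (2 * sg) (is_derive_occupation fu b s0)).
    - move=> s /andP[s1 s2]; have /win/andP[s0 _] : t - h <= s <= t + h by lra.
      exact: (derD (derD (is_derive_occupation fu a s0) (is_derive_occupation fv b s0))
        (derZ (2 * sg) (is_derive_occupation fu b s0))).
    - move=> s r /andP[s1 sr] r2; have /win/andP[s0 _] : t - h <= s <= t + h by lra.
      have : 0 <= s / 2 <= r / 2 by lra.
      move=> /(density_combination_decr n0 tau1 fu fv sg1).
      by rewrite ![2 * (_ / 2)]mulrC !divfK.
    - move=> s sh; have sT := win s sh.
      have := HC n tau eta a u hom aA fu a s sT.
      have := HC n tau eta b v hom bA fv b s sT.
      have := HC n tau eta a u hom aA fu b s sT.
      rewrite !site0 -/y; set ub := occupation u b s - _; set vb := _ - _ ; set ua := _ - _.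
      move=> Eub Evb Eua.
      have -> : G s - g s = ua + vb + 2 * (sg * ub) by rewrite /G /g /ua /ub /vb; ring.
      have : `|sg * ub| <= C * eta ^+ 2 by rewrite normrM sg1 mul1r.
      move: Eub Evb Eua; rewrite !ler_norml.
      move=> /andP[? ?] /andP[? ?] /andP[? ?] /andP[? ?]; apply/andP; split; lra.
  by have := mulr_ge0 (ltW L0) (ltW h0); rewrite lerD2r; move: (L * h) => ?; lra.
have Hp := main 1 (normr1 _).
have Hm : `|(-1 : R)| = 1 by rewrite normrN normr1.
have {Hm}Hm := main _ Hm.
rewrite -/y; have -> : u b t - heat (t / m) y / m =
   ((u a t + v b t + 2 * 1 * u b t
      - (2 * heat (t / m) 0 + 2 * 1 * heat (t / m) y) / m)
   - (u a t + v b t + 2 * (-1) * u b t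
      - (2 * heat (t / m) 0 + 2 * (-1) * heat (t / m) y) / m)) / 4.
  by field; rewrite gt_eqF.
move: Hp Hm; set p := _ - _ / m; set q := _ - _ / m.
move=> Hp Hm; have eC := le_trans (normr_ge0 p) Hp.
move: Hp Hm; rewrite mulrDl !ler_norml => /andP[? ?] /andP[? ?]; apply/andP; split; lra.
Qed.

End estimates.

(** * From the Markov chain to the forward equation *)

Section bounded_expectation.
Context {R : realType} {d : measure_display} {Om : measurableType d}.
Variable P : {measure set Om -> \bar R}.
Hypothesis P1 : P setT = 1%E.

Definition bounded_measurable (f : Om -> R) :=
  measurable_fun setT f /\ exists M, forall w, `|f w| <= M.

Lemma bounded_measurable_integrable f : bounded_measurable f ->
  P.-integrable setT (EFin \o f).
Proof.
move=> [mf [M fM]]; apply: measurable_bounded_integrable => //.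
  by rewrite P1 ltry.
exists M; split; first exact: num_real.
by move=> x Mx w _; apply: (le_trans (fM w)); exact: ltW.
Qed.

Lemma bounded_measurableD f g : bounded_measurable f -> bounded_measurable g ->
  bounded_measurable (fun w => f w + g w).
Proof.
move=> [mf [M fM]] [mg [N gN]]; split; first exact: measurable_funD.
by exists (M + N) => w; apply: (le_trans (ler_normD _ _)); exact: lerD.
Qed.

Lemma bounded_measurableZ c f : bounded_measurable f ->
  bounded_measurable (fun w => c * f w).
Proof.
move=> [mf [M fM]]; split; first exact: measurable_funM.
by exists (`|c| * M) => w; rewrite normrM ler_wpM2l.
Qed.

Lemma bounded_measurableN f : bounded_measurable f ->
  bounded_measurable (fun w => - f w).
Proof.
move=> [mf [M fM]]; split; last by exists M => w; rewrite normrN.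
exact: measurableT_comp.
Qed.

Lemma bounded_measurableB f g : bounded_measurable f -> bounded_measurable g ->
  bounded_measurable (fun w => f w - g w).
Proof. by move=> bf bg; apply: bounded_measurableD => //; exact: bounded_measurableN. Qed.

Lemma bounded_measurable_indic (A : set Om) : measurable A ->
  bounded_measurable (\1_A : Om -> R).
Proof.
move=> mA; split; first exact: measurable_indic.
by exists 1 => w; rewrite indicE; case: (_ \in _); rewrite ?normr0 ?normr1.
Qed.

Lemma expectationD f g : bounded_measurable f -> bounded_measurable g ->
  (\int[P]_w (f w + g w))%R = (\int[P]_w f w)%R + (\int[P]_w g w)%R.
Proof. by move=> bf bg; rewrite RintegralD//; exact: bounded_measurable_integrable. Qed.

Lemma expectationB f g : bounded_measurable f -> bounded_measurable g ->
  (\int[P]_w (f w - g w))%R = (\int[P]_w f w)%R - (\int[P]_w g w)%R.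
Proof. by move=> bf bg; rewrite RintegralB//; exact: bounded_measurable_integrable. Qed.

Lemma expectationZ c f : bounded_measurable f ->
  (\int[P]_w (c * f w))%R = c * (\int[P]_w f w)%R.
Proof. by move=> bf; rewrite RintegralZl//; exact: bounded_measurable_integrable. Qed.

Lemma expectation_cst c : (\int[P]_w c)%R = c.
Proof. by rewrite Rintegral_cst// P1 mulr1. Qed.

Lemma expectation_le f g : bounded_measurable f -> bounded_measurable g ->
  (forall w, f w <= g w) -> (\int[P]_w f w)%R <= (\int[P]_w g w)%R.
Proof. by move=> bf bg fg; apply: le_Rintegral => //; exact: bounded_measurable_integrable. Qed.

Lemma bounded_measurable_cst c : bounded_measurable (fun=> c).
Proof. by split; [exact: measurable_cst|exists `|c|]. Qed.

Lemma bounded_measurable_sum (F : nat -> Om -> R) L :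
  (forall j, bounded_measurable (F j)) ->
  bounded_measurable (fun w => \sum_(j < L) F j w).
Proof.
move=> bF; elim: L => [|L IH].
  have -> : (fun w => \sum_(j < 0) F j w) = cst 0.
    by apply/funext => w; rewrite big_ord0.
  exact: bounded_measurable_cst.
have -> : (fun w => \sum_(j < L.+1) F j w) = fun w => \sum_(j < L) F j w + F L w.
  by apply/funext => w; rewrite big_ord_recr.
exact: bounded_measurableD.
Qed.

Lemma expectation_sum (F : nat -> Om -> R) L : (forall j, bounded_measurable (F j)) ->
  (\int[P]_w (\sum_(j < L) F j w))%R = \sum_(j < L) (\int[P]_w F j w)%R.
Proof.
move=> bF; elim: L => [|L IH].
  rewrite big_ord0; have -> : (fun w => \sum_(j < 0) F j w) = cst 0.
    by apply/funext => w; rewrite big_ord0.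
  exact: expectation_cst.
rewrite big_ord_recr/= -IH -expectationD//; last exact: bounded_measurable_sum.
by congr fine; apply: eq_integral => w _; rewrite big_ord_recr.
Qed.

Lemma expectation_norm_le f M : bounded_measurable f ->
  (forall w, `|f w| <= M) -> `|(\int[P]_w f w)%R| <= M.
Proof.
move=> bf fM; have bc := bounded_measurable_cst.
rewrite ler_norml; apply/andP; split.
  rewrite -(expectation_cst (- M)); apply: expectation_le => // w.
  by have := fM w; rewrite ler_norml => /andP[].
rewrite -[leRHS](expectation_cst M); apply: expectation_le => // w.
by have := fM w; rewrite ler_norml => /andP[].
Qed.

Lemma expectation_indic (A : set Om) : measurable A ->
  (\int[P]_w \1_A w)%R = fine (P A).
Proof. by move=> mA; rewrite /Rintegral integral_indic// setIT. Qed.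

End bounded_expectation.

Section markov.
Context {R : realType} {d : measure_display} {Om : measurableType d}.
Variables (S : set R) (P : R.-pker (measurableTypeR R) ~> Om) (X : R -> Om -> R).
Hypothesis mP : markov_process S P X.

Let mX t : 0 <= t -> measurable_fun setT (X t). Proof. by case: mP => + _ _ _; apply. Qed.

Lemma state_measurable t (B : set R) : 0 <= t -> measurable B ->
  measurable (X t @^-1` B).
Proof. by move=> t0 mB; rewrite -[X in measurable X]setTI; exact: mX. Qed.

Lemma markov_at_time a s h (B : set R) : S a -> 0 <= s -> 0 <= h -> measurable B ->
  P a (X (s + h) @^-1` B) = (\int[P a]_w P (X s w) (X h @^-1` B))%E.
Proof.
move=> Sa s0 h0 mB; case: mP => _ _ _ /(_ a s h setT B Sa s0 h0) H.
rewrite -H ?setTI//.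
suff : natural_filtration X s (setT `\` set0) by rewrite setD0.
by apply: sigma_algebraCD; exact: sigma_algebra0.
Qed.

Lemma transition_bounded_measurable s h (B : set R) : 0 <= s -> 0 <= h ->
  measurable B -> bounded_measurable (fun w => fine (P (X s w) (X h @^-1` B))).
Proof.
move=> s0 h0 mB; split.
  apply: measurableT_comp; first exact: fine_measurable.
  apply: (@measurableT_comp _ _ _ _ _ _ (fun x => P x (X h @^-1` B))) (mX s0).
  by apply: measurable_kernel; exact: state_measurable.
exists 1 => w; have le1 : (P (X s w) (X h @^-1` B) <= 1)%E.
  rewrite -(@prob_kernel _ _ _ _ _ P (X s w)); apply: le_measure; rewrite ?inE//.
  exact: state_measurable.
rewrite ger0_norm ?fine_ge0//.
by rewrite -lee_fin fineK// ge0_fin_numE// (le_lt_trans le1) ?ltry.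
Qed.

Lemma markov_at_time_fine a s h (B : set R) : S a -> 0 <= s -> 0 <= h ->
  measurable B -> fine (P a (X (s + h) @^-1` B)) =
  (\int[P a]_w fine (P (X s w) (X h @^-1` B)))%R.
Proof.
move=> Sa s0 h0 mB; rewrite markov_at_time//; congr fine.
apply: eq_integral => w _; rewrite fineK// ge0_fin_numE//.
rewrite (@le_lt_trans _ _ 1%E) ?ltry//.
rewrite -(@prob_kernel _ _ _ _ _ P (X s w)); apply: le_measure; rewrite ?inE//.
exact: state_measurable.
Qed.

Lemma bounded_measurable_state (f : R -> R) t : measurable_fun setT f ->
  (exists M, forall x, `|f x| <= M) -> 0 <= t ->
  bounded_measurable (fun w => f (X t w)).
Proof.
move=> mf [M fM] t0; split; last by exists M.
exact: measurableT_comp mf (mX t0).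
Qed.

Let Pa1 a : P a setT = 1%E. Proof. exact: prob_kernel. Qed.

Lemma transition_expectation_measurable (f : R -> R) M s h : 0 <= s -> 0 <= h ->
  measurable_fun setT f -> (forall x, 0 <= f x <= M) ->
  bounded_measurable (fun w => (\int[P (X s w)]_v f (X h v))%R).
Proof.
move=> s0 h0 mf fM; split; last first.
  exists M => w; apply: (expectation_norm_le (Pa1 _)).
    apply: bounded_measurable_state => //; exists M => x.
    by have /andP[f0 fxM] := fM x; rewrite ger0_norm.
  by move=> v; have /andP[f0 fxM] := fM (X h v); rewrite ger0_norm.
apply: measurableT_comp; first exact: fine_measurable.
apply: (@measurableT_comp _ _ _ _ _ _ (fun x => \int[P x]_v (f (X h v))%:E)%E) (mX s0).
apply: (@measurable_fun_integral_kernel _ _ _ _ _ P (measurable_kernel P)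
  (fun v => (f (X h v))%:E)).
  by move=> v; rewrite lee_fin; have /andP[] := fM (X h v).
by apply/measurable_EFinP; exact: measurableT_comp mf (mX h0).
Qed.

Lemma staircase_approx (N K : nat) (y : R) : (0 < N)%N -> 0 <= y -> y * N%:R <= K%:R ->
  `|y - N%:R^-1 * \sum_(j < K) (j.+1%:R / N%:R <= y)%R%:R| <= N%:R^-1.
Proof.
move=> N0 y0 yK; have N0' : 0 < N%:R :> R by rewrite ltr0n.
have z0 : 0 <= y * N%:R by rewrite mulr_ge0.
pose z := y * N%:R; pose T := Num.truncn z.
have -> : \sum_(j < K) (j.+1%:R / N%:R <= y)%R%:R = T%:R :> R.
  rewrite -natr_sum; congr (_%:R).
  have TK : (T <= K)%N.
    by rewrite -(ler_nat R) (le_trans _ yK)// truncn_le.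
  transitivity (\sum_(j < K | (j < T)%N) 1)%N.
    rewrite [RHS]big_mkcond; apply: eq_bigr => j _.
    by rewrite ler_pdivrMr// -/z truncn_gt_nat; case: ifP.
  by rewrite -(big_ord_widen _ (fun=> 1%N))// sum1_card card_ord.
have /andP[Tz zT] := truncn_itv z0.
have -> : y - N%:R^-1 * T%:R = N%:R^-1 * (z - T%:R).
  by rewrite /z; field; rewrite gt_eqF.
rewrite normrM gtr0_norm ?invr_gt0// ler_piMr ?invr_ge0 ?(ltW N0')//.
rewrite ger0_norm ?subr_ge0//; rewrite -natr1 -/T -/z in zT.
by rewrite lerBlDr addrC ltW.
Qed.

(** The Markov property at a fixed time, for functions: bounded functions are
  uniform limits of combinations of indicators. *)
Lemma markov_expectation (f : R -> R) M a s h : S a -> 0 <= s -> 0 <= h ->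
  measurable_fun setT f -> (forall x, 0 <= f x <= M) ->
  (\int[P a]_w f (X (s + h) w))%R =
  (\int[P a]_w (\int[P (X s w)]_v (f (X h v)))%R)%R.
Proof.
move=> Sa s0 h0 mf fM; have sh0 : 0 <= s + h by rewrite addr_ge0.
apply/eqP; rewrite -subr_eq0 -normr_le0; apply/ler_addgt0Pr => e e0; rewrite add0r.
pose N := (Num.truncn (2 / e)).+1.
have N0' : 0 < N%:R :> R by rewrite ltr0n.
have Ne : 2 * N%:R^-1 <= e.
  by rewrite ler_pdivrMr// -ler_pdivrMl// mulrC ltW// truncnS_gt.
pose K := (Num.truncn (M * N%:R)).+1.
pose c j : R := j.+1%:R / N%:R.
have mc j : measurable [set x | c j <= f x].
  rewrite -[X in measurable X]setTI.
  have -> : [set x | c j <= f x] = f @^-1` `[c j, +oo[.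
    by apply/seteqP; split => x /=; rewrite in_itv/= andbT.
  exact: mf.
pose g x : R := N%:R^-1 * \sum_(j < K) \1_[set x | c j <= f x] x.
have fg x : `|f x - g x| <= N%:R^-1.
  have /andP[f0 fxM] := fM x.
  have -> : g x = N%:R^-1 * \sum_(j < K) (j.+1%:R / N%:R <= f x)%R%:R.
    congr (_ * _); apply: eq_bigr => j _; rewrite indicE; congr (nat_of_bool _)%:R.
    by apply/idP/idP; rewrite inE.
  apply: staircase_approx => //; apply: (@le_trans _ _ (M * N%:R)).
    by rewrite ler_pM2r.
  by rewrite ltW// truncnS_gt.
have bC t j : 0 <= t -> measurable (X t @^-1` [set x | c j <= f x]).
  by move=> t0; exact: state_measurable.
have bF t j : 0 <= t -> bounded_measurable (fun w => \1_[set x | c j <= f x] (X t w) : R).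
  by move=> t0; exact: (bounded_measurable_indic (bC t j t0)).
have bf t : 0 <= t -> bounded_measurable (fun w => f (X t w)).
  move=> t0; apply: bounded_measurable_state => //.
  by exists M => x; have /andP[f0 fxM] := fM x; rewrite ger0_norm.
have bg t : 0 <= t -> bounded_measurable (fun w => g (X t w)).
  move=> t0; apply: bounded_measurableZ.
  exact: (bounded_measurable_sum K (fun j => bF t j t0)).
have Eg b t : 0 <= t -> (\int[P b]_w g (X t w))%R =
    N%:R^-1 * \sum_(j < K) fine (P b (X t @^-1` [set x | c j <= f x])).
  move=> t0; rewrite expectationZ//; last first.
    exact: (bounded_measurable_sum K (fun j => bF t j t0)).
  rewrite (expectation_sum (Pa1 b) K (fun j => bF t j t0)).
  by congr (_ * _); apply: eq_bigr => j _; rewrite -expectation_indic//; exact: bC.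
have Efg b t : 0 <= t ->
    `|(\int[P b]_w f (X t w))%R - (\int[P b]_w g (X t w))%R| <= N%:R^-1.
  move=> t0; rewrite -expectationB//; [|exact: bf|exact: bg].
  apply: (expectation_norm_le (Pa1 b)) => //.
  by apply: bounded_measurableB; [exact: bf|exact: bg].
have bP j : bounded_measurable
    (fun w => fine (P (X s w) (X h @^-1` [set x | c j <= f x]))).
  exact: transition_bounded_measurable.
have bTf : bounded_measurable (fun w => (\int[P (X s w)]_v (f (X h v)))%R).
  exact: (transition_expectation_measurable (M := M)).
have bTg : bounded_measurable (fun w => (\int[P (X s w)]_v (g (X h v)))%R).
  have -> : (fun w => (\int[P (X s w)]_v (g (X h v)))%R) = fun w =>
      N%:R^-1 * \sum_(j < K) fine (P (X s w) (X h @^-1` [set x | c j <= f x])).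
    by apply/funext => w; exact: Eg.
  by apply: bounded_measurableZ; exact: (bounded_measurable_sum K bP).
have E1 : (\int[P a]_w g (X (s + h) w))%R =
    (\int[P a]_w (\int[P (X s w)]_v (g (X h v)))%R)%R.
  rewrite Eg//.
  have -> : (\int[P a]_w (\int[P (X s w)]_v (g (X h v)))%R)%R =
     (\int[P a]_w (N%:R^-1 * \sum_(j < K) fine (P (X s w) (X h @^-1` [set x | c j <= f x]))))%R.
    by congr fine; apply: eq_integral => w _; rewrite Eg.
  rewrite expectationZ//; last exact: (bounded_measurable_sum K bP).
  rewrite (expectation_sum (Pa1 a) K bP); congr (_ * _); apply: eq_bigr => j _.
  exact: markov_at_time_fine.
have -> : (\int[P a]_w f (X (s + h) w))%R -
    (\int[P a]_w (\int[P (X s w)]_v (f (X h v)))%R)%R =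
  ((\int[P a]_w f (X (s + h) w))%R - (\int[P a]_w g (X (s + h) w))%R) -
  ((\int[P a]_w (\int[P (X s w)]_v (f (X h v)))%R)%R -
   (\int[P a]_w (\int[P (X s w)]_v (g (X h v)))%R)%R) by rewrite E1; ring.
apply: (le_trans (ler_normB _ _)); apply: le_trans Ne.
rewrite mulr_natl mulr2n lerD//; first exact: Efg.
rewrite -expectationB//; apply: (expectation_norm_le (Pa1 a)).
  exact: bounded_measurableB.
by move=> w; exact: Efg.
Qed.

(** The generator, integrated against the law at time [s], controls the forward
  difference quotients uniformly in [s]. *)
Lemma generator_increment (D : set (R -> R)) (L : (R -> R) -> R -> R)
  (f ell : R -> R) M a :
  has_generator S P X D L -> D f -> S a ->
  measurable_fun setT f -> (forall x, 0 <= f x <= M) ->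
  measurable_fun setT ell -> (exists N, forall x, `|ell x| <= N) ->
  (forall x, S x -> L f x = ell x) ->
  forall e, 0 < e -> exists2 dl : R, 0 < dl & forall s h : R, 0 <= s -> 0 < h < dl ->
    `|(\int[P a]_w f (X (s + h) w))%R - (\int[P a]_w f (X s w))%R
      - h * (\int[P a]_w ell (X s w))%R| <= e * h.
Proof.
move=> gen Df Sa mf fM mell ellN Lell e e0.
have := gen _ Df e e0; rewrite near_withinE => /nbhs_normP[dl /= dl0 H].
exists dl => // s h s0 /andP[h0 hdl].
have h0' := ltW h0.
rewrite (markov_expectation Sa s0 h0' mf fM).
have bf : bounded_measurable (fun w => f (X s w)).
  apply: bounded_measurable_state => //.
  by exists M => x; have /andP[f0 fxM] := fM x; rewrite ger0_norm.
have bell : bounded_measurable (fun w => ell (X s w)).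
  exact: bounded_measurable_state.
have bT : bounded_measurable (fun w => (\int[P (X s w)]_v (f (X h v)))%R).
  exact: (transition_expectation_measurable (M := M)).
rewrite -expectationB// -expectationZ// -expectationB//; last 2 first.
- exact: bounded_measurableB.
- exact: bounded_measurableZ.
apply: (expectation_norm_le (Pa1 a)).
  by apply: bounded_measurableB; [exact: bounded_measurableB|exact: bounded_measurableZ].
move=> w; have SX : S (X s w) by case: mP => _ + _ _; apply.
have := H h; rewrite /ball_/= sub0r normrN (gtr0_norm h0) => /(_ hdl h0 _ SX).
rewrite Lell// => Hw.
have -> : (\int[P (X s w)]_v (f (X h v)))%R - f (X s w) - h * ell (X s w) =
  (((\int[P (X s w)]_v (f (X h v)))%R - f (X s w)) / h - ell (X s w)) * h.
  by field; rewrite gt_eqF.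
by rewrite normrM (gtr0_norm h0) ler_pM2r.
Qed.

End markov.

Section chain.
Context {R : realType} {d : measure_display} {Om : measurableType d}.
Variables (n : nat) (tau : int -> R).
Variables (P : R.-pker (measurableTypeR R) ~> Om) (X : R -> Om -> R).
Hypothesis n0 : (0 < n)%N.
Hypothesis tau1 : forall k, 1 <= tau k.
Hypothesis chain : is_trap_chain n tau P X.

Let n0' : 0 < n%:R :> R. Proof. by rewrite ltr0n. Qed.
Let tau0 k : 0 < tau k. Proof. exact: lt_le_trans (tau1 k). Qed.
Let mP : markov_process (lattice n) P X. Proof. by case: chain. Qed.
Let Pa1 a : P a setT = 1%E. Proof. exact: prob_kernel. Qed.

Lemma site_inj : injective (@site R n).
Proof.
move=> i j; rewrite /site => /(mulIf (invr_neq0 (lt0r_neq0 n0'))).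
by move/eqP; rewrite eqr_int => /eqP.
Qed.

Lemma floor_site k : Num.floor (n%:R * @site R n k) = k.
Proof. by rewrite /site mulrCA divff ?gt_eqF// mulr1 intrKfloor. Qed.

Lemma lattice_site k : lattice n (@site R n k).
Proof. by exists k. Qed.

Definition site_prob (a k : int) (t : R) : R :=
  fine (P (site n a) (X t @^-1` [set site n k])).
Local Notation q := site_prob.

Let site_event_measurable k t : 0 <= t -> measurable (X t @^-1` [set site n k]).
Proof. by move=> t0; apply: (state_measurable mP) => //; exact: measurable_set1. Qed.

Lemma site_prob_ge0 a k t : 0 <= q a k t. Proof. exact: fine_ge0. Qed.

Lemma site_probE a k t : 0 <= t ->
  P (site n a) (X t @^-1` [set site n k]) = (q a k t)%:E.
Proof.
move=> t0; rewrite fineK// ge0_fin_numE//.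
rewrite (@le_lt_trans _ _ 1%E) ?ltry//.
by rewrite -(Pa1 (site n a)); apply: le_measure; rewrite ?inE//; exact: site_event_measurable.
Qed.

Lemma site_prob_le1 a k t : 0 <= t -> q a k t <= 1.
Proof.
move=> t0; rewrite -lee_fin -site_probE// -(Pa1 (site n a)).
by apply: le_measure; rewrite ?inE//; exact: site_event_measurable.
Qed.

Let indic_site k (x : R) : (\1_[set site n k] x : R) = (x == site n k)%:R.
Proof. by rewrite indicE; congr (nat_of_bool _)%:R; apply/idP/eqP; rewrite inE. Qed.

Let generator_site k j :
  trap_generator n tau (\1_[set site n k]) (site n j) =
  n%:R ^+ 2 * ((tau (k + 1))^-1 * (j == k + 1)%:R + (tau (k - 1))^-1 * (j == k - 1)%:R
    - 2 * ((tau k)^-1 * (j == k)%:R)).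
Proof.
rewrite /trap_generator floor_site.
have -> : site n j + n%:R^-1 = site n (j + 1) :> R by rewrite /site intrD mulrDl mul1r.
have -> : site n j - n%:R^-1 = site n (j - 1) :> R by rewrite /site intrB mulrBl mul1r.
rewrite !indic_site !(inj_eq site_inj).
have -> : (j + 1 == k) = (j == k - 1) by lia.
have -> : (j - 1 == k) = (j == k + 1) by lia.
have [->|jp] := eqVneq j (k + 1).
  have -> : (k + 1 == k - 1) = false by lia.
  have -> : (k + 1 == k) = false by lia.
  by rewrite /=; field; rewrite !gt_eqF.
have [->|jm] := eqVneq j (k - 1).
  have -> : (k - 1 == k) = false by lia.
  by rewrite /=; field; rewrite !gt_eqF.
have [->|jk] := eqVneq j k; last by rewrite !mulr0; ring.
by rewrite /=; field; rewrite !gt_eqF.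
Qed.

Let rate (a k : int) (t : R) : R :=
  n%:R ^+ 2 * (q a (k + 1) t / tau (k + 1) + q a (k - 1) t / tau (k - 1)
    - 2 * (q a k t / tau k)).

Let expectation_site a k t : 0 <= t ->
  (\int[P (site n a)]_w \1_[set site n k] (X t w))%R = q a k t.
Proof. by move=> t0; rewrite /site_prob -expectation_indic//; exact: site_event_measurable. Qed.

Lemma site_prob_increment a k e : 0 < e -> exists2 dl : R, 0 < dl &
  forall s h : R, 0 <= s -> 0 < h < dl ->
    `|q a k (s + h) - q a k s - h * rate a k s| <= e * h.
Proof.
move=> e0; have [_ _ gen] := chain.
pose f : R -> R := \1_[set site n k].
have bs : bounded_support f.
  exists `|site n k| => x xk; rewrite /f indic_site; case: eqVneq => // xE.
  by rewrite xE ltxx in xk.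
pose ind j : R -> R := \1_[set site n j].
have mind j : measurable_fun setT (ind j) by exact: measurable_indic.
have indb j x : `|ind j x| <= 1.
  by rewrite /ind indicE; case: (_ \in _); rewrite ?normr0 ?normr1.
have bind j : bounded_measurable (ind j) by split => //; exists 1.
pose ell x := n%:R ^+ 2 * ((tau (k + 1))^-1 * ind (k + 1) x
  + (tau (k - 1))^-1 * ind (k - 1) x - 2 * ((tau k)^-1 * ind k x)).
have [mell ellN] : bounded_measurable ell.
  apply: bounded_measurableZ; apply: bounded_measurableB; last first.
    by apply: bounded_measurableZ; apply: bounded_measurableZ; exact: bind.
  by apply: bounded_measurableD; apply: bounded_measurableZ; exact: bind.
have fM x : 0 <= f x <= 1.
  by rewrite /f indicE; case: (_ \in _); rewrite ?lexx ?ler01.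
have Lell x : lattice n x -> trap_generator n tau f x = ell x.
  move=> [j _ <-]; rewrite generator_site /ell /ind !indic_site !(inj_eq site_inj).
  by [].
have [dl dl0 H] := generator_increment mP gen bs (lattice_site a) (mind k) fM
  mell ellN Lell e0.
exists dl => // s h s0 hdl; have h0 : 0 <= h by case/andP: hdl => /ltW.
have := H s h s0 hdl; rewrite !expectation_site ?addr_ge0//.
have bX j : bounded_measurable (fun w => ind j (X s w)).
  by apply: (bounded_measurable_state mP) => //; exists 1.
have -> : (\int[P (site n a)]_w ell (X s w))%R = rate a k s.
  rewrite /ell expectationZ//; last first.
    apply: bounded_measurableB; last by do 2!apply: bounded_measurableZ.
    by apply: bounded_measurableD; apply: bounded_measurableZ.
  rewrite expectationB//; last 2 first.
  - by apply: bounded_measurableD; apply: bounded_measurableZ.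
  - by do 2!apply: bounded_measurableZ.
  rewrite expectationD//; [|exact: bounded_measurableZ|exact: bounded_measurableZ].
  rewrite !expectationZ//; last exact: bounded_measurableZ.
  rewrite !expectation_site//.
  by rewrite /rate ![_^-1 * _]mulrC.
by [].
Qed.

Let rate_bound a k t : 0 <= t -> `|rate a k t| <= 4 * n%:R ^+ 2.
Proof.
move=> t0; rewrite /rate normrM (@gtr0_norm _ (_ ^+ 2)) ?exprn_gt0// mulrC.
rewrite ler_pM2r ?exprn_gt0//.
have qt j : 0 <= q a j t / tau j <= 1.
  rewrite divr_ge0 ?site_prob_ge0 ?(ltW (tau0 _))//= ler_pdivrMr// mul1r.
  by rewrite (le_trans (site_prob_le1 _ _ t0)).
have /andP[? ?] := qt (k + 1); have /andP[? ?] := qt (k - 1); have /andP[? ?] := qt k.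
by rewrite ler_norml; apply/andP; split; lra.
Qed.

Let site_prob_continuous a k : continuous (fun t : R => q a k `|t|).
Proof.
have [dl dl0 H] := uniform_right_derivative_lipschitz (@site_prob_increment a k)
  (fun s s0 => rate_bound a k s0).
exact: locally_lipschitz_continuous dl0 H.
Qed.

Let is_derive_site_prob a k (t : R) : 0 < t ->
  is_derive t 1 (fun t : R => q a k `|t|) (rate a k t).
Proof.
move=> t0; apply: (uniform_right_derivative_is_derive (@site_prob_increment a k)
  (fun s s0 => rate_bound a k s0)) => //.
move=> x; apply: cvgMr; apply: cvgB; last first.
  by apply: cvgMr; apply: cvgM; [exact: site_prob_continuous|exact: cvg_cst].
by apply: cvgD; apply: cvgM; (exact: site_prob_continuous || exact: cvg_cst).
Qed.

Lemma site_prob0 a k : q a k 0 = (k == a)%:R.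
Proof.
case: mP => _ _ start _; have := start _ (lattice_site a) => Pa.
case: eqVneq => [->|ka]; first by rewrite /site_prob Pa.
apply/eqP; rewrite eq_le site_prob_ge0 andbT -lee_fin -site_probE//.
have dis : [disjoint X 0 @^-1` [set site n k] & X 0 @^-1` [set site n a]].
  by apply/disj_setPS => w /= [-> /site_inj/eqP]; rewrite (negbTE ka).
have mk := site_event_measurable k (lexx 0).
have ma := site_event_measurable a (lexx 0).
have : (P (site n a) (X 0 @^-1` [set site n k] `|` X 0 @^-1` [set site n a]) <= 1)%E.
  by rewrite -(Pa1 (site n a)); apply: le_measure; rewrite ?inE//; exact: measurableU.
have qa1 : q a a 0 = 1 by rewrite /site_prob Pa.
have U : P (site n a) (X 0 @^-1` [set site n k] `|` X 0 @^-1` [set site n a]) =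
    (q a k 0 + q a a 0)%:E := etrans (measureU (P (site n a)) mk ma (disj_set2P dis))
  (congr2 adde (site_probE a k (lexx 0)) (site_probE a a (lexx 0))).
rewrite U => H; have {H} : q a k 0 + q a a 0 <= 1 by exact: H.
by rewrite qa1 site_probE// lee_fin gerDr.
Qed.

Lemma site_prob_mass a c N t : 0 <= t -> isum c N (fun k => q a k t) <= 1.
Proof.
move=> t0; pose ind j : R -> R := \1_[set site n j].
have bX j : bounded_measurable (fun w => ind (c + j%:Z) (X t w)).
  apply: (bounded_measurable_state mP) => //; first exact: measurable_indic.
  by exists 1 => x; rewrite /ind indicE; case: (_ \in _); rewrite ?normr0 ?normr1.
have -> : isum c N (fun k => q a k t) =
    (\int[P (site n a)]_w (\sum_(j < N) ind (c + j%:Z) (X t w)))%R.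
  rewrite (expectation_sum (Pa1 _) N bX); apply: eq_bigr => j _.
  by rewrite expectation_site.
apply: (le_trans (ler_norm _)); apply: (expectation_norm_le (Pa1 _)).
  exact: (bounded_measurable_sum N bX).
move=> w; have [j _ jE] : lattice n (X t w) by case: mP => _ + _ _; apply.
have -> : \sum_(i < N) ind (c + i%:Z) (X t w) = isum c N (fun i => 1 * (i == j)%:R).
  by apply: eq_bigr => i _; rewrite mul1r -jE /ind indic_site (inj_eq site_inj) eq_sym.
by rewrite isum_delta mul1r; case: (_ <= _ < _)%R; rewrite ?normr1 ?normr0.
Qed.

(** The density with respect to the speed measure, extended to negative times by
  reflection so as to be continuous on the whole line. *)
Definition chain_density (a k : int) (t : R) : R :=
  n%:R / tau k * q a k `|t|.

Theorem chain_forward_solution a : forward_solution n tau a (chain_density a).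
Proof.
have nt k : 0 < n%:R / tau k by rewrite divr_gt0.
split.
- by move=> k t t0; rewrite mulr_ge0 ?site_prob_ge0 ?(ltW (nt k)).
- by move=> k x; apply: cvgMr; exact: site_prob_continuous.
- move=> k t t0; apply: (derE _ (derZ _ (is_derive_site_prob a k t0))).
  rewrite /rate /chain_density (gtr0_norm t0).
  by field; rewrite !gt_eqF.
- move=> k; rewrite /chain_density normr0 site_prob0.
  by case: eqVneq => [->|_]; rewrite ?mulr0.
- move=> t c N t0; rewrite /chain_density ger0_norm//.
  have -> : isum c N (fun k => tau k / n%:R * (n%:R / tau k * q a k t)) =
      isum c N (fun k => q a k t).
    by apply: eq_bigr => i _; field; rewrite !gt_eqF.
  exact: site_prob_mass.
Qed.

Lemma site_cdf_cvg (a k : int) (t : R) : 0 <= t ->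
  (fun N => \sum_(i < N) q a (k - i%:Z) t) @ \oo --> prob_le P X (site n a) t (site n k).
Proof.
move=> t0; pose F i := X t @^-1` [set site n (k - i%:Z)].
have mF i : measurable (F i) by exact: site_event_measurable.
have UF : [set w | X t w <= site n k] = \bigcup_i F i.
  apply/seteqP; split => w /=.
    have [j _ jE] : lattice n (X t w) by case: mP => _ + _ _; apply.
    rewrite -jE /site ler_pM2r ?invr_gt0// ler_int => jk.
    exists (absz (k - j)%R) => //; rewrite /F/= -jE; congr site; lia.
  move=> [i _ /= ->]; rewrite /site ler_pM2r ?invr_gt0// ler_int; lia.
have tF : trivIset setT F.
  apply/trivIsetP => i j _ _ ij; apply/seteqP; split => // w /= [wi wj].
  have /site_inj : site n (k - i%:Z) = site n (k - j%:Z) :> R by rewrite -wi.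
  by move: i j ij {wi wj} => i j; lia.
have UFm : measurable (\bigcup_i F i) by exact: bigcup_measurable.
have c : (fun N => \sum_(0 <= i < N) P (site n a) (F i))%E @ \oo -->
    P (site n a) (\bigcup_i F i) by exact: measure_semi_sigma_additive.
have c' : (fun N => (\sum_(i < N) q a (k - i%:Z) t)%:E) @ \oo -->
    P (site n a) (\bigcup_i F i).
  apply: cvg_trans c; apply: near_eq_cvg; near=> N.
  by rewrite big_mkord -sumEFin; apply: eq_bigr => i _; rewrite site_probE.
have UFE : P (site n a) (\bigcup_i F i) = (prob_le P X (site n a) t (site n k))%:E.
  rewrite /prob_le UF fineK// ge0_fin_numE//.
  apply: (@le_lt_trans _ _ 1%E); last exact: ltry.
  by rewrite -(Pa1 (site n a)); apply: le_measure; rewrite ?inE.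
by rewrite UFE in c'; exact: (fine_cvg c').
Unshelve. all: by end_near. Qed.

Let atoms_at_site (c : nat -> {nonneg R}) (g : nat -> int) k :
    (forall i, (c i)%:num = `|tau (g i) / n%:R|) -> injective g ->
  mseries (fun i => mscale (c i) (dirac (site n (g i) : measurableTypeR R))) 0
    [set site n k] = if `[< exists i, g i = k >] then (tau k / n%:R)%:E else 0%E.
Proof.
move=> cE gi.
have atomE i : mscale (c i) (dirac (site n (g i) : measurableTypeR R)) [set site n k] =
    (tau (g i) / n%:R * (g i == k)%:R)%:E.
  rewrite /mscale/= diracE cE.
  have -> : (@site R n (g i) \in [set site n k]) = (g i == k).
    by apply/idP/eqP => [/set_mem/site_inj//|->]; rewrite inE.
  by rewrite ger0_norm ?divr_ge0 ?(ltW (tau0 _))// EFinM.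
case: asboolP => [[k0 gk]|nk]; last first.
  rewrite /mseries eseries0// => i _ _; apply: etrans (atomE i) _.
  by case: eqVneq => [gk|]; [exfalso; apply: nk; exists i|rewrite mulr0].
apply: cvg_lim => //.
apply: (@cvg_trans _ ((fun=> (tau k / n%:R)%:E) @ \oo)); last exact: cvg_cst.
apply: near_eq_cvg; near=> N.
have k0N : (k0 < N)%N by near: N; exact: nbhs_infty_gt.
rewrite big_mkord (bigD1 (Ordinal k0N))//= atomE gk eqxx mulr1 big1 ?adde0//.
move=> i ik; rewrite atomE -gk (inj_eq gi).
have -> : (nat_of_ord i == k0) = false.
  by apply: contraNF ik => /eqP ik0; apply/eqP/val_inj.
by rewrite mulr0.
Unshelve. all: by end_near. Qed.

Lemma lattice_measure_site k : lattice_measure n tau [set site n k] = (tau k / n%:R)%:E.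
Proof.
rewrite /lattice_measure/= /measure_add /msum 2!big_ord_recl big_ord0 adde0.
apply: etrans (congr2 adde (atoms_at_site (g := Posz) k _ _)
  (atoms_at_site (g := Negz) k _ _)) _ => //; [by move=> i j [].. |].
case: k => k; do 2!case: asboolP => [[]|] //.
- by move=> _ i _; rewrite /adde/= addr0.
- by move=> _ /(_ (ex_intro _ k erefl)).
- by move=> i _ _; rewrite /adde/= add0r.
- by move=> /(_ (ex_intro _ k erefl)).
Qed.

(** The heat kernel is defined through integrals, and a singleton of the lattice is
  an atom of the speed measure. *)
Theorem heat_kernel_chain_density (p : R -> R -> R -> R) (a k : int) (t : R) :
  is_heat_kernel (lattice n) P X (lattice_measure n tau) p -> 0 < t ->
  p t (site n a) (site n k) = chain_density a k t.
Proof.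
case=> _ _ pE t0.
have := pE t (site n a) [set site n k] t0 (lattice_site a) (measurable_set1 _).
have -> : [set site n k] `&` lattice n = [set site n k] :> set R.
  by apply/setIidl => _ ->; exact: lattice_site.
rewrite (eq_integral (cst (p t (site n a) (site n k))%:E)); last by move=> x /set_mem ->.
rewrite integral_cst// lattice_measure_site site_probE ?(ltW t0)// -EFinM => -[qE].
rewrite /chain_density gtr0_norm// qE.
by field; rewrite !gt_eqF.
Qed.

End chain.

(** * Identification of the limiting diffusion *)

Section dini.
Context {R : realType}.

(** The mean value inequality for right upper derivatives, with steps [dl] that may
  depend on the base point: the supremum of the times up to which the bound holds
  can only be [t]. *)
Lemma right_dini_bound (psi : R -> R) (t c : R) : 0 <= t ->
  (forall s e : R, 0 <= s < t -> 0 < e -> exists2 dl : R, 0 < dl &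
     forall h, 0 < h < dl -> `|psi (s + h) - psi s| <= (c + e) * h) ->
  (forall s e : R, 0 < s <= t -> 0 < e -> exists2 dl : R, 0 < dl &
     forall h, 0 < h < dl -> h <= s -> `|psi s - psi (s - h)| <= e) ->
  `|psi t - psi 0| <= c * t.
Proof.
move=> t0 right left.
suff H e : 0 < e -> `|psi t - psi 0| <= (c + e) * t + e.
  apply/ler_addgt0Pl => e e0; have t1 : 0 < t + 1 by lra.
  apply: (le_trans (H _ (divr_gt0 e0 t1))).
  have -> : (c + e / (t + 1)) * t + e / (t + 1) = e + c * t.
    by field; rewrite gt_eqF.
  exact: lexx.
move=> e0; pose A := [set s | 0 <= s <= t /\
  forall u, 0 <= u <= s -> `|psi u - psi 0| <= (c + e) * u + e].
have A0 : A 0.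
  split; first by rewrite lexx.
  move=> u /andP[u0 u1]; have -> : u = 0 by apply/eqP; rewrite eq_le u1.
  by rewrite subrr normr0 mulr0 add0r ltW.
have hsA : has_sup A.
  by split; [exists 0|exists t => s [/andP[]]].
pose s := sup A.
have s0 : 0 <= s by exact: sup_upper_bound.
have st : s <= t by apply: ge_sup; [exists 0|move=> u [/andP[]]].
have below u : 0 <= u < s -> `|psi u - psi 0| <= (c + e) * u + e.
  move=> /andP[u0 us]; have [v [/andP[v0 vt] Av] uv] := sup_gt (ex_intro _ 0 A0) us.
  by apply: Av; rewrite u0 ltW.
have As : A s.
  split; first by rewrite s0.
  move=> u /andP[u0 us].
  move: us; rewrite le_eqVlt => /orP[/eqP ->|us]; last by apply: below; rewrite u0.
  move: s0; rewrite le_eqVlt => /orP[/eqP <-|s0].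
    by rewrite subrr normr0 mulr0 add0r ltW.
  apply/ler_addgt0Pl => e' e'0.
  have e'2 : 0 < e' / 2 by rewrite divr_gt0.
  have [dl dl0 Hdl] := left s (e' / 2) ltac:(by rewrite s0) e'2.
  pose K := `|c + e| + 1; have K0 : 0 < K by rewrite ltr_wpDl.
  pose h := Num.min (dl / 2) (Num.min s (e' / 2 / K)).
  have h0 : 0 < h by rewrite !lt_min s0 !divr_gt0.
  have hs : h <= s by rewrite /h !ge_min lexx orbT.
  have hd : h < dl by rewrite /h gt_min ltr_pdivrMr// ltr_pMr// ltr1n.
  have hK : h * K <= e' / 2.
    by rewrite -ler_pdivlMr// /h !ge_min lexx !orbT.
  have := Hdl h ltac:(by rewrite h0) hs.
  have := below (s - h) ltac:(by apply/andP; split; lra).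
  rewrite !ler_norml => /andP[a1 a2] /andP[b1 b2].
  have ck : - ((c + e) * h) <= e' / 2.
    apply: le_trans hK; rewrite mulrC -mulrN ler_pM2l// /K.
    by have := ler_norm (- (c + e)); rewrite normrN; lra.
  by apply/andP; split; lra.
case: (ltP s t) => [lt_st|ts]; last first.
  have sE : s = t by apply/eqP; rewrite eq_le st.
  by case: As => _; rewrite sE; apply; rewrite t0 lexx.
exfalso.
have [dl dl0 Hdl] := right s e ltac:(by rewrite s0) e0.
pose h := Num.min (dl / 2) (t - s).
have h0 : 0 < h by rewrite lt_min divr_gt0//= subr_gt0.
have hd : h < dl by rewrite /h gt_min ltr_pdivrMr// ltr_pMr// ltr1n.
have ht : s + h <= t by rewrite -lerBrDl /h ge_min lexx orbT.
suff : A (s + h).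
  by move=> /(ub_le_sup hsA.2); rewrite -/s; lra.
split; first by apply/andP; split; lra.
move=> u /andP[u0 uh]; case: (leP u s) => us.
  by case: As => _; apply; rewrite u0.
have := Hdl (u - s) ltac:(by apply/andP; split; lra).
have := As.2 s ltac:(by rewrite s0 lexx).
have -> : s + (u - s) = u by ring.
rewrite !ler_norml => /andP[a1 a2] /andP[b1 b2].
by apply/andP; split; lra.
Qed.

End dini.

Section cutoff.
Context {R : realType}.
Implicit Types (v y M : R).
Local Notation pos v := (Num.max v 0).

Lemma is_derive_pos_sqr (v : R) : is_derive v 1 (fun v : R => pos v ^+ 2) (2 * pos v).
Proof.
apply: is_derive1_eps => e e0; exists e => // h h0 he.
apply: (@le_trans _ _ (h ^+ 2)).
  rewrite ler_norml; case: (leP v 0) => v0; case: (leP (v + h) 0) => vh;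
    apply/andP; split; nra.
by rewrite -real_normK ?num_real// expr2 ler_wpM2r// ltW.
Qed.

Lemma is_derive_pos_cube (v : R) :
  is_derive v 1 (fun v : R => pos v ^+ 3) (3 * pos v ^+ 2).
Proof.
have pcube (z : R) : z * pos z ^+ 2 = pos z ^+ 3.
  by case: (leP z 0) => _; ring.
have -> : (fun v : R => pos v ^+ 3) = fun v => v * pos v ^+ 2.
  by apply/funext => z; rewrite pcube.
apply: (derE _ (derM (derI v) (is_derive_pos_sqr v))).
by case: (leP v 0) => _; ring.
Qed.

(** A twice continuously differentiable function supported in [-M, M] that is close
  to [1] on bounded sets when [M] is large, with derivatives of order [1 / M]. *)
Definition cutoff M y := pos (1 - y ^+ 2 / M ^+ 2) ^+ 3.
Definition cutoff1 M y := 3 * pos (1 - y ^+ 2 / M ^+ 2) ^+ 2 * (- (2 * y / M ^+ 2)).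
Definition cutoff2 M y :=
  6 * pos (1 - y ^+ 2 / M ^+ 2) * (2 * y / M ^+ 2) ^+ 2
  - 6 * pos (1 - y ^+ 2 / M ^+ 2) ^+ 2 / M ^+ 2.

Let der_arg M y : is_derive y 1 (fun y : R => 1 - y ^+ 2 / M ^+ 2) (- (2 * y / M ^+ 2)).
Proof.
apply: (derE _ (derB (derC y 1) (derM (derX 1 (derI y)) (derC y (M ^- 2))))).
by rewrite expr1; ring.
Qed.

Lemma is_derive_cutoff M y : is_derive y 1 (cutoff M) (cutoff1 M y).
Proof.
exact: (@der_comp R (fun v => pos v ^+ 3) _ y _ _ (is_derive_pos_cube _) (der_arg M y)).
Qed.

Lemma is_derive_cutoff1 M y : is_derive y 1 (cutoff1 M) (cutoff2 M y).
Proof.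
have d1 := @der_comp R (fun v => pos v ^+ 2) _ y _ _ (is_derive_pos_sqr _) (der_arg M y).
have d2 : is_derive y 1 (fun y : R => - (2 * y / M ^+ 2)) (- (2 / M ^+ 2)).
  by apply: (derE _ (derN (derM (derZ 2 (derI y)) (derC y (M ^- 2))))); ring.
apply: (derE _ (derM (derZ 3 d1) d2)).
by rewrite /cutoff2; ring.
Qed.

Lemma cutoff2_continuous M : continuous (cutoff2 M).
Proof.
have cp : continuous (fun y : R => pos (1 - y ^+ 2 / M ^+ 2)).
  move=> y; exact: (@continuous_max R R _ (cst 0) y
    (is_derive1_continuous (der_arg M y)) (cvg_cst _)).
have cl : continuous (fun y : R => 2 * y / M ^+ 2).
  move=> y; apply: cvgMl; apply: cvgMr; exact: cvg_id.
move=> y; apply: cvgB.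
  apply: cvgM; [apply: cvgMr; exact: cp|].
  exact: cvgM (cl y) (cl y).
apply: cvgMl; apply: cvgMr.
exact: cvgM (cp y) (cp y).
Qed.

Lemma cutoff_bounds M y : 1 <= M ->
  [/\ 0 <= cutoff M y <= 1, `|cutoff1 M y| <= 6 / M & `|cutoff2 M y| <= 30 / M].
Proof.
move=> M1; have M0 : 0 < M by rewrite (lt_le_trans ltr01).
have M20 : 0 < M ^+ 2 by exact: exprn_gt0.
have y20 : 0 <= y ^+ 2 / M ^+ 2 by rewrite divr_ge0 ?sqr_ge0.
rewrite /cutoff /cutoff1 /cutoff2.
case: (leP (1 - y ^+ 2 / M ^+ 2) 0) => [_|p0].
  rewrite !expr0n/= !mulr0 !mul0r !subrr normr0 lexx ler01.
  by split => //; rewrite divr_ge0// ltW.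
set p := 1 - _ in p0 *; have p1 : p <= 1 by rewrite /p; lra.
have p0' : 0 <= p := ltW p0.
have yM : `|y| <= M.
  rewrite -(@ler_pXn2r _ 2)// ?nnegrE ?(ltW M0)// real_normK ?num_real//.
  by rewrite -[leRHS]mul1r -ler_pdivrMr//; rewrite /p in p0; lra.
have q1 : `|2 * y / M ^+ 2| <= 2 / M.
  rewrite !normrM (@ger0_norm _ 2)// (@gtr0_norm _ (_^-1)) ?invr_gt0//.
  rewrite ler_pdivrMr//; have -> : 2 / M * M ^+ 2 = 2 * M by field; rewrite gt_eqF.
  by rewrite ler_pM2l.
have p2 : p ^+ 2 <= 1 by rewrite exprn_ile1// ltW.
have p20 : 0 <= p ^+ 2 by exact: sqr_ge0.
have Mi : 0 < M^-1 <= 1 by rewrite invr_gt0 M0 invf_le1.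
split.
- by rewrite exprn_ge0 ?exprn_ile1// ltW.
- rewrite normrM normrN (@ger0_norm _ (3 * _)) ?mulr_ge0//.
  have -> : 6 / M = 3 * 1 * (2 / M) by ring.
  by apply: ler_pM => //; [exact: mulr_ge0|rewrite ler_pM2l].
- have q2 : (2 * y / M ^+ 2) ^+ 2 <= 4 / M.
    rewrite -[leLHS]real_normK ?num_real//.
    have -> : 4 / M = (2 / M) * 2 by ring.
    rewrite expr2; apply: ler_pM => //; apply: (le_trans q1).
    by rewrite ler_pdivrMr// ler_peMr.
  have q20 : 0 <= (2 * y / M ^+ 2) ^+ 2 by exact: sqr_ge0.
  have Mi2 : M ^- 2 <= M^-1.
    by rewrite -exprVn expr2 ler_piMr//; case/andP: Mi => // /ltW.
  have Mi20 : 0 <= M ^- 2 by rewrite invr_ge0 ltW.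
  set q := (_ ^+ 2 : R) in q2 q20 *.
  have h1 : 0 <= 6 * p * q <= 6 * (4 / M).
    apply/andP; split; first by apply: mulr_ge0 => //; exact: mulr_ge0.
    rewrite -[6 * p * q]mulrA ler_pM2l//.
    by apply: (@le_trans _ _ q) => //; rewrite ler_piMl.
  have h2 : 0 <= 6 * p ^+ 2 / M ^+ 2 <= 6 / M.
    apply/andP; split; first by apply: mulr_ge0 => //; exact: mulr_ge0.
    rewrite -[6 * p ^+ 2 / _]mulrA ler_pM2l//.
    by apply: (@le_trans _ _ (M ^- 2)) => //; rewrite ler_piMl.
  case/andP: h1 => ? ?; case/andP: h2 => ? ?.
  by rewrite ler_norml; apply/andP; split; lra.
Qed.

End cutoff.

Section bounded_convergence.
Context {R : realType} {d : measure_display} {Om : measurableType d}.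
Variable P : {measure set Om -> \bar R}.
Hypothesis P1 : P setT = 1%E.

Lemma bounded_convergence (f_ : nat -> Om -> R) (f : Om -> R) (K : R) :
  (forall n, measurable_fun setT (f_ n)) -> (forall n w, `|f_ n w| <= K) ->
  (forall w, f_ ^~ w @ \oo --> f w) ->
  (fun n => (\int[P]_w f_ n w)%R) @ \oo --> (\int[P]_w f w)%R.
Proof.
move=> mf fK ff.
have mlim : measurable_fun setT f by apply: (measurable_fun_cvg (h := f_)) => // w _; exact: ff.
have bf : bounded_measurable f.
  split => //; exists K => w; apply: (cvgr_to_le (cvg_norm (ff w))).
  by near=> n; exact: fK.
have := @dominated_cvg _ _ _ P setT measurableT (fun n w => (f_ n w)%:E)
  (fun w => (f w)%:E) (fun=> K%:E).
have bfn n : bounded_measurable (f_ n) by split => //; exists K.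
have fin (g : Om -> R) : bounded_measurable g ->
    (\int[P]_w (g w)%:E)%E = ((\int[P]_w g w)%R)%:E.
  by move=> bg; rewrite fineK// integrable_fin_num//; exact: bounded_measurable_integrable.
rewrite fin// => H; apply: (fine_cvg (f := fun n => (\int[P]_w (f_ n w)%:E)%E)).
apply: H => //.
- by move=> n; apply/measurable_EFinP.
- by move=> w _; apply: cvg_EFin => //; [exact: nearW|exact: ff].
- exact: (bounded_measurable_integrable P1 (@bounded_measurable_cst R _ Om K)).
- by move=> n w _; rewrite /= lee_fin.
Unshelve. all: by end_near. Qed.

End bounded_convergence.

Section test_functions.
Context {R : realType}.

(** For [r = r0 + (t - s) / m] the first factor solves the backward equation of the
  diffusion in [(s, y)], with the smoothed indicator of a half-line as value at
  time [t]; the second one makes the support compact. *)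
Definition test_function (M r x y : R) := heat_cdf r (x - y) * cutoff M y.
Definition test_function1 (M r x y : R) :=
  - heat r (x - y) * cutoff M y + heat_cdf r (x - y) * cutoff1 M y.
Definition test_function2 (M r x y : R) :=
  heat1 r (x - y) * cutoff M y - 2 * (heat r (x - y) * cutoff1 M y)
  + heat_cdf r (x - y) * cutoff2 M y.

Let der_sub (x y : R) : is_derive y 1 (fun y : R => x - y) (- 1).
Proof. by apply: (derE _ (derB (derC y x) (derI y))); ring. Qed.

Let der_cdf (r x y : R) : is_derive y 1 (fun y => heat_cdf r (x - y)) (- heat r (x - y)).
Proof.
apply: (derE _ (@der_comp R (heat_cdf r) _ y _ _ (is_derive_heat_cdf_y r _) (der_sub x y))).
by ring.
Qed.

Let der_heat (r x y : R) : 0 < r ->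
  is_derive y 1 (fun y => heat r (x - y)) (- heat1 r (x - y)).
Proof.
move=> r0.
apply: (derE _ (@der_comp R (heat r) _ y _ _ (is_derive_heat_y _ r0) (der_sub x y))).
by ring.
Qed.

Let der_heat1 (r x y : R) : 0 < r ->
  is_derive y 1 (fun y => heat1 r (x - y)) (- heat2 r (x - y)).
Proof.
move=> r0.
apply: (derE _ (@der_comp R (heat1 r) _ y _ _ (is_derive_heat1_y _ r0) (der_sub x y))).
by ring.
Qed.

Lemma is_derive_test_function M r x (y : R) :
  is_derive y 1 (test_function M r x) (test_function1 M r x y).
Proof. exact: derM (der_cdf r x y) (is_derive_cutoff M y). Qed.

Lemma is_derive_test_function1 M r x (y : R) : 0 < r ->
  is_derive y 1 (test_function1 M r x) (test_function2 M r x y).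
Proof.
move=> r0; apply: (derE _ (derD (derM (derN (der_heat x y r0)) (is_derive_cutoff M y))
  (derM (der_cdf r x y) (is_derive_cutoff1 M y)))).
by rewrite /test_function2; ring.
Qed.

Let derive1_is (f df : R -> R) : (forall y : R, is_derive y 1 f (df y)) -> derive1 f = df.
Proof. by move=> fd; apply/funext => y; rewrite derive1E; exact: derive_val. Qed.

Lemma derive1_test_function M r x : derive1 (test_function M r x) = test_function1 M r x.
Proof. by apply: derive1_is => y; exact: is_derive_test_function. Qed.

Lemma derive2_test_function M r x : 0 < r ->
  derive1 (derive1 (test_function M r x)) = test_function2 M r x.
Proof.
move=> r0; rewrite derive1_test_function.
by apply: derive1_is => y; exact: is_derive_test_function1.
Qed.

Lemma test_function2_continuous M r x : 0 < r -> continuous (test_function2 M r x).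
Proof.
move=> r0 y; have c1 := is_derive1_continuous (is_derive_cutoff M y).
have c2 := is_derive1_continuous (is_derive_cutoff1 M y).
have h0 := is_derive1_continuous (der_cdf r x y).
have h1 := is_derive1_continuous (der_heat x y r0).
have h2 := is_derive1_continuous (der_heat1 x y r0).
apply: cvgD; last exact: (cvgM h0 (@cutoff2_continuous R M y)).
by apply: cvgB; [exact: cvgM h2 c1|apply: cvgMr; exact: cvgM h1 c2].
Qed.

Lemma test_function_continuous M r x : continuous (test_function M r x).
Proof. by move=> y; exact: is_derive1_continuous (is_derive_test_function M r x y). Qed.

Lemma test_function_C2c M r x : 1 <= M -> 0 < r -> C2c (test_function M r x).
Proof.
move=> M1 r0; split.
- by move=> y; have [] := is_derive_test_function M r x y.
- by move=> y; rewrite derive1_test_function; have [] := is_derive_test_function1 M x y r0.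
- by rewrite derive2_test_function//; exact: test_function2_continuous.
- exists M => y My; rewrite /test_function /cutoff max_r ?expr0n/= ?mulr0//.
  have M0 : 0 < M by rewrite (lt_le_trans ltr01).
  rewrite subr_le0 ler_pdivlMr ?exprn_gt0// mul1r -(real_normK (num_real y)).
  by rewrite lerXn2r ?nnegrE ?(ltW M0)// ltW.
Qed.

Lemma test_function_bounds M r x y : 1 <= M -> 0 <= test_function M r x y <= 1.
Proof.
move=> M1; have [/andP[c0 c1] _ _] := cutoff_bounds y M1.
rewrite mulr_ge0 ?heat_cdf_ge0//= -[leRHS]mulr1.
by apply: ler_pM; rewrite ?heat_cdf_ge0 ?heat_cdf_le1.
Qed.

(** The heat operator applied to the test function only sees the cutoff. *)
Lemma test_function2_residual M r x y B : 1 <= M -> 0 < r -> heat r (x - y) <= B ->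
  `|test_function2 M r x y - heat1 r (x - y) * cutoff M y| <= (12 * B + 30) / M.
Proof.
move=> M1 r0 hB; have [_ c1 c2] := cutoff_bounds y M1.
have h0 := heat_gt0 (x - y) r0.
have -> : test_function2 M r x y - heat1 r (x - y) * cutoff M y =
    heat_cdf r (x - y) * cutoff2 M y - 2 * (heat r (x - y) * cutoff1 M y).
  by rewrite /test_function2; ring.
apply: (le_trans (ler_normB _ _)).
have -> : (12 * B + 30) / M = 1 * (30 / M) + 2 * (B * (6 / M)) by ring.
apply: lerD.
  by rewrite normrM ger0_norm ?heat_cdf_ge0// ler_pM ?heat_cdf_ge0 ?heat_cdf_le1.
rewrite normrM (@ger0_norm _ 2)// ler_pM2l// normrM (gtr0_norm h0).
by apply: ler_pM => //; exact: ltW.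
Qed.

End test_functions.

Section diffusion_law.
Context {R : realType} {d : measure_display} {Om : measurableType d}.
Variables (m : R) (P : R.-pker (measurableTypeR R) ~> Om) (X : R -> Om -> R).
Hypothesis m0 : 0 < m.
Hypothesis diffusion : is_diffusion m P X.
Local Notation Ex f := (\int[P 0]_w f w)%R.

Let mP : markov_process setT P X. Proof. by case: diffusion. Qed.
Let P1 : P 0 setT = 1%E. Proof. exact: prob_kernel. Qed.
Let minv0 : 0 < m^-1. Proof. by rewrite invr_gt0. Qed.

Let sandwich (a b f g e : R) : `|a - b| <= e / 2 -> f <= b + e / 2 -> b <= g + e / 2 ->
  f <= a + e /\ a - e <= g.
Proof. by rewrite ler_norml => /andP[? ?]; split; lra. Qed.

Let increment_forward (a1 a2 a3 h l k b e q : R) : 0 < h ->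
  `|a1 - a2 - h * l| <= e / 2 * h -> `|l - k| <= b ->
  `|a2 - a3 + h * k| <= q -> q <= e / 2 * h -> `|a3 - a1| <= (b + e) * h.
Proof.
move=> h0 E1 E2 E3 E4.
have E5 : `|h * (l - k)| <= b * h by rewrite normrM (gtr0_norm h0) mulrC ler_pM2r.
rewrite distrC.
have -> : a1 - a3 = (a1 - a2 - h * l) + (a2 - a3 + h * k) + h * (l - k) by ring.
apply: (le_trans (ler_normD _ _)).
have := ler_normD (a1 - a2 - h * l) (a2 - a3 + h * k); lra.
Qed.

Let increment_backward (a1 a2 a3 h l b k e : R) : 0 < h ->
  `|a2 - a3 - h * l| <= 1 * h -> `|l| <= k -> `|a1 - a2| <= b * h ->
  h * (b + (1 + k)) <= e -> `|a3 - a1| <= e.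
Proof.
move=> h0 E1 E2 E3; apply: le_trans; rewrite distrC.
have E4 : `|h * l| <= k * h by rewrite normrM (gtr0_norm h0) mulrC ler_pM2r.
have -> : a1 - a3 = (a1 - a2) + ((a2 - a3 - h * l) + h * l) by ring.
have -> : h * (b + (1 + k)) = b * h + (1 * h + k * h) by ring.
apply: (le_trans (ler_normD _ _)); apply: lerD => //.
by apply: (le_trans (ler_normD _ _)); apply: lerD.
Qed.

Let state_bounded (f : R -> R) (s K : R) : measurable_fun setT f ->
  (forall x, `|f x| <= K) -> 0 <= s -> bounded_measurable (fun w => f (X s w)).
Proof. by move=> mf fK s0; apply: (bounded_measurable_state mP) => //; exists K. Qed.

Lemma expectation_start (f : R -> R) (K : R) : measurable_fun setT f ->
  (forall x, `|f x| <= K) -> Ex (fun w => f (X 0 w)) = f 0.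
Proof.
move=> mf fK; have [_ _ start _] := mP.
have bX := state_bounded mf fK (lexx 0).
rewrite -[RHS](expectation_cst P1); congr fine; apply: ae_eq_integral => //.
- by apply/measurable_EFinP; case: bX.
- have mS : measurable (X 0 @^-1` [set 0]).
    by apply: (state_measurable mP) => //; exact: measurable_set1.
  exists (~` (X 0 @^-1` [set 0])); split; first exact: measurableC.
    have U := etrans (esym (measureU (P 0) mS (measurableC mS) (setICr _)))
      (etrans (congr1 (P 0) (setUCr _)) P1).
    have pf : P 0 (~` (X 0 @^-1` [set 0])) \is a fin_num.
      rewrite ge0_fin_numE//; apply: (@le_lt_trans _ _ 1%E); last exact: ltry.
      by rewrite -P1; apply: le_measure; rewrite ?inE//; exact: measurableC.
    have {U} : (1 + fine (P 0 (~` (X 0 @^-1` [set 0]))))%:E = 1%:E :> \bar R.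
      apply: etrans U; apply: esym.
      exact: etrans (congr2 adde (start 0 I) (esym (fineK pf))) _.
    by move=> [/eqP]; rewrite -subr_eq0 addrC addKr -{2}(fineK pf) => /eqP ->.
  by move=> w /= H Xw; apply: H => _; rewrite Xw.
Qed.

Section one_test_function.
Variables (M x r0 t B : R).
Hypothesis M1 : 1 <= M.
Hypothesis r00 : 0 < r0.
Hypothesis t0 : 0 < t.
Hypothesis B0 : 0 < B.
Hypothesis heatB : forall r y, r0 <= r <= r0 + t / m -> [/\ heat r y <= B,
  `|heat1 r y| <= B, `|heat2 r y| <= B &
  `|y / (2 * r ^+ 2) * heat r y - y / (2 * r) * heat2 r y| <= B].

Let rad (s : R) := r0 + (t - s) / m.
Let rad_bounds s : 0 <= s <= t -> r0 <= rad s <= r0 + t / m.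
Proof.
move=> /andP[s0 st]; rewrite /rad lerDl divr_ge0 ?subr_ge0 ?(ltW m0)//= lerD2l.
by rewrite ler_pM2r// lerBlDr lerDl.
Qed.
Let rad_gt0 s : 0 <= s <= t -> 0 < rad s.
Proof. by move=> /rad_bounds/andP[h _]; exact: lt_le_trans h. Qed.

Let g (s y : R) := test_function M (rad s) x y.
Let gk (s y : R) := m^-1 * (heat1 (rad s) (x - y) * cutoff M y).
Let ell (s y : R) := m^-1 * test_function2 M (rad s) x y.
Let psi (s : R) := Ex (fun w => g s (X s w)).

Let quadratic_small h e : 0 < h -> h * (B / m ^+ 2) < e / 2 ->
  B * (h / m) ^+ 2 <= e / 2 * h.
Proof.
move=> h0 he; have -> : B * (h / m) ^+ 2 = h * (B / m ^+ 2) * h.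
  by field; rewrite gt_eqF.
by rewrite ler_pM2r// ltW.
Qed.

Let shift_le v h : h <= v -> t - v + h <= t.
Proof. by move=> hv; lra. Qed.

Let measurable_g s : measurable_fun setT (g s).
Proof. by apply: continuous_measurable_fun; exact: test_function_continuous. Qed.

Let g_range s y : 0 <= g s y <= 1. Proof. exact: test_function_bounds. Qed.

Let gN s y : `|g s y| <= 1.
Proof. by have /andP[h ?] := g_range s y; rewrite ger0_norm. Qed.

Let bg s u : 0 <= u -> bounded_measurable (fun w => g s (X u w)).
Proof. by move=> u0; apply: (state_bounded (K := 1)). Qed.

Let measurable_gk s : 0 <= s <= t -> measurable_fun setT (gk s).
Proof.
move=> st; apply: continuous_measurable_fun => y; apply: cvgMr.
have rs := rad_gt0 st; apply: cvgM; last exact: is_derive1_continuous (is_derive_cutoff M y).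
apply: (@continuous_comp _ _ _ (fun y : R => x - y) (heat1 (rad s))).
  by apply: cvgB; [exact: cvg_cst|exact: cvg_id].
exact: is_derive1_continuous (is_derive_heat1_y _ rs).
Qed.

Let cutN y : `|cutoff M y| <= 1.
Proof. by have [/andP[h ?] _ _] := cutoff_bounds y M1; rewrite ger0_norm. Qed.

Let gkN s y : 0 <= s <= t -> `|gk s y| <= B / m.
Proof.
move=> st; have [_ h _ _] := heatB (x - y) (rad_bounds st).
rewrite /gk (@normrM R m^-1) (@normrM R (heat1 _ _)) (gtr0_norm minv0) mulrC ler_pM2r//.
by rewrite -[leRHS]mulr1; apply: ler_pM.
Qed.

Let measurable_ell s : 0 <= s <= t -> measurable_fun setT (ell s).
Proof.
move=> st; apply: continuous_measurable_fun => y; apply: cvgMr.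
exact: (test_function2_continuous (rad_gt0 st)).
Qed.

Let ell_gk s y : 0 <= s <= t -> `|ell s y - gk s y| <= (12 * B + 30) / M / m.
Proof.
move=> st; rewrite /ell /gk -mulrBr normrM (gtr0_norm minv0) mulrC ler_pM2r//.
apply: test_function2_residual => //; first exact: rad_gt0.
by have [] := heatB (x - y) (rad_bounds st).
Qed.

Let ellN s y : 0 <= s <= t -> `|ell s y| <= B / m + (12 * B + 30) / M / m.
Proof.
move=> st; have -> : ell s y = gk s y + (ell s y - gk s y) by ring.
by apply: (le_trans (ler_normD _ _)); apply: lerD; [exact: gkN|exact: ell_gk].
Qed.

Let bgk s u : 0 <= s <= t -> 0 <= u -> bounded_measurable (fun w => gk s (X u w)).
Proof. by move=> st u0; exact: (state_bounded (measurable_gk st) (fun y => gkN y st) u0). Qed.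

Let bell s u : 0 <= s <= t -> 0 <= u -> bounded_measurable (fun w => ell s (X u w)).
Proof. by move=> st u0; exact: (state_bounded (measurable_ell st) (fun y => ellN y st) u0). Qed.

Let backward s h y : 0 < h -> h <= s -> s <= t ->
  `|g s y - g (s - h) y| <= B / m * h /\
  `|g s y - g (s - h) y + h * gk s y| <= B * (h / m) ^+ 2.
Proof.
move=> h0 hs st; pose z := x - y; pose k := h / m; pose r1 := rad s.
have k0 : 0 < k by rewrite divr_gt0.
have radE : rad (s - h) = r1 + k by rewrite /r1 /rad /k; ring.
have sP : 0 <= s <= t by rewrite (le_trans (ltW h0)).
have shP : 0 <= s - h <= t by rewrite subr_ge0 hs (le_trans _ st)// gerBl ltW.
have rB r : r1 <= r <= r1 + k -> r0 <= r <= r0 + t / m.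
  move=> /andP[h1 h2]; have /andP[h3 _] := rad_bounds sP.
  have /andP[_ h4] := rad_bounds shP; rewrite radE in h4.
  by rewrite (le_trans h3 h1) (le_trans h2 h4).
have rpos r : r1 <= r <= r1 + k -> 0 < r by move=> /rB/andP[r01 _]; exact: lt_le_trans r01.
have in1 : r1 <= r1 <= r1 + k by rewrite lexx lerDl ltW.
have in2 : r1 <= r1 + k <= r1 + k by rewrite lexx lerDl ltW.
have L1 := mean_value_dist (fun r rr => is_derive_heat_cdf_r z (rpos r rr))
  (fun r rr => let: And4 _ b _ _ := heatB z (rB r rr) in b) in1 in2.
have L2 r (rr : r1 <= r <= r1 + k) :=
  mean_value_dist (fun r rr => is_derive_heat1_r z (rpos r rr))
  (fun r rr => let: And4 _ _ _ b := heatB z (rB r rr) in b) rr in1.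
have dF (r : R) : r1 <= r <= r1 + k ->
    is_derive r 1 (fun r => heat_cdf r z - r * heat1 r1 z) (heat1 r z - heat1 r1 z).
  move=> rr; apply: (derE _ (derB (is_derive_heat_cdf_r z (rpos r rr))
    (derM (derI r) (derC r _)))); ring.
have FB r : r1 <= r <= r1 + k -> `|heat1 r z - heat1 r1 z| <= B * k.
  move=> rr; apply: (le_trans (L2 r rr)); rewrite ler_pM2l//.
  by case/andP: rr => h1 h2; rewrite ger0_norm ?subr_ge0// lerBlDl.
have L3 := mean_value_dist dF FB in1 in2.
have r1k : `|r1 - (r1 + k)| = k by rewrite opprD addNKr normrN gtr0_norm.
rewrite r1k in L1 L3.
have cut : 0 <= cutoff M y <= 1 by have [] := cutoff_bounds y M1.
have cutM (v w : R) : `|v| <= w -> `|v * cutoff M y| <= w.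
  move=> vw; case/andP: cut => c0 c1; rewrite normrM (ger0_norm c0).
  by rewrite -[w]mulr1; apply: ler_pM.
split.
  rewrite /g /test_function -mulrBl radE; apply: cutM.
  by have -> : B / m * h = B * k by rewrite /k; ring.
have -> : g s y - g (s - h) y + h * gk s y =
    (heat_cdf r1 z - r1 * heat1 r1 z - (heat_cdf (r1 + k) z - (r1 + k) * heat1 r1 z))
    * cutoff M y.
  by rewrite /g /test_function /gk radE -/r1 -/z /k; ring.
by rewrite -/k (_ : B * k ^+ 2 = B * k * k); [exact: cutM|ring].
Qed.

Let backward_expectation s h u : 0 < h -> h <= s -> s <= t -> 0 <= u ->
  `|Ex (fun w => g s (X u w)) - Ex (fun w => g (s - h) (X u w))| <= B / m * h /\
  `|Ex (fun w => g s (X u w)) - Ex (fun w => g (s - h) (X u w))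
    + h * Ex (fun w => gk s (X u w))| <= B * (h / m) ^+ 2.
Proof.
move=> h0 hs st u0; have sP : 0 <= s <= t by rewrite (le_trans (ltW h0)).
have bd := bounded_measurableB (bg s u0) (bg (s - h) u0).
have bk := bounded_measurableZ h (bgk sP u0).
rewrite -(expectationB P1 (bg s u0) (bg (s - h) u0)) -(expectationZ P1 h (bgk sP u0)).
rewrite -(expectationD P1 bd bk); split; apply: (expectation_norm_le P1).
- exact: bd.
- by move=> w; have [] := backward (X u w) h0 hs st.
- exact: bounded_measurableD bd bk.
- by move=> w; have [] := backward (X u w) h0 hs st.
Qed.

Let ell_gk_expectation s u : 0 <= s <= t -> 0 <= u ->
  `|Ex (fun w => ell s (X u w)) - Ex (fun w => gk s (X u w))| <= (12 * B + 30) / M / m.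
Proof.
move=> sP u0; rewrite -(expectationB P1 (bell sP u0) (bgk sP u0)).
apply: (expectation_norm_le P1 (bounded_measurableB (bell sP u0) (bgk sP u0))) => w.
exact: ell_gk.
Qed.

Let ell_expectation s u : 0 <= s <= t -> 0 <= u ->
  `|Ex (fun w => ell s (X u w))| <= B / m + (12 * B + 30) / M / m.
Proof.
move=> sP u0; apply: (expectation_norm_le P1 (bell sP u0)) => w; exact: ellN.
Qed.

Let space_part s e : 0 <= s <= t -> 0 < e -> exists2 dl : R, 0 < dl &
  forall u h, 0 <= u -> 0 < h < dl ->
   `|Ex (fun w => g s (X (u + h) w)) - Ex (fun w => g s (X u w))
     - h * Ex (fun w => ell s (X u w))| <= e * h.
Proof.
move=> st e0; have [_ _ gen] := diffusion.
apply: (generator_increment mP gen (M := 1) (f := g s) (ell := ell s)) => //.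
- by apply: test_function_C2c => //; exact: rad_gt0.
- exact: measurable_ell.
- by exists (B / m + (12 * B + 30) / M / m) => y; exact: ellN.
- by move=> y _; rewrite derive2_test_function//; exact: rad_gt0.
Qed.

Let c := (12 * B + 30) / M / m.
Let Bm : 0 < B / m := divr_gt0 B0 m0.
Let c0 : 0 <= c.
Proof.
have h : 0 <= 12 * B + 30 by apply: addr_ge0 => //; rewrite mulr_ge0// ltW.
exact: divr_ge0 (divr_ge0 h (le_trans ler01 M1)) (ltW m0).
Qed.

(** The generator controls the increments of the expectation of a fixed function,
  uniformly in the time at which they start. Hence the increment between [s - h]
  and [s] is split so that the process moves while the test function is frozen at
  its value at time [s]: the test function then only varies in time at a fixed law,
  and the two contributions cancel up to the effect of the cutoff. *)
Lemma test_function_conservation :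
  `|Ex (fun w => test_function M r0 x (X t w)) - test_function M (r0 + t / m) x 0|
  <= c * t.
Proof.
have g0E : test_function M (r0 + t / m) x 0 = psi 0.
  by rewrite /psi (@expectation_start (g 0) 1 (measurable_g 0) (gN 0)) /g /rad subr0.
have gtE : Ex (fun w => test_function M r0 x (X t w)) = psi t.
  by rewrite /psi /g /rad subrr mul0r addr0.
rewrite gtE g0E distrC; pose phi u := psi (t - u).
suff reversed (a b : R) : phi t = a -> phi 0 = b -> `|a - b| <= c * t.
  exact: reversed (congr1 psi (subrr t)) (congr1 psi (subr0 t)).
move=> <- <-.
have q0 : 0 < B / m ^+ 2 := divr_gt0 B0 (exprn_gt0 2 m0).
apply: right_dini_bound; first exact: ltW.
- move=> v e /andP[v0 vt] e0; pose s := t - v.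
  have s0 : 0 < s by rewrite subr_gt0.
  have st : s <= t by rewrite gerBl.
  have sP : 0 <= s <= t by rewrite ltW.
  have e2 : 0 < e / 2 by rewrite divr_gt0.
  have [d1 d10 H1] := space_part sP e2.
  exists (Num.min d1 (Num.min s (e / 2 / (B / m ^+ 2)))).
    by rewrite !lt_min d10 s0 divr_gt0.
  move=> h /andP[h0]; rewrite !lt_min (ltr_pdivlMr _ _ q0) => /and3P[h1 h2 h3].
  have sh : 0 <= s - h by rewrite subr_ge0 ltW.
  have E1 := H1 (s - h) h sh ltac:(by rewrite h0); rewrite subrK in E1.
  have E2 := ell_gk_expectation sP sh.
  have [_ E3] := backward_expectation h0 (ltW h2) st sh.
  have -> : phi (v + h) - phi v = psi (s - h) - psi s.
    by rewrite /phi /s opprD addrA.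
  exact: increment_forward h0 E1 E2 E3 (quadratic_small h0 h3).
- move=> v e /andP[v0 vt] e0; pose s := t - v.
  have s0 : 0 <= s by rewrite subr_ge0.
  have st : s <= t by rewrite gerBl ltW.
  have sP : 0 <= s <= t by rewrite s0.
  have [d1 d10 H1] := space_part sP ltr01.
  pose K := B / m + (1 + (B / m + c)).
  have K0 : 0 < K by rewrite /K; move: Bm c0; lra.
  exists (Num.min d1 (e / K)); first by rewrite lt_min d10 divr_gt0.
  move=> h /andP[h0]; rewrite lt_min (ltr_pdivlMr _ _ K0) => /andP[h1 h2] hv.
  have sh : 0 <= s + h := addr_ge0 s0 (ltW h0).
  have sht : s + h <= t := shift_le hv.
  have E1 := H1 s h s0 ltac:(by rewrite h0).
  have E2 := ell_expectation sP s0.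
  have hs : h <= s + h := ler_wpDl s0 (lexx h).
  have [E3 _] := backward_expectation h0 hs sht sh; rewrite addrK in E3.
  have -> : phi v - phi (v - h) = psi s - psi (s + h).
    by rewrite /phi /s opprB addrA [in X in _ - X]addrAC.
  exact: increment_backward h0 E1 E2 E3 (ltW h2).
Qed.

End one_test_function.

(** The error due to the cutoff vanishes when its support grows to the whole line. *)
Lemma expectation_heat_cdf (x r0 t : R) : 0 < r0 -> 0 < t ->
  Ex (fun w => heat_cdf r0 (x - X t w)) = heat_cdf (r0 + t / m) x.
Proof.
move=> r00 t0; have [B B0 heatB] := heat_bounded (r0 + t / m) r00.
pose M_ (n : nat) : R := n.+1%:R.
have M1 n : 1 <= M_ n by rewrite ler1n.
have cut1 y : (fun n => cutoff (M_ n) y) @ \oo --> (1 : R).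
  have h : (fun n => y ^+ 2 / M_ n ^+ 2) @ \oo --> (0 : R).
    have -> : (fun n => y ^+ 2 / M_ n ^+ 2) = fun n => y ^+ 2 * (n.+1%:R^-1 * n.+1%:R^-1).
      by apply/funext => n; rewrite /M_ expr2 invfM.
    rewrite -[X in _ --> X](mulr0 (y ^+ 2)); apply: cvgMr.
    rewrite -[X in _ --> X](mulr0 (0 : R)); apply: cvgM; exact: cvg_harmonic.
  have -> : (1 : R) = Num.max (1 - 0) 0 ^+ 3.
    by rewrite subr0 max_l ?ler01// expr1n.
  have ch : {for (0 : R), continuous (fun z : R => Num.max (1 - z) 0 ^+ 3)}.
    have d1 : is_derive (0 : R) 1 (fun z : R => 1 - z) (0 - 1) := derB (derC _ 1) (derI _).
    exact: is_derive1_continuous (@der_comp R (fun v => Num.max v 0 ^+ 3) _ 0 _ _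
      (is_derive_pos_cube _) d1).
  exact: (@cvg_comp _ _ _ (fun n => y ^+ 2 / M_ n ^+ 2)
    (fun z : R => Num.max (1 - z) 0 ^+ 3) _ _ _ h ch).
have tcv : (fun n => Ex (fun w => test_function (M_ n) r0 x (X t w))) @ \oo -->
    Ex (fun w => heat_cdf r0 (x - X t w)).
  apply: (bounded_convergence P1 (K := 1)).
  - move=> n; have mX : measurable_fun setT (X t) by case: mP => + _ _ _; apply; exact: ltW.
    apply: measurableT_comp mX; apply: continuous_measurable_fun.
    exact: test_function_continuous.
  - move=> n w; have /andP[h ?] := test_function_bounds r0 x (X t w) (M1 n).
    by rewrite ger0_norm.
  - move=> w; rewrite -[X in _ --> X]mulr1; apply: cvgM; first exact: cvg_cst.
    exact: cut1.
have cut0 n : cutoff (M_ n) 0 = 1.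
  by rewrite /cutoff expr0n/= mul0r subr0 max_l ?ler01// expr1n.
pose D := (12 * B + 30) / m * t.
have D0 : 0 < D.
  by rewrite mulr_gt0// divr_gt0// addr_gt0// mulr_gt0.
have bound n : `|Ex (fun w => test_function (M_ n) r0 x (X t w))
    - heat_cdf (r0 + t / m) x| <= D / n.+1%:R.
  have := @test_function_conservation (M_ n) x r0 t B (M1 n) r00 t0 B0 heatB.
  rewrite {2}/test_function subr0 cut0 mulr1 => h; apply: (le_trans h).
  rewrite /D /M_ le_eqVlt; apply/orP; left; apply/eqP.
  by field; rewrite gt_eqF// gt_eqF.
apply/eqP; rewrite -subr_eq0 -normr_eq0 eq_le normr_ge0 andbT.
apply/ler_addgt0Pl => e e0; rewrite addr0.
apply: (cvgr_to_le (cvg_norm (cvgB tcv (cvg_cst (heat_cdf (r0 + t / m) x))))).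
near=> n; apply: (le_trans (bound n)).
rewrite ler_pdivrMr ?ltr0n// mulrC -ler_pdivrMr//.
apply: (@le_trans _ _ n%:R); last by rewrite ler_nat.
near: n; exact: nbhs_infty_ger.
Unshelve. all: by end_near. Qed.

(** The transition probabilities are obtained by letting the regularisation of the
  indicator of a half-line disappear. *)
Theorem diffusion_cdf (t x : R) : 0 < t -> prob_le P X 0 t x = heat_cdf (t / m) x.
Proof.
move=> t0; have tm0 : 0 < t / m by rewrite divr_gt0.
pose F x := prob_le P X 0 t x.
have mle (z : R) : measurable [set w | X t w <= z].
  have mX : measurable_fun setT (X t) by case: mP => + _ _ _; apply; exact: ltW.
  by rewrite -[X in measurable X]setTI; exact: measurable_fun_ler.
have FE z : F z = Ex (\1_[set w | X t w <= z] : Om -> R).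
  by rewrite expectation_indic.
have bind z : bounded_measurable (\1_[set w | X t w <= z] : Om -> R).
  exact: bounded_measurable_indic.
have bH r0 z : bounded_measurable (fun w => heat_cdf r0 (z - X t w)).
  apply: (@state_bounded (fun y => heat_cdf r0 (z - y)) t 1); last exact: ltW.
    apply: continuous_measurable_fun => y.
    apply: (@continuous_comp _ _ _ (fun y : R => z - y) (heat_cdf r0)).
      by apply: cvgB; [exact: cvg_cst|exact: cvg_id].
    exact: is_derive1_continuous (is_derive_heat_cdf_y r0 _).
  by move=> y; rewrite ger0_norm ?heat_cdf_ge0 ?heat_cdf_le1.
have key e eta z : 0 < e -> 0 < eta ->
    F (z - eta) <= heat_cdf (t / m) z + e /\ heat_cdf (t / m) z - e <= F (z + eta).
  move=> e0 eta0; have e2 : 0 < e / 2 by rewrite divr_gt0.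
  have [Q HQ] := gauss_cdf_near1 e2.
  have Hc : {for t / m, continuous (heat_cdf ^~ z)}.
    exact: is_derive1_continuous (is_derive_heat_cdf_r z tm0).
  have /cvgrPdist_le/(_ _ e2)[dl /= dl0 Hdl] := Hc.
  pose Q1 := Num.max Q 1; have Q10 : 0 < Q1 by rewrite lt_max ltr01 orbT.
  pose r0 := Num.min (dl / 2) ((eta / Q1) ^+ 2).
  have eQ0 : 0 < eta / Q1 by exact: divr_gt0.
  have r00 : 0 < r0 by rewrite lt_min divr_gt0//= exprn_gt0.
  have s0 : 0 < Num.sqrt r0 by rewrite sqrtr_gt0.
  have sQ : Q1 * Num.sqrt r0 <= eta.
    rewrite mulrC -ler_pdivlMr// -[leRHS](ger0_norm (ltW eQ0)) -sqrtr_sqr.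
    by apply: ler_wsqrtr; rewrite /r0 ge_min lexx orbT.
  have big y : eta <= y -> 1 - e / 2 <= heat_cdf r0 y.
    move=> y1; apply: HQ; apply: (@le_trans _ _ Q1); first by rewrite le_max lexx.
    by rewrite -/(y / _) ler_pdivlMr// (le_trans sQ).
  have small y : y <= - eta -> heat_cdf r0 y <= e / 2.
    move=> y1; rewrite /heat_cdf -[y]opprK mulNr gauss_cdfN.
    by have := big (- y); rewrite /heat_cdf => /(_ _)/wrap[|]; lra.
  have near : `|heat_cdf (t / m) z - heat_cdf (r0 + t / m) z| <= e / 2.
    apply: Hdl; rewrite /ball_/= opprD addrCA subrr addr0 normrN (gtr0_norm r00).
    by rewrite /r0 gt_min ltr_pdivrMr// ltr_pMr// ltr1n.
  have E := expectation_heat_cdf z r00 t0.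
  have bc : bounded_measurable (fun _ : Om => e / 2) by exact: bounded_measurable_cst.
  have h1 : F (z - eta) <= heat_cdf (r0 + t / m) z + e / 2.
    rewrite FE -E -(expectation_cst P1 (e / 2)) -expectationD//.
    apply: expectation_le => //; first exact: bounded_measurableD.
    move=> w; rewrite indicE; case: (boolP (w \in _)) => [/set_mem/= Xw|_].
      by have := big (z - X t w) ltac:(lra); lra.
    by rewrite addr_ge0 ?heat_cdf_ge0// ltW.
  have h2 : heat_cdf (r0 + t / m) z <= F (z + eta) + e / 2.
    rewrite FE -E -(expectation_cst P1 (e / 2)) -expectationD//.
    apply: expectation_le => //; first exact: bounded_measurableD.
    move=> w; rewrite indicE; case: (boolP (w \in _)) => [_|/negP Xw].
      by apply: (le_trans (heat_cdf_le1 _ _)); rewrite lerDl ltW.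
    rewrite add0r; apply: small.
    have : z + eta < X t w by rewrite ltNge; apply/negP => h; apply: Xw; rewrite inE.
    lra.
  exact: (sandwich near h1 h2).
apply/eqP; rewrite -subr_eq0 -normr_eq0 eq_le normr_ge0 andbT.
apply/ler_addgt0Pl => e e0; rewrite addr0; have e2 : 0 < e / 2 by rewrite divr_gt0.
have /cvgrPdist_le/(_ _ e2)[dl /= dl0 Hdl] := heat_cdf_continuous (y := x) tm0.
have d2 : 0 < dl / 2 by rewrite divr_gt0.
have dd : dl / 2 < dl by rewrite ltr_pdivrMr// ltr_pMr// ltr1n.
have [k1 _] := key (e / 2) (dl / 2) (x + dl / 2) e2 d2.
have [_ k2] := key (e / 2) (dl / 2) (x - dl / 2) e2 d2.
rewrite addrK in k1; rewrite subrK in k2.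
have c1 : `|heat_cdf (t / m) x - heat_cdf (t / m) (x + dl / 2)| <= e / 2.
  by apply: Hdl; rewrite /ball_/= opprD addrA subrr add0r normrN gtr0_norm.
have c2 : `|heat_cdf (t / m) x - heat_cdf (t / m) (x - dl / 2)| <= e / 2.
  by apply: Hdl; rewrite /ball_/= opprB addrCA subrr addr0 gtr0_norm.
move: c1 c2; rewrite -/(F x) !ler_norml => /andP[? ?] /andP[? ?].
by apply/andP; split; lra.
Qed.

(** The distribution function has derivative [heat (t / m) x], and the density is
  continuous. *)
Theorem diffusion_density (p : R -> R -> R -> R) (t x : R) : 0 < t ->
  is_heat_kernel setT P X (scaled_lebesgue m) p ->
  p t 0 x = heat (t / m) x / m.
Proof.
move=> t0 [p0 pc pE]; have tm0 : 0 < t / m by rewrite divr_gt0.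
have cp : continuous (p t 0).
  move=> y; pose A := [set z : R * R * R |
    [/\ 0 < z.1.1, [set: R] z.1.2 & [set: R] z.2]].
  have /subspace_continuousP/(_ (t, 0, y)) H := pc.
  have cpair : (fun y' : R => (t, 0 : R, y')) @ y --> within A (nbhs (t, 0 : R, y)).
    move=> U; rewrite /within/= => HU.
    have cc : (fun y' : R => (t, 0 : R, y')) @ y --> (t, 0 : R, y).
      apply: (@cvg_pair _ _ _ _ (nbhs ((t, 0) : R * R)) (nbhs y) _ _ _
        (cst ((t, 0) : R * R)) id); [exact: cvg_cst|exact: cvg_id].
    have near_y : \forall y' \near y, A (t, 0, y') -> U (t, 0, y') := cc _ HU.
    have : \forall y' \near y, U (t, 0, y') by apply: filterS near_y => y'; apply.
    exact.
  have Hy := H (And3 t0 I I).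
  exact: (@cvg_comp _ _ _ (fun y' : R => (t, 0 : R, y'))
    (fun z : R * R * R => p z.1.1 z.1.2 z.2) _ _ _ cpair Hy).
set L := p t 0 x; set q := heat (t / m) x.
have L0 : 0 <= L by exact: p0.
suff H e : 0 < e -> `|m * L - q| <= (m + 1) * e.
  have : `|m * L - q| <= 0.
    apply/ler_addgt0Pl => e e0; rewrite addr0.
    have m10 : 0 < m + 1 by rewrite addr_gt0.
    have := H _ (divr_gt0 e0 m10).
    by rewrite mulrCA divff ?mulr1// gt_eqF.
  rewrite normr_le0 subr_eq0 => /eqP <-.
  by rewrite mulrAC divff ?mul1r// gt_eqF.
move=> e0.
have /cvgrPdist_le/(_ _ e0)[d1 /= d10 H1] := cp x.
have /cvgrPdist_le/(_ _ e0)[d2 /= d20 H2] := heat_continuous (y := x) tm0.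
pose h := Num.min d1 d2 / 2.
have h0 : 0 < h by rewrite divr_gt0// lt_min d10.
have hd : h < Num.min d1 d2 by rewrite ltr_pdivrMr// ltr_pMr ?ltr1n// lt_min d10.
have [hd1 hd2] : h < d1 /\ h < d2 by move: hd; rewrite lt_min => /andP[].
pose A : set R := `]x, (x + h)]%classic.
have near y : A y -> `|x - y| < Num.min d1 d2.
  rewrite /A/= in_itv/= => /andP[y1 y2]; rewrite distrC gtr0_norm ?subr_gt0//.
  by apply: le_lt_trans hd; rewrite lerBlDl.
have pA y : A y -> L - e <= p t 0 y <= L + e.
  move=> /near; rewrite lt_min => /andP[yd _]; have := H1 y yd.
  by rewrite -/L ler_norml => /andP[? ?]; apply/andP; split; lra.
have mA : measurable A by exact: measurable_itv.
have mX : measurable_fun setT (X t) by case: mP => + _ _ _; apply; exact: ltW.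
have muA : scaled_lebesgue m A = (m * h)%:E.
  have lA : @lebesgue_measure R A = h%:E.
    rewrite /A lebesgue_measure_itv/= lte_fin ltrDl h0 -EFinB; congr EFin; ring.
  apply: etrans (congr1 (fun z => (`|m|%:E * z)%E) lA) _.
  by rewrite gtr0_norm.
have mpt : measurable_fun A (EFin \o p t 0).
  by apply/measurable_EFinP; apply: measurable_funTS; exact: continuous_measurable_fun.
pose v := fine (P 0 (X t @^-1` A)).
have vE : P 0 (X t @^-1` A) = v%:E.
  rewrite fineK// ge0_fin_numE//; apply: (@le_lt_trans _ _ 1%E); last exact: ltry.
  rewrite -P1; apply: le_measure; rewrite ?inE//.
  by rewrite -[X in measurable X]setTI; exact: mX.
have := pE t 0 A t0 I mA; rewrite setIT vE => intE.
have up : v <= (L + e) * (m * h).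
  rewrite -lee_fin intE EFinM -muA -integral_cst//; apply: ge0_le_integral => //.
  - by move=> y _; rewrite lee_fin; exact: p0.
  - by move=> y /pA/andP[_ h2]; rewrite lee_fin.
have lo : (L - e) * (m * h) <= v.
  apply: (@le_trans _ _ (Num.max 0 (L - e) * (m * h))).
    by rewrite (ler_pM2r (mulr_gt0 m0 h0)) le_max lexx orbT.
  rewrite -lee_fin intE EFinM -muA -integral_cst//; apply: ge0_le_integral => //.
  - by move=> y _; rewrite lee_fin le_max lexx.
  - by move=> y /pA/andP[h1 _]; rewrite lee_fin ge_max p0.
have vF : v = prob_le P X 0 t (x + h) - prob_le P X 0 t x.
  have mle (z : R) : measurable [set w | X t w <= z].
    by rewrite -[X in measurable X]setTI; exact: measurable_fun_ler.
  have mXA : measurable (X t @^-1` A).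
    by rewrite -[X in measurable X]setTI; exact: mX.
  rewrite /v /prob_le -!expectation_indic// -expectationB//; last 2 first.
  - exact: bounded_measurable_indic.
  - exact: bounded_measurable_indic.
  congr fine; apply: eq_integral => w _; congr EFin; rewrite !indicE.
  have memE (z : R) : (w \in [set w | X t w <= z]) = (X t w <= z).
    by apply/idP/idP => [/set_mem//|?]; rewrite inE.
  have -> : (w \in X t @^-1` A) = (x < X t w) && (X t w <= x + h).
    by apply/idP/idP => [/set_mem|H]; rewrite ?inE /A/= in_itv.
  rewrite !memE; case: (leP (X t w) x) => wx /=; last by rewrite subr0.
  by rewrite (le_trans wx) ?subrr// lerDl ltW.
rewrite !diffusion_cdf// in vF.
have xh : x <= x + h by rewrite lerDl ltW.
have cH : {within `[x, x + h], continuous (heat_cdf (t / m))}.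
  by apply: continuous_subspaceT => y; exact: heat_cdf_continuous.
have dH y := is_derive_heat_cdf_y (t / m) y.
have hB y : x < y < x + h -> q - e <= heat (t / m) y <= q + e.
  move=> /andP[y1 y2]; have /near : A y by rewrite /A/= in_itv/= y1 ltW.
  rewrite lt_min => /andP[_ yd]; have := H2 y yd.
  by rewrite -/q ler_norml => /andP[? ?]; apply/andP; split; lra.
have m1 : v <= (q + e) * (x + h - x).
  rewrite vF; apply: (mean_value_le xh cH (fun y _ => dH y)) => y /hB/andP[_]; exact.
have m2 : (q - e) * (x + h - x) <= v.
  rewrite vF; apply: (mean_value_ge xh cH (fun y _ => dH y)) => y /hB/andP[+ _]; exact.
have xhx : x + h - x = h by ring.
rewrite xhx in m1 m2; rewrite ler_norml; apply/andP; split.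
- rewrite -(ler_pM2r h0); lra.
- rewrite -(ler_pM2r h0); lra.
Qed.

End diffusion_law.

(** * A rate in the strong law of large numbers *)

Section chaining.
Context {R : realType}.

(** Any initial segment of length at most [2 ^ J] is a disjoint union of dyadic
  blocks, with at most one block of each length. *)
Lemma dyadic_chaining (J : nat) (s : nat -> R) (x : R) :
  (forall l i : nat, (l <= J)%N -> (i < 2 ^ (J - l))%N ->
     `|\sum_(j < 2 ^ l) s (i * 2 ^ l + j)%N| <= x) ->
  forall k, (k <= 2 ^ J)%N -> `|\sum_(j < k) s j| <= J.+1%:R * x.
Proof.
elim: J s => [|J IH] s H k kJ.
  have x0 : 0 <= x := le_trans (normr_ge0 _) (H 0%N 0%N isT isT).
  case: k kJ => [|[|]]// _; first by rewrite big_ord0 normr0 mul1r.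
  by have := H 0%N 0%N isT isT; rewrite mul1r mul0n.
have x0 : 0 <= x := le_trans (normr_ge0 _) (H 0%N 0%N isT (expn_gt0 2 _)).
have half c : (forall l i : nat, (l <= J)%N -> (i < 2 ^ (J - l))%N ->
     (c * 2 ^ (J - l) + i < 2 ^ (J.+1 - l))%N) ->
   forall k, (k <= 2 ^ J)%N ->
   `|\sum_(j < k) s (c * 2 ^ J + j)%N| <= J.+1%:R * x.
  move=> Hc; apply: (IH (fun j => s (c * 2 ^ J + j)%N)) => l i lJ iJ.
  have := H l (c * 2 ^ (J - l) + i)%N (leqW lJ) (Hc l i lJ iJ).
  rewrite mulnDl -mulnA -expnD subnK//; under eq_bigr do rewrite -addnA; exact.
have [kJ'|kJ'] := leqP k (2 ^ J).
  have := half 0%N _ k kJ'; rewrite mul0n => h; apply: le_trans (h _) _.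
    move=> l i lJ iJ; rewrite mul0n add0n (ltn_trans iJ)// ltn_exp2l//.
    by rewrite subSn.
  by rewrite ler_wpM2r// ler_nat.
rewrite -(subnKC (ltnW kJ')) big_split_ord/= (_ : J.+2%:R = 1 + J.+1%:R :> R); last first.
  by rewrite addrC natr1.
rewrite mulrDl mul1r; apply: (le_trans (ler_normD _ _)); apply: lerD.
  have := H J 0%N (leqnSn _); rewrite mul0n; apply.
  by rewrite subSn// subnn.
have := half 1%N; rewrite mul1n; apply.
  move=> l i lJ iJ; rewrite mul1n subSn// expnS mul2n -addnn ltn_add2l//.
by rewrite leq_subLR addnn -mul2n -expnS.
Qed.

End chaining.

Section moments.
Context {R : realType} {d : measure_display} {T : measurableType d}.
Variable P : probability T R.
Let P1 : P setT = 1%E. Proof. exact: probability_setT. Qed.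
Local Notation Ex f := (\int[P]_w f w)%R.

Lemma bounded_measurableM (f g : T -> R) : bounded_measurable f ->
  bounded_measurable g -> bounded_measurable (fun w => f w * g w).
Proof.
move=> [mf [M fM]] [mg [N gN]]; split; first exact: measurable_funM.
by exists (M * N) => w; rewrite normrM ler_pM.
Qed.

Lemma second_moment_sum (D : nat -> T -> R) (v : R) :
  (forall i, bounded_measurable (D i)) ->
  (forall i j, i != j -> Ex (fun w => D i w * D j w) = 0) ->
  (forall i, Ex (fun w => D i w ^+ 2) <= v) ->
  forall a N, Ex (fun w => (\sum_(i < N) D (a + i)%N w) ^+ 2) <= N%:R * v.
Proof.
move=> bD D0 Dv a; elim=> [|N IH].
  have -> : (fun w => (\sum_(i < 0) D (a + i)%N w) ^+ 2) = cst 0.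
    by apply/funext => w; rewrite big_ord0 expr0n.
  by rewrite expectation_cst// mul0r.
pose S w := \sum_(i < N) D (a + i)%N w.
have bS : bounded_measurable S by exact: (bounded_measurable_sum N (fun i => bD (a + i)%N)).
have -> : (fun w => (\sum_(i < N.+1) D (a + i)%N w) ^+ 2) =
    fun w => S w * S w + (2 * (D (a + N)%N w * S w) + D (a + N)%N w * D (a + N)%N w).
  by apply/funext => w; rewrite big_ord_recr/= -/(S w); ring.
have bSS := bounded_measurableM bS bS.
have bDS := bounded_measurableM (bD (a + N)%N) bS.
have bDD := bounded_measurableM (bD (a + N)%N) (bD (a + N)%N).
rewrite expectationD//; last first.
  by apply: bounded_measurableD => //; exact: bounded_measurableZ.
rewrite expectationD//; last exact: bounded_measurableZ.
rewrite expectationZ//.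
have -> : Ex (fun w => D (a + N)%N w * S w) = 0.
  have -> : (fun w => D (a + N)%N w * S w) =
      fun w => \sum_(i < N) D (a + N)%N w * D (a + i)%N w.
    by apply/funext => w; rewrite /S big_distrr.
  rewrite (expectation_sum P1 N (F := fun i w => D (a + N)%N w * D (a + i)%N w)).
    rewrite big1// => i _; apply: D0.
    by rewrite eqn_add2l neq_ltn ltn_ord orbT.
  by move=> i; exact: bounded_measurableM.
rewrite mulr0 add0r -natr1 mulrDl mul1r; apply: lerD.
  exact: IH.
exact: Dv.
Qed.

Lemma chebyshev_bounded (f : T -> R) (x : R) : bounded_measurable f -> 0 < x ->
  (P [set w | (x < `|f w|)%R] <= (Ex (fun w => f w ^+ 2) / x ^+ 2)%:E)%E.
Proof.
move=> bf x0; have [mf _] := bf.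
have mA : measurable [set w | x < `|f w|].
  rewrite -[X in measurable X]setTI.
  by apply: measurable_fun_ltr => //; exact: measurableT_comp.
have x20 : 0 < x ^+ 2 by exact: exprn_gt0.
have -> : P [set w | x < `|f w|] = (Ex (\1_[set w | x < `|f w|] : T -> R))%:E.
  rewrite expectation_indic// fineK// ge0_fin_numE//.
  by rewrite (le_lt_trans (probability_le1 _ _))// ltry.
rewrite lee_fin ler_pdivlMr// mulrC -expectationZ//; last exact: bounded_measurable_indic.
apply: expectation_le => //.
- by apply: bounded_measurableZ; exact: bounded_measurable_indic.
- exact: bounded_measurableM.
- move=> w; rewrite indicE; case: (boolP (w \in _)) => [/set_mem/= xf|_]; last first.
    by rewrite mulr0 sqr_ge0.
  rewrite mulr1 -(real_normK (num_real (f w))).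
  by rewrite ler_pXn2r// ?nnegrE// ltW.
Qed.

(** The joint law of two independent variables is the product of their laws, on
  which Fubini's theorem applies. *)
Lemma independent_expectation (U V : {RV P >-> R}) (f g : R -> R) (M : R) :
  (forall A B : set R, measurable A -> measurable B ->
    P (U @^-1` A `&` V @^-1` B) = (P (U @^-1` A) * P (V @^-1` B))%E) ->
  measurable_fun setT f -> measurable_fun setT g ->
  (forall x, 0 <= f x <= M) -> (forall x, 0 <= g x <= M) ->
  Ex (fun w => f (U w) * g (V w)) = Ex (fun w => f (U w)) * Ex (fun w => g (V w)).
Proof.
move=> ind mf mg fM gM.
have f0 x : 0 <= f x by case/andP: (fM x).
have g0 x : 0 <= g x by case/andP: (gM x).
have mUV : measurable_fun setT (fun w => (U w, V w)) by exact: measurable_fun_pair.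
have mfE : measurable_fun setT (EFin \o f) by exact/measurable_EFinP.
have mgE : measurable_fun setT (EFin \o g) by exact/measurable_EFinP.
have fE0 x : (0 <= (EFin \o f) x)%E by rewrite lee_fin.
have gE0 x : (0 <= (EFin \o g) x)%E by rewrite lee_fin.
pose h (z : R * R) := ((f z.1)%:E * (g z.2)%:E)%E.
have mh : measurable_fun setT h.
  apply: emeasurable_funM.
    exact: (measurableT_comp mfE measurable_fst).
  exact: (measurableT_comp mgE measurable_snd).
have h0 z : (0 <= h z)%E by rewrite mule_ge0 ?lee_fin.
have law : forall Z, measurable Z -> 
    (distribution P U \x distribution P V)%E Z = pushforward P (fun w => (U w, V w)) Z.
  move=> Z mZ; exact: product_measure_unique.

have prod : (\int[P]_w ((f (U w))%:E * (g (V w))%:E) =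
    (\int[P]_w (f (U w))%:E) * \int[P]_w (g (V w))%:E)%E.
  have -> : (\int[P]_w ((f (U w))%:E * (g (V w))%:E) =
      \int[pushforward P (fun w => (U w, V w))]_z h z)%E.
    by rewrite (ge0_integral_pushforward mUV).
  rewrite -(eq_measure_integral _ (fun Z mZ _ => law Z mZ)).
  rewrite fubini_tonelli1//.
  rewrite (eq_integral (fun x => (f x)%:E * \int[P]_w (g (V w))%:E)%E).
  - rewrite ge0_integralZr//.
    + by rewrite (ge0_integral_distribution U mfE fE0).
    + by move=> x _; rewrite lee_fin.
    + by apply: integral_ge0 => w _; rewrite lee_fin.
  - move=> x _; have := ge0_integralZl (distribution P V) measurableT mgE
      (fun y _ => gE0 y) (fE0 x).
    by rewrite (ge0_integral_distribution V mgE gE0).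
  - exact: mUV.
have fin (Z : {RV P >-> R}) (k : R -> R) : measurable_fun setT k ->
    (forall x, 0 <= k x <= M) -> (\int[P]_w (k (Z w))%:E)%E \is a fin_num.
  move=> mk kM; apply: integrable_fin_num => //.
  apply: (bounded_measurable_integrable (f := fun w => k (Z w)) (probability_setT P)).
  split; first exact: measurableT_comp.
  by exists M => w; have /andP[k0 ?] := kM (Z w); rewrite ger0_norm.
by rewrite /Rintegral -fineM; [congr fine|exact: fin|exact: fin].
Qed.

End moments.

Section truncation.
Context {R : realType}.

(** Truncation at the dyadic levels is chosen because the increments of the
  truncated value and of its square from one level to the next are controlled by
  the indicator of a single tail event, so that all moments are geometric sums of
  tail probabilities. *)
Definition truncated (l : nat) (x : R) : R := Num.min (Num.max x 1) (2 ^+ l).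

Lemma pow2_ge1 l : 1 <= 2 ^+ l :> R.
Proof. by rewrite exprn_ege1// ler1n. Qed.

Lemma truncated_bounds l x : 1 <= truncated l x <= 2 ^+ l.
Proof.
rewrite /truncated ge_min lexx orbT andbT le_min le_max lexx orbT/=.
exact: pow2_ge1.
Qed.

Lemma truncated0 x : truncated 0 x = 1.
Proof. by rewrite /truncated expr0; apply/min_idPr; rewrite le_max lexx orbT. Qed.

Lemma truncated_id l x : 1 <= x -> x < 2 ^+ l -> truncated l x = x.
Proof. by move=> x1 xl; rewrite /truncated max_l// min_l// ltW. Qed.

Lemma truncated_step l x :
  0 <= truncated l.+1 x - truncated l x <= 2 ^+ l * (2 ^+ l <= x)%R%:R.
Proof.
have p1 := pow2_ge1 l; rewrite /truncated exprS; move: (2 ^+ l) p1 => p p1.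
case: (leP x 1) => x1; case: (leP p x) => xp; rewrite ?mulr1 ?mulr0;
  try (rewrite (@min_l _ _ 1 p)//; rewrite (@min_l _ _ 1 (2 * p)); last lra).
- by apply/andP; split; lra.
- by apply/andP; split; lra.
- by case: (leP x (2 * p)) => ?; apply/andP; split; lra.
- by rewrite (@min_l _ _ x (2 * p)) ?subrr ?lexx//; lra.
Qed.

Lemma truncated_sqr_step l x :
  truncated l.+1 x ^+ 2 - truncated l x ^+ 2 <= 3 * (4 ^+ l * (2 ^+ l <= x)%R%:R).
Proof.
have := truncated_step l x; have := truncated_bounds l x.
have := truncated_bounds l.+1 x; have p1 := pow2_ge1 l.
have -> : (4 : R) ^+ l = 2 ^+ l * 2 ^+ l.
  by rewrite -exprMn; congr (_ ^+ _); ring.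
rewrite exprS; move: (2 ^+ l) p1 (truncated _ _) (truncated _ _) => p p1 a b.
move=> /andP[? ?] /andP[? ?]; case: (leP p x) => _ /=;
  rewrite ?mulr1 ?mulr0 => /andP[? ?]; last by nra.
have -> : b ^+ 2 - a ^+ 2 = (b - a) * (b + a) by ring.
have -> : 3 * (p * p) = p * (3 * p) by ring.
apply: ler_pM; lra.
Qed.

Lemma geometric_sum_le (q : R) N : 0 <= q < 1 -> \sum_(i < N) q ^+ i <= (1 - q)^-1.
Proof.
move=> /andP[q0 q1]; have q10 : 0 < 1 - q by rewrite subr_gt0.
rewrite -[leRHS]mul1r ler_pdivlMr//.
have := subrX1 q N; have := exprn_ge0 N q0 => h1 h2.
have -> : (\sum_(i < N) q ^+ i) * (1 - q) = - (q ^+ N - 1) by rewrite h2; ring.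
lra.
Qed.

Lemma geometric_sum_growing (q : R) N : 1 < q ->
  \sum_(i < N) q ^+ i <= q ^+ N / (q - 1).
Proof.
move=> q1; have q10 : 0 < q - 1 by rewrite subr_gt0.
rewrite ler_pdivlMr// mulrC -subrX1; lra.
Qed.

Lemma measurable_truncated l : measurable_fun setT (truncated l).
Proof.
by apply: measurable_minr => //; apply: measurable_maxr.
Qed.

End truncation.

Section tails.
Context {R : realType} {d : measure_display} {T : measurableType d}.
Variables (P : probability T R) (Y : T -> R) (s : R).
Hypothesis mY : measurable_fun setT Y.
Hypothesis s14 : 1 / 4 < s < 1 / 2.
Hypothesis Ytail : forall l, (P [set w | (2 ^+ l <= Y w)%R] <= (s ^+ l)%:E)%E.
Let P1 : P setT = 1%E. Proof. exact: probability_setT. Qed.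
Let s0 : 0 < s. Proof. case/andP: s14; lra. Qed.
Local Notation Ex f := (\int[P]_w f w)%R.

Lemma truncated_bounded_measurable l : bounded_measurable (fun w => truncated l (Y w)).
Proof.
split; first exact: measurableT_comp (measurable_truncated l) mY.
exists (2 ^+ l) => w; have /andP[h1 h2] := truncated_bounds l (Y w).
by rewrite ger0_norm// (le_trans ler01).
Qed.
Let bt := truncated_bounded_measurable.

Let mev l : measurable [set w | (2 ^+ l <= Y w)%R].
Proof.
rewrite -[X in measurable X]setTI; exact: measurable_fun_ler.
Qed.

Let indic_ev l w : (2 ^+ l <= Y w)%R%:R = \1_[set w | (2 ^+ l <= Y w)%R] w :> R.
Proof.
by rewrite indicE; congr (nat_of_bool _)%:R; apply/idP/idP => [?|/set_mem//]; rewrite inE.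
Qed.

Let Ex_ev l : Ex (fun w => (2 ^+ l <= Y w)%R%:R : R) <= s ^+ l.
Proof.
under eq_Rintegral do rewrite indic_ev.
rewrite (expectation_indic P (mev l)) -lee_fin fineK; first exact: Ytail.
exact: fin_num_measure (mev l).
Qed.

Let b_ev l : bounded_measurable (fun w => (2 ^+ l <= Y w)%R%:R : R).
Proof.
by under eq_fun do rewrite indic_ev; exact: bounded_measurable_indic.
Qed.

Lemma truncated_second_moment : exists2 C : R, 0 < C &
  forall l, Ex (fun w => truncated l (Y w) ^+ 2) <= C * (4 * s) ^+ l.
Proof.
have q1 : 1 < 4 * s by case/andP: s14; lra.
have q10 : 0 < 4 * s - 1 by lra.
exists (1 + 3 / (4 * s - 1)); first by rewrite addr_gt0// divr_gt0.
have H l : Ex (fun w => truncated l (Y w) ^+ 2) <= 1 + 3 * \sum_(i < l) (4 * s) ^+ i.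
  elim: l => [|l IH].
    rewrite big_ord0 mulr0 addr0; under eq_Rintegral do rewrite truncated0 expr1n.
    by rewrite expectation_cst.
  rewrite big_ord_recr/= mulrDr addrA.
  have bl := bounded_measurableM (bt l) (bt l).
  have bl1 := bounded_measurableM (bt l.+1) (bt l.+1).
  apply: (@le_trans _ _ (Ex (fun w => truncated l (Y w) ^+ 2 +
      3 * (4 ^+ l * (2 ^+ l <= Y w)%R%:R)))).
    apply: expectation_le => //.
      by apply: bounded_measurableD => //; do 2!apply: bounded_measurableZ.
    by move=> w; have := truncated_sqr_step l (Y w); lra.
  rewrite expectationD//; last by do 2!apply: bounded_measurableZ.
  rewrite expectationZ//; last exact: bounded_measurableZ.
  rewrite expectationZ//; apply: lerD => //.
  by rewrite ler_pM2l// exprMn ler_pM2l ?exprn_gt0//; exact: Ex_ev.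
move=> l; apply: (le_trans (H l)).
rewrite [leRHS]mulrDl mul1r; apply: lerD; first by rewrite exprn_ege1// ltW.
by rewrite -mulrA [_^-1 * _]mulrC ler_pM2l// geometric_sum_growing.
Qed.

Lemma truncated_mean_increment l N :
  0 <= Ex (fun w => truncated (l + N) (Y w)) - Ex (fun w => truncated l (Y w))
    <= (1 - 2 * s)^-1 * (2 * s) ^+ l.
Proof.
have H : 0 <= Ex (fun w => truncated (l + N) (Y w)) - Ex (fun w => truncated l (Y w))
    <= (2 * s) ^+ l * \sum_(i < N) (2 * s) ^+ i.
  elim: N => [|N IH]; first by rewrite addn0 subrr big_ord0 mulr0 lexx.
  rewrite addnS big_ord_recr/= mulrDr -exprD.
  have stp : 0 <= Ex (fun w => truncated (l + N).+1 (Y w) - truncated (l + N) (Y w))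
      <= (2 * s) ^+ (l + N).
    apply/andP; split.
      rewrite -[leLHS](expectation_cst P1); apply: expectation_le => //.
      - exact: bounded_measurable_cst.
      - exact: bounded_measurableB.
      - by move=> w; have /andP[] := truncated_step (l + N) (Y w).
    apply: (@le_trans _ _ (Ex (fun w => 2 ^+ (l + N) * (2 ^+ (l + N) <= Y w)%R%:R))).
      apply: expectation_le => //.
      - exact: bounded_measurableB.
      - exact: bounded_measurableZ.
      - by move=> w; have /andP[] := truncated_step (l + N) (Y w).
    by rewrite expectationZ// exprMn ler_pM2l ?exprn_gt0//; exact: Ex_ev.
  move: stp; rewrite expectationB// => /andP[? ?]; case/andP: IH => ? ?.
  by apply/andP; split; lra.
have q1 : 0 <= 2 * s < 1 by case/andP: s14 => ? ?; apply/andP; split; lra.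
case/andP: H => -> H /=; apply: (le_trans H).
by rewrite mulrC ler_wpM2r ?geometric_sum_le// exprn_ge0//; case/andP: q1.
Qed.

Lemma truncated_mean_bias : {ae P, forall w, 1 <= Y w} ->
  exists2 C : R, 0 < C & forall l,
    `|fine (\int[P]_w (Y w)%:E)%E - Ex (fun w => truncated l (Y w))| <= C * (2 * s) ^+ l.
Proof.
move=> Y1; have s2 : 0 < 1 - 2 * s by case/andP: s14; lra.
exists (1 - 2 * s)^-1; first by rewrite invr_gt0.
pose e l := Ex (fun w => truncated l (Y w)).
suff ec : e @ \oo --> fine (\int[P]_w (Y w)%:E)%E.
  move=> l; rewrite ler_norml; apply/andP; split.
    rewrite lerBrDr; apply: (cvgr_to_ge ec); near=> N.
    have lN : (l <= N)%N by near: N; exact: nbhs_infty_ge.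
    have := truncated_mean_increment l (N - l); rewrite subnKC// => /andP[h _].
    have s20 : 0 <= (1 - 2 * s)^-1 * (2 * s) ^+ l.
      by rewrite mulr_ge0 ?invr_ge0 ?exprn_ge0 ?mulr_ge0// ltW.
    by rewrite /e; lra.
  rewrite lerBlDr; apply: (cvgr_to_le ec); near=> N.
  have lN : (l <= N)%N by near: N; exact: nbhs_infty_ge.
  by have := truncated_mean_increment l (N - l); rewrite subnKC// /e => /andP[_ h]; lra.
have eE l : (\int[P]_w (truncated l (Y w))%:E)%E = (e l)%:E.
  by rewrite /e fineK// integrable_fin_num//; exact: bounded_measurable_integrable.
have maxE : (\int[P]_w (Num.max (Y w) 1)%:E)%E = (\int[P]_w (Y w)%:E)%E.
  apply: ae_eq_integral => //.
  - by apply/measurable_EFinP; exact: measurable_maxr.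
  - exact/measurable_EFinP.
  - by apply: filterS Y1 => w Yw _; rewrite max_l.
have c : (fun l => (e l)%:E) @ \oo --> (\int[P]_w (Y w)%:E)%E.
  rewrite -maxE.
  have := @cvg_monotone_convergence _ _ _ P setT measurableT
    (fun l w => (truncated l (Y w))%:E) _ _ _.
  have -> : (fun l => (\int[P]_w (truncated l (Y w))%:E)%E) = fun l => (e l)%:E.
    exact/funext.
  have -> : (\int[P]_w (limn (fun l => (truncated l (Y w))%:E)))%E =
      (\int[P]_w (Num.max (Y w) 1)%:E)%E.
    apply: eq_integral => w _; apply: cvg_lim => //; apply: cvg_near_cst.
    near=> l; congr EFin; rewrite /truncated min_l//.
    have Nl : ((Num.truncn (Num.max (Y w) 1%R)).+1 <= l)%N.
      by near: l; exact: nbhs_infty_ge.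
    apply: (le_trans (ltW (truncnS_gt _))); rewrite -natrX ler_nat.
    exact: leq_trans Nl (ltnW (ltn_expl _ _)).
  apply.
  - by move=> l; apply/measurable_EFinP; case: (bt l).
  - move=> l w _; rewrite lee_fin; have /andP[h _] := truncated_bounds l (Y w); lra.
  - move=> w _; apply/nondecreasing_seqP => l; rewrite lee_fin.
    by have /andP[h _] := truncated_step l (Y w); lra.
have fin : (\int[P]_w (Y w)%:E)%E \is a fin_num.
  rewrite ge0_fin_numE; last first.
    by rewrite -maxE; apply: integral_ge0 => w _; rewrite lee_fin le_max ler01 orbT.
  apply: (@le_lt_trans _ _ (1 + (1 - 2 * s)^-1)%:E); last exact: ltry.
  rewrite -(cvg_lim _ c)//; apply: lime_le; first exact: cvgP c.
  near=> N; have := truncated_mean_increment 0 N; rewrite add0n expr0 mulr1.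
  have -> : Ex (fun w => truncated 0 (Y w)) = 1.
    by under eq_Rintegral do rewrite truncated0; rewrite expectation_cst.
  by rewrite lee_fin /e => /andP[_ h]; lra.
by rewrite -(fineK fin) in c; exact: (fine_cvg c).
Unshelve. all: by end_near. Qed.

End tails.

Section elementary.
Context {R : realType}.

Lemma arithmetic_geometric_sum_le (q : R) N : 0 <= q < 1 ->
  \sum_(J < N) J.+1%:R * q ^+ J <= (1 - q) ^- 2.
Proof.
move=> /andP[q0 q1]; have q10 : 0 < 1 - q by rewrite subr_gt0.
have q20 : 0 < (1 - q) ^+ 2 by exact: exprn_gt0.
rewrite -[leRHS]mul1r ler_pdivlMr//.
have -> : (\sum_(J < N) J.+1%:R * q ^+ J) * (1 - q) ^+ 2 =
    1 - q ^+ N * (1 + N%:R * (1 - q)).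
  elim: N => [|N IH]; first by rewrite big_ord0 expr0; ring.
  by rewrite big_ord_recr/= [LHS]mulrDl IH (exprS q N) -(natr1 N); ring.
have : 0 <= q ^+ N * (1 + N%:R * (1 - q)).
  by rewrite mulr_ge0 ?exprn_ge0// addr_ge0// mulr_ge0// ltW.
lra.
Qed.

Lemma linear_le_geometric (q : R) J : 1 < q ->
  J.+1%:R <= (1 + (q - 1)^-1) * q ^+ J.
Proof.
move=> q1; have q10 : 0 < q - 1 by rewrite subr_gt0.
have H : 1 + J%:R * (q - 1) <= q ^+ J.
  elim: J => [|J IH]; first by rewrite expr0; lra.
  rewrite exprS; apply: (@le_trans _ _ (q * (1 + J%:R * (q - 1)))); last first.
    by rewrite ler_pM2l//; lra.
  have : 0 <= J%:R * (q - 1) ^+ 2 by rewrite mulr_ge0// sqr_ge0.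
  by rewrite -natr1; nra.
have c0 : 0 < 1 + (q - 1)^-1 by rewrite addr_gt0// invr_gt0.
apply: (@le_trans _ _ ((1 + (q - 1)^-1) * (1 + J%:R * (q - 1)))); last first.
  by rewrite ler_pM2l.
have -> : (1 + (q - 1)^-1) * (1 + J%:R * (q - 1)) =
    J.+1%:R + (q - 1)^-1 + J%:R * (q - 1).
  by rewrite -natr1; field; rewrite gt_eqF.
have : 0 <= J%:R * (q - 1) by rewrite mulr_ge0// ltW.
have : 0 <= (q - 1)^-1 by rewrite invr_ge0 ltW.
lra.
Qed.

Lemma pow2D (x y : R) : 2 `^ (x + y) = 2 `^ x * 2 `^ y :> R.
Proof. by rewrite powRD// pnatr_eq0 implybT. Qed.

Lemma pow2_gt0 (x : R) : 0 < 2 `^ x :> R. Proof. exact: powR_gt0. Qed.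

Lemma pow2_le (x y : R) : x <= y -> 2 `^ x <= 2 `^ y :> R.
Proof. by apply: ler_powR; rewrite ler1n. Qed.

Lemma pow2X (x : R) J : (2 `^ x) ^+ J = 2 `^ (x * J%:R) :> R.
Proof. by rewrite powRrM powR_mulrn// powR_ge0. Qed.

Lemma pow2n J : 2 ^+ J = 2 `^ J%:R :> R.
Proof. by rewrite powR_mulrn. Qed.

Lemma pow2_lt1 (x : R) : x < 0 -> 2 `^ x < 1 :> R.
Proof.
move=> x0; rewrite -[ltRHS](powRr0 (2 : R)).
by rewrite /powR pnatr_eq0/= ltr_expR ltr_pM2r// ln_gt0// ltr1n.
Qed.

Lemma pow2_gt1 (x : R) : 0 < x -> 1 < 2 `^ x :> R.
Proof.
move=> x0; rewrite -[ltLHS](powRr0 (2 : R)).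
by rewrite /powR pnatr_eq0/= ltr_expR ltr_pM2r// ln_gt0// ltr1n.
Qed.

End elementary.

Section law_of_large_numbers.
Context {R : realType} {d : measure_display} {T : measurableType d}.
Variables (P : probability T R) (Y : nat -> {RV P >-> R}) (b : R).
Hypothesis Yindep : forall i j, i != j -> forall A B : set R,
  measurable A -> measurable B ->
  P (Y i @^-1` A `&` Y j @^-1` B) = (P (Y i @^-1` A) * P (Y j @^-1` B))%E.
Hypothesis Yident : forall i (A : set R), measurable A ->
  P (Y i @^-1` A) = P (Y 0%N @^-1` A).
Hypothesis b12 : 1 < b < 2.
Hypothesis Ytail : forall l,
  (P [set w | (2 ^+ l <= Y 0%N w)%R] <= ((2 `^ (- b)) ^+ l)%:E)%E.
Hypothesis Y1 : {ae P, forall w, 1 <= Y 0%N w}.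
Let P1 : P setT = 1%E. Proof. exact: probability_setT. Qed.
Local Notation Ex f := (\int[P]_w f w)%R.
Local Notation s := (2 `^ (- b) : R).
Let m : R := fine (\int[P]_w (Y 0%N w)%:E)%E.

Let s14 : 1 / 4 < s < 1 / 2.
Proof.
have [b1 b2] := andP b12; have p2 : 2 `^ 1 = 2 :> R by rewrite powRr1.
have h1 : 2 `^ (2 - b) * 2 `^ (- 1) * 2 `^ (- 1) = s.
  by rewrite -!pow2D; congr (_ `^ _); ring.
have h2 : 2 `^ (1 - b) * 2 `^ (- 1) = s by rewrite -!pow2D; congr (_ `^ _); ring.
have hi : 2 `^ (-1) = 1 / 2 :> R by rewrite powR_inv1// div1r.
have g1 : 1 < 2 `^ (2 - b) :> R by apply: pow2_gt1; lra.
have g2 : 2 `^ (1 - b) < 1 :> R by apply: pow2_lt1; lra.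
by rewrite hi in h1 h2; apply/andP; split; lra.
Qed.

Let bt l i : bounded_measurable (fun w => truncated l (Y i w)).
Proof. exact: truncated_bounded_measurable. Qed.

Let tail_event l i : measurable [set w | (2 ^+ l <= Y i w)%R].
Proof. by rewrite -[X in measurable X]setTI; exact: measurable_fun_ler. Qed.

Let identical_expectation (f : R -> R) (M : R) i : measurable_fun setT f ->
  (forall x, 0 <= f x <= M) -> Ex (fun w => f (Y i w)) = Ex (fun w => f (Y 0%N w)).
Proof.
move=> mf fM; congr fine.
have mfE : measurable_fun setT (EFin \o f) by exact/measurable_EFinP.
have push j : (\int[P]_w (f (Y j w))%:E = \int[pushforward P (Y j)]_y (f y)%:E)%E.
  rewrite (ge0_integral_pushforward (measurable_funPT (Y j)))//.
  by move=> y _; rewrite lee_fin; case/andP: (fM y).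
rewrite !push; apply: eq_measure_integral => A mA _; exact: Yident.
Qed.

Let e l := Ex (fun w => truncated l (Y 0%N w)).
Let D l i w := truncated l (Y i w) - e l.

Let bD l i : bounded_measurable (D l i).
Proof. by apply: bounded_measurableB => //; exact: bounded_measurable_cst. Qed.

Let trunc_range l (x : R) : 0 <= truncated l x <= 2 ^+ l.
Proof. by have /andP[h ->] := truncated_bounds l x; rewrite (le_trans ler01). Qed.

Let ExT l i : Ex (fun w => truncated l (Y i w)) = e l.
Proof. exact: identical_expectation (measurable_truncated l) (trunc_range l). Qed.

Let uncorrelated l i j : i != j -> Ex (fun w => D l i w * D l j w) = 0.
Proof.
move=> ij.
have -> : (fun w => D l i w * D l j w) = fun w =>
    truncated l (Y i w) * truncated l (Y j w)
    - e l * (truncated l (Y i w) + D l j w).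
  by apply/funext => w; rewrite /D; ring.
rewrite expectationB//; last 2 first.
- exact: bounded_measurableM.
- by apply: bounded_measurableZ; exact: bounded_measurableD.
rewrite expectationZ//; last exact: bounded_measurableD.
rewrite expectationD// expectationB//; last exact: bounded_measurable_cst.
rewrite expectation_cst// !ExT subrr addr0.
rewrite (independent_expectation (Yindep ij) (measurable_truncated l)
  (measurable_truncated l) (trunc_range l) (trunc_range l)).
by rewrite !ExT subrr.
Qed.

Let centered_second_moment l i :
  Ex (fun w => D l i w ^+ 2) <= Ex (fun w => truncated l (Y 0%N w) ^+ 2).
Proof.
have -> : Ex (fun w => truncated l (Y 0%N w) ^+ 2) =
    Ex (fun w => truncated l (Y i w) ^+ 2).
  apply/esym/(@identical_expectation (fun x => truncated l x ^+ 2) ((2 ^+ l) ^+ 2)).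
    exact: measurable_funX (measurable_truncated l).
  move=> x; rewrite sqr_ge0/=; have /andP[h0 h1] := trunc_range l x.
  by rewrite ler_pXn2r ?nnegrE// exprn_ge0.
have bsq := bounded_measurableM (bt l i) (bt l i).
have -> : (fun w => D l i w ^+ 2) = fun w => truncated l (Y i w) * truncated l (Y i w)
    - (2 * e l * truncated l (Y i w) - e l ^+ 2).
  by apply/funext => w; rewrite /D; ring.
have bc := @bounded_measurable_cst R _ T (e l ^+ 2).
rewrite expectationB//; last by apply: bounded_measurableB => //; exact: bounded_measurableZ.
rewrite expectationB//; last exact: bounded_measurableZ.
rewrite expectationZ// ExT expectation_cst//.
by rewrite lerBlDr lerDl; have := sqr_ge0 (e l); nra.
Qed.

Variables (k1 k2 : R).
Hypothesis k12 : 0 < k1 < k2.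
Hypothesis k2b : k2 < 1 - b^-1.

(** The truncation level at scale [2 ^ J] balances the probability that one of the
  variables is truncated against the variance of the truncated ones. *)
Let c : R := (1 - 2 * k2) / (2 - b).
Let level (J : nat) : nat := (Num.truncn (c * J%:R)).+1.

Let b0 : 0 < b. Proof. by case/andP: b12 => h _; rewrite (lt_trans ltr01). Qed.

Let cb : b^-1 < c.
Proof.
have [b1 b2] := andP b12; have h : 0 < 2 - b by lra.
rewrite /c ltr_pdivlMr//.
have -> : b^-1 * (2 - b) = 2 * b^-1 - 1 by field; rewrite gt_eqF.
move: k2b; move: b^-1 => z; lra.
Qed.

Let c0 : 0 < c. Proof. by rewrite (lt_trans _ cb)// invr_gt0. Qed.

Let level_bounds J : c * J%:R <= (level J)%:R <= c * J%:R + 1.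
Proof.
have cJ : 0 <= c * J%:R by rewrite mulr_ge0// ltW.
apply/andP; split; first exact/ltW/truncnS_gt.
rewrite -natr1 lerD2r; have /andP[h _] := truncn_itv cJ; exact: h.
Qed.

Let tail_level J : s ^+ level J <= 2 `^ (- (b * c) * J%:R).
Proof.
rewrite pow2X; apply: pow2_le; have /andP[h _] := level_bounds J.
by rewrite !mulNr lerN2 -mulrA ler_pM2l.
Qed.

Let variance_level J : (4 * s) ^+ level J <= 4 * 2 `^ ((1 - 2 * k2) * J%:R).
Proof.
have [b1 b2] := andP b12.
have -> : 4 * s = 2 `^ (2 - b).
  by rewrite pow2D powR_mulrn//; congr (_ * _); ring.
rewrite pow2X; apply: (@le_trans _ _ (2 `^ (2 + (1 - 2 * k2) * J%:R))); last first.
  rewrite pow2D powR_mulrn//; have -> : (4 : R) = 2 ^+ 2 by ring.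
  exact: lexx.
apply: pow2_le; have /andP[_ h] := level_bounds J.
have h2 : 0 < 2 - b by lra.
apply: (@le_trans _ _ ((2 - b) * (c * J%:R + 1))); first by rewrite ler_pM2l.
rewrite mulrDr mulr1 mulrA.
have -> : (2 - b) * c = 1 - 2 * k2 by rewrite /c; field; rewrite gt_eqF.
by rewrite addrC lerD2r; lra.
Qed.

Let bias_level J : (2 * s) ^+ level J <= 2 `^ (- k1 * J%:R).
Proof.
have [b1 b2] := andP b12; have [k10 k1k2] := andP k12.
have -> : 2 * s = 2 `^ (1 - b) by rewrite pow2D powRr1.
rewrite pow2X; apply: pow2_le; have /andP[h _] := level_bounds J.
apply: (@le_trans _ _ ((1 - b) * (c * J%:R))).
  by rewrite ler_nM2l//; lra.
rewrite mulrA ler_wpM2r//.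
have : (1 - b) * c <= (1 - b) * b^-1 by rewrite ler_nM2l ?(ltW cb)//; lra.
have -> : (1 - b) * b^-1 = b^-1 - 1 by field; rewrite gt_eqF.
move: k2b k1k2; move: b^-1 ((1 - b) * c) => z y; lra.
Qed.

Let thr J : R := 2 `^ ((1 - k1) * J%:R).
Let block J l i w := \sum_(j < 2 ^ l) D (level J) (i * 2 ^ l + j)%N w.

Let bblock J l i : bounded_measurable (block J l i).
Proof.
exact: (bounded_measurable_sum _ (F := fun j => D (level J) (i * 2 ^ l + j)%N)).
Qed.

Let large_value J := \big[setU/set0]_(i < 2 ^ J)
  [set w | (2 ^+ level J <= Y i w)%R].
Let large_block J := \big[setU/set0]_(l < J.+1) \big[setU/set0]_(i < 2 ^ (J - l))
  [set w | (thr J < `|block J l i w|)%R].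
Let bad J := large_value J `|` large_block J.

Let mblock J l i : measurable [set w | (thr J < `|block J l i w|)%R].
Proof.
rewrite -[X in measurable X]setTI; apply: measurable_fun_ltr => //.
by apply: measurableT_comp => //; case: (bblock J l i).
Qed.

Let mbad J : measurable (bad J).
Proof.
apply: measurableU; apply: bigsetU_measurable => i _ //.
by apply: bigsetU_measurable => j _.
Qed.

Let tail_i l i : (P [set w | (2 ^+ l <= Y i w)%R] <= (s ^+ l)%:E)%E.
Proof.
apply: le_trans (Ytail l); rewrite le_eqVlt; apply/orP; left; apply/eqP.
have mA : measurable [set x : R | 2 ^+ l <= x].
  by rewrite -[X in measurable X]setTI; exact: measurable_fun_ler.
exact: Yident mA.
Qed.

(** The two contributions decrease geometrically: some variable is truncated with
  probability at most [2 `^ ((1 - b * c) * J)], where [b * c] exceeds [1], and in Chebyshev's inequality the blocks of each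
  length contribute the same amount, whence the factor [J.+1]. *)
Let bad_small : exists C q : R, [/\ 0 < C, 0 <= q < 1 &
  forall J, (P (bad J) <= (C * (J.+1%:R * q ^+ J))%:E)%E].
Proof.
have [V V0 HV] := truncated_second_moment (measurable_funPT (Y 0%N)) s14 Ytail.
have [k10 k1k2] := andP k12.
pose q1 : R := 2 `^ (1 - b * c); pose q2 : R := 2 `^ (- (2 * (k2 - k1))).
have q10 : 0 < q1 by exact: pow2_gt0.
have q20 : 0 < q2 by exact: pow2_gt0.
have bc : 1 < b * c by rewrite mulrC -ltr_pdivrMr// div1r.
have q11 : q1 < 1 by apply: pow2_lt1; lra.
have q21 : q2 < 1 by apply: pow2_lt1; lra.
exists (1 + 4 * V), (Num.max q1 q2); split.
- by rewrite addr_gt0// mulr_gt0.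
- by rewrite le_max (ltW q10)/= gt_max q11.
move=> J; pose q := Num.max q1 q2.
have q1J : q1 ^+ J <= q ^+ J.
  by rewrite lerXn2r ?nnegrE ?le_max ?lexx// ltW.
have q2J : q2 ^+ J <= q ^+ J.
  by rewrite lerXn2r ?nnegrE ?le_max ?lexx ?orbT// ?(ltW q10)// ltW.
have large1 : (P (large_value J) <= (q1 ^+ J)%:E)%E.
  apply: (le_trans (@Boole_inequality _ _ _ P
    (fun i => [set w | (2 ^+ level J <= Y i w)%R]) (2 ^ J) _)).
    by move=> i _; exact: tail_event.
  apply: (@le_trans _ _ (\sum_(i < 2 ^ J) (s ^+ level J)%:E)%E).
    by apply: lee_sum => i _; exact: tail_i.
  rewrite sumEFin lee_fin sumr_const card_ord -[_ *+ (2 ^ J)]mulr_natr natrX mulrC.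
  apply: (@le_trans _ _ (2 ^+ J * 2 `^ (- (b * c) * J%:R))).
    by rewrite ler_pM2l ?exprn_gt0.
  rewrite pow2n -pow2D pow2X; apply: pow2_le; rewrite mulrDl mul1r; exact: lexx.
have blockP l i : (l <= J)%N ->
    (P [set w | (thr J < `|block J l i w|)%R] <= (2 ^+ l * (4 * V * q2 ^+ J) * 2 ^- J)%:E)%E.
  move=> lJ; apply: (le_trans (@chebyshev_bounded _ _ _ P _ (thr J) (bblock J l i)
    (pow2_gt0 _))).
  rewrite lee_fin; apply: (@le_trans _ _
    (2 ^+ l * (V * (4 * 2 `^ ((1 - 2 * k2) * J%:R))) / thr J ^+ 2)).
    rewrite ler_pM2r ?invr_gt0 ?exprn_gt0 ?pow2_gt0//.
    apply: (le_trans (second_moment_sum (v := V * (4 * s) ^+ level J) _ _ _ _ _)).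
    - by move=> i'; exact: bD.
    - by move=> i' j'; exact: uncorrelated.
    - by move=> i'; exact: le_trans (centered_second_moment _ _) (HV _).
    - by rewrite natrX ler_pM2l ?exprn_gt0// ler_pM2l// variance_level.
  have -> : thr J ^+ 2 = 2 `^ ((2 - 2 * k1) * J%:R).
    by rewrite pow2X; congr (_ `^ _); ring.
  have -> : q2 ^+ J = 2 `^ (J%:R + (1 - 2 * k2) * J%:R - (2 - 2 * k1) * J%:R).
    by rewrite pow2X; congr (_ `^ _); ring.
  rewrite -powRN -!mulrA !mulrA.
  rewrite !pow2D -pow2n; set x := 2 `^ ((1 - _) * _); set y := 2 `^ (- _).
  rewrite le_eqVlt; apply/orP; left; apply/eqP.
  by field; rewrite expf_neq0// pnatr_eq0.
have large2 : (P (large_block J) <= (J.+1%:R * (4 * V * q2 ^+ J))%:E)%E.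
  apply: (le_trans (@Boole_inequality _ _ _ P (fun l => \big[setU/set0]_(i < 2 ^ (J - l))
    [set w | (thr J < `|block J l i w|)%R]) J.+1 _)).
    by move=> l _; apply: bigsetU_measurable => i _.
  apply: (@le_trans _ _ (\sum_(l < J.+1) (4 * V * q2 ^+ J)%:E)%E); last first.
    by rewrite sumEFin lee_fin sumr_const card_ord [leRHS]mulr_natl.
  apply: lee_sum => l _; have lJ : (l <= J)%N by rewrite -ltnS.
  apply: (le_trans (@Boole_inequality _ _ _ P
    (fun i => [set w | (thr J < `|block J l i w|)%R]) (2 ^ (J - l)) _)) => //.
  apply: (@le_trans _ _
    (\sum_(i < 2 ^ (J - l)) (2 ^+ l * (4 * V * q2 ^+ J) * 2 ^- J)%:E)%E).
    by apply: lee_sum => i _; exact: blockP.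
  rewrite sumEFin lee_fin sumr_const card_ord -[_ *+ (2 ^ (J - l))]mulr_natr natrX.
  have -> : 2 ^+ J = 2 ^+ (J - l) * 2 ^+ l :> R by rewrite -exprD subnK.
  rewrite le_eqVlt; apply/orP; left; apply/eqP.
  by field; rewrite !expf_neq0// pnatr_eq0.
have mv : measurable (large_value J) by exact: bigsetU_measurable.
have mb : measurable (large_block J).
  by apply: bigsetU_measurable => l _; apply: bigsetU_measurable.
apply: (le_trans (measureU2 P mv mb)).
apply: (le_trans (leeD large1 large2)); rewrite -EFinD lee_fin [leRHS]mulrDl mul1r.
apply: lerD.
  by apply: (le_trans q1J); rewrite ler_peMl ?exprn_ge0 ?le_max ?(ltW q10)// ler1n.
have V4 : 0 < 4 * V by rewrite mulr_gt0.
by rewrite mulrCA (ler_pM2l V4) ler_pM2l.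
Qed.

Let good_bound : exists2 C : R, 0 < C & forall J w,
  ~ bad J w -> (forall i, 1 <= Y i w) -> forall k, (k <= 2 ^ J)%N ->
  `|\sum_(i < k) (Y i w - m)| <= C * (J.+1%:R * thr J).
Proof.
have [B B0 HB] := truncated_mean_bias (measurable_funPT (Y 0%N)) s14 Ytail Y1.
exists (1 + B); first by rewrite addr_gt0.
move=> J w nbad Yw k kJ; have thr0 : 0 < thr J by exact: pow2_gt0.
have small i : (i < 2 ^ J)%N -> Y i w < 2 ^+ level J.
  move=> iJ; rewrite ltNge; apply/negP => h; apply: nbad; left.
  rewrite /large_value -(bigcup_mkord _ (fun i => [set w | 2 ^+ level J <= Y i w])).
  by exists i.
have blocks l i : (l <= J)%N -> (i < 2 ^ (J - l))%N -> `|block J l i w| <= thr J.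
  move=> lJ iJ; rewrite leNgt; apply/negP => h; apply: nbad; right.
  rewrite /large_block -(bigcup_mkord J.+1 (fun l => \big[setU/set0]_(i < 2 ^ (J - l))
    [set w | (thr J < `|block J l i w|)%R])).
  exists l => //.
  rewrite -(bigcup_mkord _ (fun i => [set w | (thr J < `|block J l i w|)%R])).
  by exists i.
have chain := dyadic_chaining (s := fun i => D (level J) i w) blocks kJ.
have -> : \sum_(i < k) (Y i w - m) =
    \sum_(i < k) D (level J) i w - k%:R * (m - e (level J)).
  rewrite mulr_natl -[X in _ *+ X](card_ord k) -sumr_const -sumrB.
  apply: eq_bigr => i _; rewrite /D truncated_id//; first by ring.
  by apply: small; exact: leq_trans (ltn_ord i) kJ.
apply: (le_trans (ler_normB _ _)); rewrite mulrDl mul1r; apply: lerD => //.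
rewrite normrM ger0_norm//; apply: (@le_trans _ _ (2 ^+ J * (B * 2 `^ (- k1 * J%:R)))).
  apply: ler_pM => //; first by rewrite -natrX ler_nat.
  by apply: (le_trans (HB _)); rewrite ler_pM2l.
have -> : 2 ^+ J * (B * 2 `^ (- k1 * J%:R)) = B * thr J.
  by rewrite mulrCA pow2n -pow2D; congr (_ * _ `^ _); ring.
by rewrite ler_pM2l// ler_peMl ?ler1n// ltW.
Qed.

(** Rate in the law of large numbers: by Borel-Cantelli the bad event occurs at
  finitely many scales only. *)
Theorem partial_sum_rate (k0 : R) : 0 < k0 < k1 ->
  (forall i, {ae P, forall w, 1 <= Y i w}) ->
  {ae P, forall w, exists2 C : R, 0 < C &
    forall k : nat, `|\sum_(i < k) (Y i w - m)| <= C * k%:R `^ (1 - k0)}.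
Proof.
move=> /andP[k00 k01] Yi; have [k10 k1k2] := andP k12.
have [C [q [C0 q01 badP]]] := bad_small.
have [G G0 HG] := good_bound.
have lim0 : P (lim_sup_set bad) = 0%E.
  apply: lim_sup_set_cvg0 => //.
  apply: (@le_lt_trans _ _ (C * (1 - q) ^- 2)%:E); last exact: ltry.
  apply: lime_le; first by apply: is_cvg_nneseries.
  near=> N; apply: (@le_trans _ _ (\sum_(J < N) (C * (J.+1%:R * q ^+ J))%:E)%E).
    by rewrite big_mkord; apply: lee_sum => J _; exact: badP.
  by rewrite sumEFin lee_fin -big_distrr/= ler_pM2l// arithmetic_geometric_sum_le.
have aebad : {ae P, forall w, ~ lim_sup_set bad w}.
  exists (lim_sup_set bad); split => //; last by move=> w /= /contrapT.
  by apply: bigcap_measurable => // i _; apply: bigcup_measurable.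
have aeY : {ae P, forall w, forall i, 1 <= Y i w} by exact: ae_foralln.
apply: filterS2 aebad aeY => w nbad Yw.
have [J0 HJ0] : exists J0, forall J, (J0 <= J)%N -> ~ bad J w.
  apply: contrapT => /forallNP H; apply: nbad => J _.
  have := H J => /existsNP[J' /not_implyP[JJ' /contrapT bJ']].
  by exists J'.
pose A := 1 + (2 `^ (k1 - k0) - 1)^-1 : R.
have g1 : 1 < 2 `^ (k1 - k0) :> R by apply: pow2_gt1; lra.
have A0 : 0 < A by rewrite addr_gt0// invr_gt0; lra.
have thrB J : J.+1%:R * thr J <= A * 2 `^ ((1 - k0) * J%:R).
  have := linear_le_geometric J g1; rewrite -/A pow2X => h.
  apply: (@le_trans _ _ (A * 2 `^ ((k1 - k0) * J%:R) * thr J)).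
    by rewrite ler_pM2r ?pow2_gt0.
  have -> : (1 - k0) * J%:R = (k1 - k0) * J%:R + (1 - k1) * J%:R by ring.
  by rewrite pow2D mulrA.
pose S k : R := `|\sum_(i < k) (Y i w - m)|.
pose M : R := \sum_(k < 2 ^ J0) S k.
have M0 : 0 <= M by apply: sumr_ge0 => i _; exact: normr_ge0.
exists (M + G * A * 2); first by rewrite ltr_wpDl// !mulr_gt0.
move=> k; case: (posnP k) => [->|kp].
  rewrite big_ord0 normr0 mulr_ge0 ?powR_ge0// addr_ge0// mulr_ge0//.
  by rewrite mulr_ge0 ?(ltW G0) ?(ltW A0).
have kpow : 1 <= k%:R `^ (1 - k0) :> R.
  rewrite -[leLHS](powRr0 (k%:R : R)); apply: ler_powR; rewrite ?ler1n//.
  have : 1 - b^-1 < 1 by rewrite gtrDl oppr_lt0 invr_gt0.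
  by move: k2b; move: b^-1 => z; lra.
have GA0 : 0 <= G * A * 2 by rewrite !mulr_ge0 ?(ltW G0) ?(ltW A0).
have [kJ|kJ] := ltnP k (2 ^ J0).
  have SM : S k <= M.
    by rewrite /M (bigD1 (Ordinal kJ))//= lerDl; apply: sumr_ge0 => i _; exact: normr_ge0.
  apply: (le_trans SM); apply: (@le_trans _ _ (M * k%:R `^ (1 - k0))).
    by rewrite ler_peMr.
  by rewrite ler_wpM2r ?powR_ge0// lerDl.
pose J := (trunc_log 2 k).+1.
have k1J : (2 ^ trunc_log 2 k <= k)%N by exact: trunc_logP.
have k2J : (k < 2 ^ J)%N by exact: trunc_log_ltn.
have J0J : (J0 <= J)%N.
  have : (2 ^ J0 < 2 ^ J)%N := leq_ltn_trans kJ k2J.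
  by rewrite ltn_exp2l// => /ltnW.
apply: (le_trans (HG J w (HJ0 J J0J) Yw k (ltnW k2J))).
apply: (@le_trans _ _ (G * (A * 2 `^ ((1 - k0) * J%:R)))); first by rewrite ler_pM2l.
have e1 : 0 <= 1 - k0.
  have : 1 - b^-1 < 1 by rewrite gtrDl oppr_lt0 invr_gt0.
  by move: k2b; move: b^-1 => z; lra.
have : 2 `^ ((1 - k0) * J%:R) <= 2 * k%:R `^ (1 - k0).
  rewrite mulrC powRrM powR_mulrn// /J exprS powRM ?exprn_ge0//.
  apply: ler_pM; rewrite ?powR_ge0//.
    by rewrite -[leRHS](@powRr1 R 2)//; apply: pow2_le; lra.
  by apply: ge0_ler_powR; rewrite ?nnegrE ?exprn_ge0// -natrX ler_nat.
move=> h; apply: (@le_trans _ _ (G * (A * (2 * k%:R `^ (1 - k0))))).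
  by rewrite ler_pM2l// ler_pM2l.
by rewrite !mulrA ler_wpM2r ?powR_ge0// lerDr.
Unshelve. all: by end_near. Qed.

End law_of_large_numbers.

Section environment.
Context {R : realType} {d : measure_display} {T : measurableType d}.
Variables (P : probability T R) (tau : int -> {RV P >-> R}) (alpha : R).
Hypothesis alpha1 : 1 < alpha.
Hypothesis env : bouchaud_environment tau alpha.

Lemma trap_independent i j (A B : set R) : i != j -> measurable A -> measurable B ->
  P (tau i @^-1` A `&` tau j @^-1` B) = (P (tau i @^-1` A) * P (tau j @^-1` B))%E.
Proof.
move=> ij mA mB; have [ind _ _] := env.
have := ind [fset i; j]%fset (fun k => if k == i then A else B).
have iE : (i == i) = true by rewrite eqxx.
have jE : (j == i) = false by rewrite eq_sym (negbTE ij).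
rewrite big_fsetU1 ?inE//= big_seq_fset1 iE jE => <-; last by move=> k; case: ifP.
congr (P _); apply/seteqP; split => w /=.
  by move=> [wA wB] k /=; rewrite !inE => /orP[]/eqP ->; rewrite ?iE ?jE.
move=> H; split; first by have := H i; rewrite iE; apply; rewrite /= !inE eqxx.
by have := H j; rewrite jE; apply; rewrite /= !inE eqxx orbT.
Qed.

Lemma trap_identical i j (A : set R) : measurable A ->
  P (tau i @^-1` A) = P (tau j @^-1` A).
Proof. by move=> mA; have [_ ident _] := env; exact: ident. Qed.

Lemma trap_tail k (u : R) : 1 < u -> P [set w | u <= tau k w] = (u `^ (- alpha))%:E.
Proof.
move=> u1; have [_ _ <-//] := env.
have mA : measurable [set x : R | u <= x].
  by rewrite -[X in measurable X]setTI; exact: measurable_fun_ler.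
exact: (trap_identical k 0 mA).
Qed.

(** The tail is continuous at its left end, so no mass sits below [1]. *)
Lemma trap_ge1 : {ae P, forall w, forall k, 1 <= tau k w}.
Proof.
suff H k : {ae P, forall w, 1 <= tau k w}.
  have HP : {ae P, forall w, forall i : nat, 1 <= tau (Posz i) w} by exact: ae_foralln.
  have HN : {ae P, forall w, forall i : nat, 1 <= tau (Negz i) w} by exact: ae_foralln.
  by apply: filterS2 HP HN => w HP HN [] i.
have mlt : measurable [set w | tau k w < 1].
  by rewrite -[X in measurable X]setTI; exact: measurable_fun_ltr.
have mge (u : R) : measurable [set w | u <= tau k w].
  by rewrite -[X in measurable X]setTI; exact: measurable_fun_ler.
exists [set w | tau k w < 1]; split => //; last first.
  by move=> w /= /negP; rewrite -ltNge.
have fin : P [set w | tau k w < 1] \is a fin_num by exact: fin_num_measure.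
rewrite -(fineK fin); congr EFin; set p := fine _.
have p0 : 0 <= p by exact: fine_ge0.
apply/eqP; rewrite eq_le p0 andbT leNgt; apply/negP => pp.
pose u : R := 1 + p / (2 * alpha).
have a0 : 0 < alpha by rewrite (lt_trans ltr01).
have u1 : 1 < u by rewrite ltrDl divr_gt0// mulr_gt0.
have u0 : 0 < u by rewrite (lt_trans ltr01).
have : (P ([set w | (tau k w < 1)%R] `|` [set w | (u <= tau k w)%R]) <= 1)%E.
  by apply: probability_le1; exact: measurableU.
have disj : [set w | tau k w < 1] `&` [set w | u <= tau k w] = set0.
  by apply/seteqP; split => // w /= [w1 w2]; lra.
have U : P ([set w | (tau k w < 1)%R] `|` [set w | (u <= tau k w)%R]) =
    (p + u `^ (- alpha))%:E.
  exact: etrans (measureU P mlt (mge u) disj)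
    (congr2 adde (esym (fineK fin)) (trap_tail k u1)).
rewrite U => H; have {H} : p + u `^ (- alpha) <= 1 by exact: H.
have : 1 - p / 2 <= u `^ (- alpha).
  rewrite /powR gt_eqF//; apply: le_trans (expR_ge1Dx _).
  have : ln u <= p / (2 * alpha).
    rewrite /u; apply: le_ln1Dx.
    have : 0 < p / (2 * alpha) by rewrite divr_gt0// mulr_gt0.
    lra.
  move=> h; have : alpha * ln u <= alpha * (p / (2 * alpha)) by rewrite ler_pM2l.
  have -> : alpha * (p / (2 * alpha)) = p / 2 by field; rewrite gt_eqF.
  lra.
lra.
Qed.

Lemma trap_sum_rate (g : nat -> int) (k0 : R) : injective g ->
  0 < k0 < Num.min (1 - alpha^-1) (1 / 2) ->
  {ae P, forall w, exists2 C : R, 0 < C & forall k : nat,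
    `|\sum_(i < k) (tau (g i) w - mean_trap tau)| <= C * k%:R `^ (1 - k0)}.
Proof.
move=> gi /andP[k00]; rewrite lt_min => /andP[k0a k02].
have a0 : 0 < alpha by rewrite (lt_trans ltr01).
pose b1 := (1 - k0)^-1.
have k1 : 0 < 1 - k0 by lra.
have b1a : b1 < alpha.
  rewrite /b1 -[ltRHS]invrK ltf_pV2 ?posrE ?invr_gt0//.
  by move: k0a; move: alpha^-1 => z; lra.
have b12 : b1 < 2 by rewrite /b1 -[ltRHS]invrK ltf_pV2 ?posrE//; lra.
have b11 : 1 < b1 by rewrite /b1 invf_gt1//; lra.
pose b := (b1 + Num.min alpha 2) / 2.
have [bb ba b2] : [/\ b1 < b, b < alpha & b < 2].
  rewrite /b; case: (leP alpha 2) => h; split; lra.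
have bk : k0 < 1 - b^-1.
  have : b^-1 < b1^-1 by rewrite ltf_pV2 ?posrE//; lra.
  by rewrite /b1 invrK; move: b^-1 => z; lra.
pose dk := (1 - b^-1 - k0) / 3.
have dk0 : 0 < dk by rewrite /dk divr_gt0// subr_gt0.
have dkE : 3 * dk = 1 - b^-1 - k0 by rewrite /dk; field; rewrite gt_eqF//; lra.
have tail l : (P [set w | (2 ^+ l <= tau (g 0%N) w)%R] <= ((2 `^ (- b)) ^+ l)%:E)%E.
  case: l => [|l].
    rewrite [leRHS](_ : _ = 1%E) ?expr0//; apply: probability_le1.
    by rewrite -[X in measurable X]setTI; exact: measurable_fun_ler.
  have l1 : 1 < 2 ^+ l.+1 :> R by rewrite exprn_egt1// ltr1n.
  rewrite trap_tail// lee_fin pow2X pow2n -powRrM; apply: pow2_le.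
  by rewrite mulrC ler_wpM2r// lerN2 ltW.
have Y1 i : {ae P, forall w, 1 <= tau (g i) w}.
  by apply: filterS trap_ge1 => w; exact.
have meanE : fine (\int[P]_w (tau (g 0%N) w)%:E)%E = mean_trap tau.
  rewrite /mean_trap expectation_def; congr fine.
  have eqmax k : (\int[P]_w (tau k w)%:E)%E = (\int[P]_w (Num.max (tau k w) 1)%:E)%E.
    apply: ae_eq_integral => //.
    - by apply/measurable_EFinP.
    - by apply/measurable_EFinP; exact: measurable_maxr.
    - by apply: filterS trap_ge1 => w /(_ k) tk _; rewrite max_l.
  rewrite !eqmax.
  have push k : (\int[P]_w (Num.max (tau k w) 1)%:E =
      \int[pushforward P (tau k)]_y (Num.max y 1)%:E)%E.
    rewrite (ge0_integral_pushforward (measurable_funPT (tau k)))//.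
      by apply/measurable_EFinP; exact: measurable_maxr.
    by move=> y _; rewrite lee_fin le_max ler01 orbT.
  rewrite !push; apply: eq_measure_integral => A mA _; exact: trap_identical.
rewrite -meanE.
apply: (@partial_sum_rate R d T P (fun i => tau (g i)) b _ _ _ tail (Y1 0%N)
  (k0 + dk) (k0 + 2 * dk)) => //.
- move=> i j ij A B mA mB; apply: trap_independent => //.
  by apply: contraNneq ij => /gi ->.
- by move=> i A mA; exact: trap_identical.
- by rewrite b2 andbT (lt_trans b11).
- by apply/andP; split; lra.
- by move: dkE; move: b^-1 => z; lra.
- by apply/andP; split; lra.
Qed.

End environment.

(** * Homogenization and approximation *)

Section scale.
Context {R : realType}.

Lemma cvg_nat_powRN (a : R) : 0 < a -> (fun n : nat => n%:R `^ (- a)) @ \oo --> (0 : R).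
Proof.
move=> a0; apply/cvgrPdist_le => e e0; near=> n.
have n0 : 0 < n%:R :> R by rewrite ltr0n; near: n; exact: nbhs_infty_gt.
rewrite sub0r normrN ger0_norm ?powR_ge0// powRN.
rewrite -[leRHS]invrK lef_pV2 ?posrE ?powR_gt0 ?invr_gt0//.
have -> : e^-1 = (e^-1 `^ a^-1) `^ a.
  by rewrite -powRrM mulVf ?gt_eqF// powRr1// invr_ge0 ltW.
apply: ge0_ler_powR; rewrite ?nnegrE ?powR_ge0 ?(ltW a0) ?(ltW n0)//.
near: n; exact: nbhs_infty_ger.
Unshelve. all: by end_near. Qed.

Lemma sublinear_power (x y a : R) : 1 <= x -> 1 <= y -> 0 < a < 1 ->
  x `^ (1 - a) <= y `^ (- a) * (y + x).
Proof.
move=> x1 y1 /andP[a0 a1].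
have x0 : 0 < x by rewrite (lt_le_trans ltr01).
have y0 : 0 < y by rewrite (lt_le_trans ltr01).
have sp z : 0 < z -> z `^ (1 - a) = z `^ (- a) * z.
  move=> z0; rewrite addrC powRD ?powRr1 ?(ltW z0)//.
  by apply/implyP => _; rewrite gt_eqF.
rewrite mulrDr; have [xy|yx] := leP x y.
  apply: (@le_trans _ _ (y `^ (1 - a))).
    by apply: ge0_ler_powR; rewrite ?nnegrE ?(ltW x0) ?(ltW y0)//; lra.
  by rewrite sp// lerDl mulr_ge0 ?powR_ge0// ltW.
rewrite (sp x)//; apply: (@le_trans _ _ (y `^ (- a) * x)); last first.
  by rewrite lerDr mulr_ge0 ?powR_ge0// ltW.
rewrite ler_pM2r// !powRN lef_pV2 ?posrE ?powR_gt0//.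
by apply: ge0_ler_powR; rewrite ?nnegrE ?(ltW x0) ?(ltW y0) ?(ltW a0)// ltW.
Qed.

Let succ_Posz (k : nat) : (k : int) + 1 = Posz k.+1. Proof. lia. Qed.
Let succ_Negz (k : nat) : Negz k.+1 + 1 = Negz k. Proof. lia. Qed.

(** Sums of order [k `^ (1 - a)] over [k] sites are at most [n `^ (- a)] times
  [n + k]; the fourth root of this ratio is the scale [eta]. *)
Lemma homogenized_environment (m C a : R) (tau : int -> R) :
  0 < m -> 0 < C -> 0 < a < 1 -> (forall k, 1 <= tau k) ->
  (forall k : nat, `|\sum_(i < k) (tau (Posz i) - m)| <= C * k%:R `^ (1 - a)) ->
  (forall k : nat, `|\sum_(i < k) (tau (Negz i) - m)| <= C * k%:R `^ (1 - a)) ->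
  exists2 A : R, 0 < A &
    \forall n \near \oo, homogenized n m tau (A * n%:R `^ (- (a / 4))).
Proof.
move=> m0 C0 a01 tau1 HP HN; have [a0 a1] := andP a01.
pose A := 1 + 2 * C / m.
have A1 : 1 <= A by rewrite lerDl divr_ge0 ?mulr_ge0// ltW.
have A0 : 0 < A by rewrite (lt_le_trans ltr01).
exists A => //; near=> n.
have n0 : (0 < n)%N by near: n; exact: nbhs_infty_gt.
have n0' : 0 < n%:R :> R by rewrite ltr0n.
have n1 : 1 <= n%:R :> R by rewrite ler1n.
have e4 : (A * n%:R `^ (- (a / 4))) ^+ 4 = A ^+ 4 * n%:R `^ (- a).
  rewrite exprMn; congr (_ * _); rewrite -powR_mulrn ?powR_ge0// -powRrM.
  by congr (_ `^ _); field.
have A4 : A <= A ^+ 4 by rewrite -[leLHS]expr1 ler_weXn2l.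
split => //.
- rewrite mulr_gt0 ?powR_gt0//=.
  near: n; have := cvg_nat_powRN (divr_gt0 a0 (ltr0n R 4)).
  move=> /cvgrPdist_le/(_ A^-1); rewrite invr_gt0 => /(_ A0).
  apply: filterS => n; rewrite sub0r normrN ger0_norm ?powR_ge0// => h.
  by rewrite mulrC -ler_pdivlMr// div1r.
- rewrite e4; apply: (@le_trans _ _ (n%:R `^ (- a))).
    by rewrite -powR_inv1 ?(ltW n0')//; apply: ler_powR => //; lra.
  by rewrite ler_peMl ?powR_ge0// (le_trans A1).
exists (fun k => int_primitive (fun j => tau j / m - 1) (k + 1)).
  by move=> k; rewrite subrK int_primitiveD1.
have bound k : `|int_primitive (fun j => tau j / m - 1) (k + 1)| <=
    C / m * (`|k|%N.+1%:R) `^ (1 - a).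
  have sumE (g : nat -> int) N : \sum_(i < N) (tau (g i) / m - 1) =
      (\sum_(i < N) (tau (g i) - m)) / m.
    by rewrite mulr_suml; apply: eq_bigr => i _; field; rewrite gt_eqF.
  have fin (g : nat -> int) N : `|\sum_(i < N) (tau (g i) - m)| <= C * N%:R `^ (1 - a) ->
      (N <= `|k|.+1)%N -> `|\sum_(i < N) (tau (g i) / m - 1)| <=
        C / m * (`|k|%N.+1%:R) `^ (1 - a).
    move=> h Nk; rewrite sumE normrM (@gtr0_norm _ m^-1) ?invr_gt0//.
    rewrite mulrAC ler_pM2r ?invr_gt0//; apply: (le_trans h).
    rewrite ler_pM2l//; apply: ge0_ler_powR; rewrite ?nnegrE ?ler_nat//; lra.
  case: k fin => [k|[|k]] fin.
  - by rewrite succ_Posz; exact: (fin Posz _ (HP _)).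
  - rewrite (_ : Negz 0 + 1 = Posz 0 :> int)// [int_primitive _ _]/= big_ord0 normr0.
    by rewrite mulr_ge0 ?powR_ge0// divr_ge0 ?(ltW C0) ?(ltW m0).
  - rewrite succ_Negz /= normrN; apply: (fin Negz _ (HN _)); exact: ltnW.
move=> k; apply: (le_trans (bound k)).
apply: (@le_trans _ _ (C / m * (n%:R `^ (- a) * (n%:R + `|k|%N.+1%:R)))).
  rewrite ler_pM2l ?divr_gt0//; apply: sublinear_power => //; exact: ler1n.
rewrite e4 norm_site; set p := n%:R `^ (- a).
have p0 : 0 < p by exact: powR_gt0.
have -> : A ^+ 4 * p * n%:R * (1 + `|k|%N%:R / n%:R) = A ^+ 4 * (p * (n%:R + `|k|%N%:R)).
  by field; rewrite gt_eqF.
have CA : 2 * (C / m) <= A ^+ 4 by apply: le_trans A4; rewrite /A mulrA; lra.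
apply: (@le_trans _ _ (2 * (C / m) * (p * (n%:R + `|k|%N%:R)))); last first.
  by rewrite ler_wpM2r// mulr_ge0 ?(ltW p0)// addr_ge0.
have h : n%:R + `|k|%N.+1%:R <= 2 * (n%:R + `|k|%N%:R) :> R.
  have : 0 <= `|k|%N%:R :> R by [].
  rewrite -natr1; lra.
have cp := mulr_gt0 (divr_gt0 C0 m0) p0.
rewrite mulrA [leRHS](_ : _ = C / m * p * (2 * (n%:R + `|k|%N%:R))); last by ring.
by rewrite ler_pM2l.
Unshelve. all: by end_near. Qed.

End scale.

Section chain_approximation.
Context {R : realType} {d : measure_display} {Om : measurableType d}.
Variables (n : nat) (tau : int -> R).
Variables (P : R.-pker (measurableTypeR R) ~> Om) (X : R -> Om -> R).
Hypothesis n0 : (0 < n)%N.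
Hypothesis tau1 : forall k, 1 <= tau k.
Hypothesis chain : is_trap_chain n tau P X.
Let n0' : 0 < n%:R :> R. Proof. by rewrite ltr0n. Qed.
Let tau0 k : 0 < tau k. Proof. exact: lt_le_trans (tau1 k). Qed.
Local Notation u := (chain_density n tau P X).

Lemma site0 : @site R n 0 = 0. Proof. by rewrite /site mul0r. Qed.

Let far (k : int) (M N : nat) : ((M + `|k|).+1 < N)%N ->
  [/\ (M < `|(k - N%:Z + 1)%R|)%N, (M < `|(k - N%:Z)%R|)%N &
    (0 <= k - N%:Z)%R = false].
Proof. by move=> h; split; lia. Qed.

Let reversed (k : int) (N i : nat) : (i < N)%N ->
  k - (N - i.+1)%N%:Z = k - N%:Z + 1 + i%:Z.
Proof. lia. Qed.

(** The increments of [occupation_cdf] are the probabilities of the sites, and it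
  vanishes at minus infinity because the occupation densities decay. *)
Lemma chain_cdf (k : int) (t : R) : 0 <= t ->
  prob_le P X 0 t (site n k) = occupation_cdf n (u 0) k t.
Proof.
move=> t0; have fu := chain_forward_solution n0 tau1 chain 0.
have c1 := site_cdf_cvg n0 chain (a := 0) (k := k) t0; rewrite site0 in c1.
have sumE N : \sum_(i < N) site_prob n P X 0 (k - i%:Z) t =
    occupation_cdf n (u 0) k t - occupation_cdf n (u 0) (k - N%:Z) t.
  have -> : occupation_cdf n (u 0) k t - occupation_cdf n (u 0) (k - N%:Z) t =
      isum (k - N%:Z + 1) N (fun j => occupation_cdf n (u 0) (j + 1 - 1) t
        - occupation_cdf n (u 0) (j - 1) t).
    by rewrite (isum_telescope _ _ (fun j => occupation_cdf n (u 0) (j - 1) t));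
      congr (occupation_cdf _ _ _ _ - occupation_cdf _ _ _ _); ring.
  rewrite /isum (reindex_inj rev_ord_inj)/=; apply: eq_bigr => i _.
  rewrite (reversed k (ltn_ord i)) addrK (occupation_cdf_step _ n0 tau1 fu t0).
  by rewrite /chain_density ger0_norm//; field; rewrite !gt_eqF.
have c2 : (fun N => \sum_(i < N) site_prob n P X 0 (k - i%:Z) t) @ \oo -->
    occupation_cdf n (u 0) k t.
  apply/cvgrPdist_le => e e0.
  have e2 : 0 < e / (2 * n%:R) by rewrite divr_gt0// mulr_gt0.
  have [M HM] := occupation_decay n0 tau1 fu t0 e2.
  near=> N; have MN : ((M + `|k|).+1 < N)%N by near: N; exact: nbhs_infty_gt.
  have [f1 f2 neg] := far MN; have tt : 0 <= t <= t by rewrite t0 lexx.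
  rewrite sumE opprB addrCA subrr addr0 /occupation_cdf neg addr0.
  have := HM _ t f1 tt; have := HM _ t f2 tt.
  move: (occupation _ (k - _ + 1) t) (occupation _ (k - _) t) => x y yb xb.
  rewrite normrM gtr0_norm//.
  have : `|x - y| <= e / (2 * n%:R) + e / (2 * n%:R).
    by apply: (le_trans (ler_normB _ _)); exact: lerD.
  rewrite -(ler_pM2l n0') => h; apply: (le_trans h).
  rewrite le_eqVlt; apply/orP; left; apply/eqP; field; rewrite gt_eqF//.
exact: cvg_unique c1 c2.
Unshelve. all: by end_near. Qed.

Lemma chain_cdf_floor (x t : R) : 0 <= t ->
  prob_le P X 0 t x = prob_le P X 0 t (site n (Num.floor (n%:R * x))).
Proof.
move=> t0; congr (fine (P 0 _)); apply/seteqP.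
have [[_ XS _ _] _ _] := chain.
have H w : (X t w <= x) = (X t w <= site n (Num.floor (n%:R * x))).
  have [j _ <-] := XS t w t0.
  rewrite /site ler_pM2r ?invr_gt0// ler_int floor_ge_int.
  by rewrite ler_pdivrMr// [x * _]mulrC.
by split => w /=; rewrite H.
Qed.

End chain_approximation.

Section approximation.
Context {R : realType}.

Let site_floor (n : nat) (x : R) : (0 < n)%N ->
  0 <= x - site n (Num.floor (n%:R * x)) <= n%:R^-1.
Proof.
move=> n0; have n0' : 0 < n%:R :> R by rewrite ltr0n.
have /andP[h1 h2] := mem_rg1_floor (n%:R * x).
rewrite /site; apply/andP; split.
  by rewrite subr_ge0 ler_pdivrMr// [x * _]mulrC.
rewrite lerBlDr -(ler_pM2l n0') mulrDr mulrV ?unitfE ?gt_eqF//.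
rewrite mulrCA divff ?gt_eqF// mulr1 addrC; exact: ltW.
Qed.

Let heat_lipschitz (r1 r2 : R) : 0 < r1 <= r2 -> exists2 B : R, 0 < B &
  forall r y z, r1 <= r <= r2 -> `|heat r y - heat r z| <= B * `|y - z| /\
    `|heat_cdf r y - heat_cdf r z| <= B * `|y - z|.
Proof.
move=> /andP[r10 r12]; have [B B0 HB] := heat_bounded r2 r10.
exists B => // r y z rr; have rp : 0 < r by case/andP: rr => h _; exact: lt_le_trans h.
have lip (f df : R -> R) : (forall x : R, is_derive x 1 f (df x)) ->
    (forall x, `|df x| <= B) -> `|f y - f z| <= B * `|y - z|.
  move=> fd dfB; apply: (@mean_value_dist _ f df (Num.min y z) (Num.max y z)) => //;
    by rewrite ge_min le_max lexx ?orbT.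
split.
- apply: (lip (heat r) (heat1 r)) => x; first exact: is_derive_heat_y.
  by have [] := HB r x rr.
- apply: (lip (heat_cdf r) (heat r)) => x; first exact: is_derive_heat_cdf_y.
  by rewrite gtr0_norm ?heat_gt0//; have [] := HB r x rr.
Qed.

Let mesh_le (n : nat) (m eta : R) (tau : int -> R) : homogenized n m tau eta -> n%:R^-1 <= eta.
Proof.
case=> _ /andP[e0 e1] mesh _ _; apply: (le_trans mesh).
by rewrite -[leRHS]expr1 ler_wiXn2l// ltW.
Qed.

Lemma chain_cdf_approximation (m t : R) : 0 < m -> 0 < t ->
  exists2 C : R, 0 < C & forall (n : nat) (tau : int -> R) (eta : R)
    (d : measure_display) (Om : measurableType d)
    (P : R.-pker (measurableTypeR R) ~> Om) (X : R -> Om -> R),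
  homogenized n m tau eta -> is_trap_chain n tau P X ->
  forall x, `|heat_cdf (t / m) x - prob_le P X 0 t x| <= C * eta.
Proof.
move=> m0 t0; have r0 : 0 < t / m by rewrite divr_gt0.
have [C C0 HC] := occupation_cdf_estimate m0 t0.
have [B B0 HB] := heat_lipschitz (r1 := t / m) (r2 := t / m) ltac:(by rewrite r0 lexx).
exists (B + C); first exact: addr_gt0.
move=> n tau eta d Om P X hom chain x; have [n0 _ _ tau1 _] := hom.
have mesh := mesh_le hom; have fl := site_floor x n0.
rewrite (chain_cdf_floor n0 chain x (ltW t0)) (chain_cdf n0 tau1 chain _ (ltW t0)).
set k := Num.floor _ in fl *.
have h1 := HC n tau eta _ hom (chain_forward_solution n0 tau1 chain 0) k.
have [_ h2] := HB (t / m) x (site n k) ltac:(by rewrite lexx).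
have -> : heat_cdf (t / m) x - occupation_cdf n (chain_density n tau P X 0) k t =
  (heat_cdf (t / m) x - heat_cdf (t / m) (site n k))
  - (occupation_cdf n (chain_density n tau P X 0) k t - heat_cdf (t / m) (site n k)) by ring.
apply: (le_trans (ler_normB _ _)); rewrite [leRHS]mulrDl; apply: lerD => //.
apply: (le_trans h2); rewrite ler_pM2l//.
by case/andP: fl => f0 f1; rewrite ger0_norm// (le_trans f1).
Qed.

Lemma chain_density_approximation (m T1 T2 K : R) : 0 < m -> 0 < T1 <= T2 -> 0 < K ->
  exists2 C : R, 0 < C & forall (n : nat) (tau : int -> R) (eta : R)
    (d : measure_display) (Om : measurableType d)
    (P : R.-pker (measurableTypeR R) ~> Om) (X : R -> Om -> R) (p : R -> R -> R -> R),
  homogenized n m tau eta -> is_trap_chain n tau P X ->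
  is_heat_kernel (lattice n) P X (lattice_measure n tau) p ->
  forall x t, `|x| <= K -> T1 <= t <= T2 ->
    `|heat (t / m) x / m - p t 0 (site n (Num.floor (n%:R * x)))| <= C * eta.
Proof.
move=> m0 T12 K0; have K1 : 0 <= K + 1 by rewrite addr_ge0// ltW.
have [T10 _] := andP T12.
have [C C0 HC] := density_estimate m0 T12 K1.
have [B B0 HB] : exists2 B : R, 0 < B & forall r y z, T1 / m <= r <= T2 / m ->
    `|heat r y - heat r z| <= B * `|y - z| /\
    `|heat_cdf r y - heat_cdf r z| <= B * `|y - z|.
  apply: heat_lipschitz; rewrite divr_gt0//= ler_pM2r ?invr_gt0//.
  by case/andP: T12.
exists (B / m + C); first by rewrite addr_gt0// divr_gt0.
move=> n tau eta d Om P X p hom chain hp x t xK tT; have [n0 /andP[e0 e1] _ tau1 _] := hom.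
have [t1 t2] := andP tT; have t0 : 0 < t := lt_le_trans T10 t1.
have mesh := mesh_le hom; have fl := site_floor x n0.
set k := Num.floor _ in fl *.
have pE := heat_kernel_chain_density n0 tau1 chain 0 k hp t0; rewrite site0 in pE.
rewrite pE.
have xk : `|x - site n k| <= eta.
  by case/andP: fl => f0 f1; rewrite ger0_norm// (le_trans f1).
have kK : `|@site R n k| <= K + 1.
  have -> : site n k = x - (x - site n k) by ring.
  by apply: (le_trans (ler_normB _ _)); apply: lerD => //; exact: le_trans e1.
have h1 := HC n tau eta 0 k _ _ hom ltac:(by rewrite site0 normr0) kK
  (chain_forward_solution n0 tau1 chain 0) (chain_forward_solution n0 tau1 chain k) t tT.
rewrite subr0 in h1.
have [h2 _] := HB (t / m) x (site n k) ltac:(by rewrite !ler_pM2r ?invr_gt0// t1).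
set v := chain_density _ _ _ _ _ _ _ in h1 *.
have -> : heat (t / m) x / m - v = (heat (t / m) x - heat (t / m) (site n k)) / m
  - (v - heat (t / m) (site n k) / m) by ring.
apply: (le_trans (ler_normB _ _)); rewrite [leRHS]mulrDl; apply: lerD => //.
rewrite normrM (@gtr0_norm _ m^-1) ?invr_gt0// mulrAC ler_pM2r ?invr_gt0//.
by apply: (le_trans h2); rewrite ler_pM2l.
Qed.

End approximation.

(** * The convergence theorem *)

(** The law of large numbers transfers the lower bound on the traps to their mean. *)
Lemma mean_ge1 (R : realType) (m C a : R) (x : nat -> R) : 0 < a -> 0 < C ->
  (forall i, 1 <= x i) ->
  (forall k : nat, `|\sum_(i < k) (x i - m)| <= C * k%:R `^ (1 - a)) -> 1 <= m.
Proof.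
move=> a0 C0 x1 H; rewrite -subr_le0.
have c0 : (fun k : nat => C * k%:R `^ (- a)) @ \oo --> (0 : R).
  rewrite -[X in _ --> X](mulr0 C); apply: cvgMr; exact: cvg_nat_powRN.
apply: (cvgr_to_ge c0); near=> k.
have k0 : (0 < k)%N by near: k; exact: nbhs_infty_gt.
have k0' : 0 < k%:R :> R by rewrite ltr0n.
rewrite -(ler_pM2r k0') -mulrA.
have -> : k%:R `^ (- a) * k%:R = k%:R `^ (1 - a).
  rewrite addrC powRD ?powRr1 ?(ltW k0')//.
  by apply/implyP => _; rewrite gt_eqF.
apply: le_trans (H k); apply: le_trans (ler_norm _).
apply: (@le_trans _ _ (\sum_(i < k) (1 - m))).
  by rewrite sumr_const card_ord mulr_natr.
by apply: ler_sum => i _; rewrite lerD2r.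
Unshelve. all: by end_near. Qed.

Theorem theorem8p14 (R : realType) (d : measure_display) (T : measurableType d)
  (P : probability T R) (tau : int -> {RV P >-> R}) (alpha : R)
  (halpha : 1 < alpha) (henv : bouchaud_environment tau alpha)
  (dX : measure_display) (OmX : measurableType dX)
  (PX : R.-pker (measurableTypeR R) ~> OmX) (X : R -> OmX -> R)
  (p : R -> R -> R -> R)
  (hX : is_diffusion (mean_trap tau) PX X)
  (hp : is_heat_kernel setT PX X (scaled_lebesgue (mean_trap tau)) p)
  (E K T1 T2 t : R)
  (hE0 : 0 < E) (hE : E < 2 / 11 * Num.min (1 - alpha^-1) (1 / 2))
  (hK : 0 < K) (hT1 : 0 < T1) (hT12 : T1 < T2) (ht : 0 < t) :
  {ae P, forall w : T,
    forall (dn : nat -> measure_display) (Om : forall n, measurableType (dn n))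
      (Pn : forall n, R.-pker (measurableTypeR R) ~> Om n)
      (Xn : forall n, R -> Om n -> R) (pn : nat -> R -> R -> R -> R),
    (forall n, (0 < n)%N ->
       is_trap_chain n (fun k => tau k w) (Pn n) (Xn n) /\
       is_heat_kernel (lattice n) (Pn n) (Xn n)
         (lattice_measure n (fun k => tau k w)) (pn n)) ->
    ((fun n : nat =>
        sup [set `|prob_le PX X 0 t x - prob_le (Pn n) (Xn n) 0 t x|
            | x in [set: R]])
       =O_\oo (fun n : nat => n%:R `^ (- E))) /\
    (fun n : nat =>
       (n%:R `^ (2 / 3 * E))%:E *
       ereal_sup
         [set (`|p z.2 0 z.1
                 - pn n z.2 0 ((Num.floor (n%:R * z.1))%:~R / n%:R)|)%:E
         | z in [set z : R * R | (`|z.1| <= K /\ T1 <= z.2 <= T2)%R]])%E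
      @ \oo --> (0 : \bar R)}.
Proof.
have alpha0 : 0 < alpha by rewrite (lt_trans ltr01).
pose k0 := Num.min (1 - alpha^-1) (1 / 2).
have k02 : k0 <= 1 / 2 by rewrite ge_min lexx orbT.
(* Any exponent between [4 * E] and [11 / 2 * E] would do: [n `^ (- (a / 4))] is to be
   smaller than [n `^ (- E)], and [a] smaller than [k0]. *)
pose a := 5 * E.
have a0 : 0 < a by rewrite mulr_gt0.
have ak : 0 < a < k0 by rewrite a0 /a; move: hE; rewrite -/k0 => hE'; lra.
have a1 : 0 < a < 1 by apply/andP; split; [|move: ak => /andP[_ h]; lra].
have injP : injective Posz by move=> i j [].
have injN : injective Negz by move=> i j [].
have HP := trap_sum_rate halpha henv injP ak.
have HN := trap_sum_rate halpha henv injN ak.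
apply: filterS3 HP HN (trap_ge1 halpha henv) => w [C1 C10 HC1] [C2 C20 HC2] tau1.
set m := mean_trap tau in hX hp HC1 HC2 *.
have m1 : 1 <= m := mean_ge1 a0 C10 (fun i => tau1 (Posz i)) HC1.
have m0 : 0 < m by rewrite (lt_le_trans ltr01).
have C120 : 0 < C1 + C2 by exact: addr_gt0.
have [A A0 homA] : exists2 A : R, 0 < A &
    \forall n \near \oo, homogenized n m (fun k => tau k w) (A * n%:R `^ (- (a / 4))).
  apply: (homogenized_environment m0 C120 a1 tau1) => k.
    by apply: (le_trans (HC1 k)); rewrite ler_wpM2r ?powR_ge0// lerDl ltW.
  by apply: (le_trans (HC2 k)); rewrite ler_wpM2r ?powR_ge0// lerDr ltW.
move=> dn Om Pn Xn pn Hn.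
have scale (n : nat) : (0 < n)%N -> n%:R `^ (- (a / 4)) <= n%:R `^ (- E) :> R.
  by move=> n0; apply: ler_powR; [rewrite ler1n|rewrite /a; lra].
split.
- have [C C0 HC] := chain_cdf_approximation m0 ht.
  apply/eqO_exP; exists (C * A); first exact: mulr_gt0.
  near=> n; have n0 : (0 < n)%N by near: n; exact: nbhs_infty_gt.
  have [chain _] := Hn n n0.
  have hom : homogenized n m (fun k => tau k w) (A * n%:R `^ (- (a / 4))).
    by near: n; exact: homA.
  have D0 : 0 <= C * A * n%:R `^ (- E) by rewrite mulr_ge0 ?powR_ge0// ltW// mulr_gt0.
  have bound x : `|prob_le PX X 0 t x - prob_le (Pn n) (Xn n) 0 t x|
      <= C * A * n%:R `^ (- E).
    rewrite (diffusion_cdf m0 hX x ht).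
    apply: (le_trans (HC n _ _ _ _ _ _ hom chain x)).
    by rewrite mulrA ler_pM2l ?mulr_gt0// scale.
  set S := [set _ | _ in _].
  have S0 : S !=set0.
    by exists `|prob_le PX X 0 t 0 - prob_le (Pn n) (Xn n) 0 t 0|; exists 0.
  rewrite (ger0_norm (powR_ge0 _ _)) ger0_norm.
    by apply: ge_sup => // _ [x _ <-]; exact: bound.
  apply: (@le_trans _ _ `|prob_le PX X 0 t 0 - prob_le (Pn n) (Xn n) 0 t 0|) => //.
  apply: ub_le_sup; last by exists 0.
  by exists (C * A * n%:R `^ (- E)) => _ [x _ <-]; exact: bound.
- have T12 : 0 < T1 <= T2 by rewrite hT1 ltW.
  have [C C0 HC] := chain_density_approximation m0 T12 hK.
  pose D := C * A; have D0 : 0 < D by exact: mulr_gt0.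
  have lim : (fun n : nat => (D * n%:R `^ (- (a / 4 - 2 / 3 * E)))%:E) @ \oo -->
      (0 : \bar R).
    apply: cvg_EFin; first exact: nearW.
    rewrite -[X in _ --> X](mulr0 D); apply: cvgMr; apply: cvg_nat_powRN.
    rewrite /a; lra.
  apply: (squeeze_cvge _ (cvg_cst 0%E) lim).
  near=> n; have n0 : (0 < n)%N by near: n; exact: nbhs_infty_gt.
  have n0' : 0 < n%:R :> R by rewrite ltr0n.
  have [chain hpn] := Hn n n0.
  have hom : homogenized n m (fun k => tau k w) (A * n%:R `^ (- (a / 4))).
    by near: n; exact: homA.
  set S := [set _ | _ in _].
  have S0 : (0 <= ereal_sup S)%E.
    apply: (@le_trans _ _ (`|p T1 0 0
      - pn n T1 0 ((Num.floor (n%:R * 0 : R))%:~R / n%:R)|%:E)); first by rewrite lee_fin.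
    apply: ereal_sup_ubound; exists (0, T1) => //=.
    by rewrite normr0 (ltW hK) lexx ltW.
  apply/andP; split; first by rewrite mule_ge0// lee_fin powR_ge0.
  have up : (ereal_sup S <= (D * n%:R `^ (- (a / 4)))%:E)%E.
    apply: ge_ereal_sup => _ [[x s] /= [xK sT] <-]; rewrite lee_fin.
    have s0 : 0 < s by case/andP: sT => h _; exact: lt_le_trans h.
    rewrite (diffusion_density m0 hX x s0 hp).
    by rewrite /D -mulrA; exact: (HC n _ _ _ _ _ _ _ hom chain hpn x s xK sT).
  apply: (le_trans (lee_wpmul2l _ up)); first by rewrite lee_fin powR_ge0.
  rewrite -EFinM lee_fin mulrCA -powRD; last first.
    by apply/implyP => _; rewrite gt_eqF.
  rewrite le_eqVlt; apply/orP; left; apply/eqP; congr (_ * _ `^ _); ring.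
Unshelve. all: by end_near. Qed.
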